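(* Let $m\le n$ be positive integers. If the perfect matching polytope $\mathcal{P}(m,n)$ of the grid graph $\mathcal{G}(m,n)$ is Gorenstein, then $\mathcal{P}(m,n)$ has a unimodal Ehrhart $h$-vector. If $m$ and $n$ are both even, then the perfect matching polytope $\mathcal{P}_T(m,n)$ of the torus graph $\mathcal{G}_T(m,n)$ also has a unimodal Ehrhart $h$-vector.
   Context: The grid graph $\mathcal{G}(m,n)$ has vertex set $\{(i,j)\in\mathbf{Z}^2: 0\le i<n,\ 0\le j<m\}$, with $(i,j),(i',j')$ adjacent iff $|i-i'|+|j-j'|=1$. The torus graph $\mathcal{G}_T(m,n)$ has the same vertices and edges plus the edges $\{(0,j),(n-1,j)\}$ for $0\le j<m$ and $\{(i,0),(i,m-1)\}$ for $0\le i<n$ (edges are unordered pairs of distinct vertices, so no loops or multiple edges). The perfect matching polytope of a graph $G$ is the convex hull in $\mathbf{R}^{E(G)}$ of the incidence vectors of its perfect matchings. For an integral polytope $\mathcal{P}$ of dimension $d$, with $L_{\mathcal{P}}(t)$ the number of integer points in $t\mathcal{P}$, one has $\sum_{t\ge0}L_{\mathcal{P}}(t)z^t=h(z)/(1-z)^{d+1}$ with $h(z)=h_0+h_1z+\dots+h_kz^k$, $h_k\neq0$; $(h_0,\dots,h_k)$ is the Ehrhart $h$-vector. It is unimodal if there is $j$ with $h_0\le\dots\le h_j\ge h_{j+1}\ge\dots\ge h_k$. $\mathcal{P}$ is Gorenstein if for some integer $k$, the number $L_{\mathcal{P}^\circ}(t)$ of integer points in the relative interior of $t\mathcal{P}$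 satisfies $L_{\mathcal{P}^\circ}(t)=L_{\mathcal{P}}(t-k)$ for $t\ge k$ and $L_{\mathcal{P}^\circ}(t)=0$ for $0<t<k$. *)

(* Defs.v *)
From HB Require Import structures.
From mathcomp Require Import all_boot all_order all_algebra finmap.
From mathcomp Require Import boolp classical_sets cardinality reals.

Set Implicit Arguments.
Unset Strict Implicit.
Unset Printing Implicit Defensive.

Import Order.TTheory GRing.Theory Num.Theory.
Local Open Scope classical_set_scope.
Local Open Scope ring_scope.

(* R^o is R as a module over itself; it makes {ffun I -> R^o} the space R^I. *)
Section Polytopes.
Variables (R : realType) (I : finType).
Implicit Types (P S : set {ffun I -> R^o}) (x y : {ffun I -> R^o}).

Definition convex_hull S : set {ffun I -> R^o} :=
  [set y | exists (k : nat) (a : 'I_k -> R) (x : 'I_k -> {ffun I -> R^o}),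
     [/\ forall i, S (x i), forall i, 0 <= a i, \sum_i a i = 1
       & y = \sum_i a i *: x i]].

Definition affine_hull S : set {ffun I -> R^o} :=
  [set y | exists (k : nat) (a : 'I_k -> R) (x : 'I_k -> {ffun I -> R^o}),
     [/\ forall i, S (x i), \sum_i a i = 1 & y = \sum_i a i *: x i]].

Definition relative_interior P : set {ffun I -> R^o} :=
  [set x | P x /\ exists2 e : R, 0 < e &
     forall y, affine_hull P y -> (forall i, `|y i - x i : R| < e) -> P y].

(* The largest d such that P contains d + 1 affinely independent points
   x0, x1, ..., xd. For P empty the value is 0 instead of -1; its Ehrhart
   series is 0 then, so the exponent d + 1 below plays no role. *)
Definition polytope_dim P : nat :=
  \max_(d < #|I|.+1 | `[< exists (x0 : {ffun I -> R^o}) (s : seq {ffun I -> R^o}),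
    [/\ P x0, forall x, x \in s -> P x, size s = d
      & free [seq x - x0 | x <- s]] >]) d.

Definition dilate (t : nat) P : set {ffun I -> R^o} := [set t%:R *: x | x in P].

(* Meaningful for bounded P only: [fset_set] sends infinite sets to fset0. *)
Definition nb_lattice_points P : nat :=
  #|` fset_set [set z : {ffun I -> int} | P [ffun i => (z i)%:~R]] |%fset.

Definition ehrhart P (t : nat) : nat := nb_lattice_points (dilate t P).

Definition ehrhart_interior P (t : nat) : nat :=
  nb_lattice_points (relative_interior (dilate t P)).

(* Coefficientwise form of the identity of formal power series
   h(z) = (1 - z)^(d+1) * sum_(t >= 0) L_P(t) z^t, with d = dim P.
   The sequence (h_0, ..., h_k), h_k != 0, is [polyseq h]. *)
Definition is_ehrhart_h P (h : {poly int}) : Prop :=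
  forall i : nat,
    h`_i = \sum_(j < i.+1)
             ((1 - 'X) ^+ (polytope_dim P).+1 : {poly int})`_j
             * (ehrhart P (i - j)%N)%:Z.

Definition gorenstein P : Prop :=
  exists k : int,
    (forall t : nat, k <= t%:Z ->
       ehrhart_interior P t = ehrhart P (absz (t%:Z - k)%R))
    /\ (forall t : nat, (0 < t)%N -> t%:Z < k -> ehrhart_interior P t = 0%N).

End Polytopes.

Definition unimodal (s : seq int) : Prop :=
  exists j : nat,
    (forall i : nat, (i.+1 < size s)%N -> (i < j)%N -> s`_i <= s`_i.+1)
    /\ (forall i : nat, (i.+1 < size s)%N -> (j <= i)%N -> s`_i.+1 <= s`_i).

Definition has_unimodal_h_vector (R : realType) (I : finType)
    (P : set {ffun I -> R^o}) : Prop :=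
  exists2 h : {poly int}, is_ehrhart_h P h & unimodal h.

Section PerfectMatchingPolytope.
Variables (T : finType) (adj : rel T).

Definition edge : finType :=
  {e : {set T} | [exists u, exists v, adj u v && (e == [set u; v]%SET)]}.

Definition perfect_matching (M : {set edge}) : bool :=
  [forall v : T, #|[set e in M | v \in val e]%SET| == 1%N].

Definition incidence (R : realType) (M : {set edge}) : {ffun edge -> R^o} :=
  [ffun e => (e \in M)%:R].

Definition perfect_matching_polytope (R : realType) : set {ffun edge -> R^o} :=
  convex_hull [set incidence R M | M in [set M | perfect_matching M]].

End PerfectMatchingPolytope.

Arguments perfect_matching_polytope [T] adj R.

Definition grid_adj (m n : nat) : rel ('I_n * 'I_m) :=
  fun u v => (`|u.1 - v.1| + `|u.2 - v.2| == 1)%N.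

Definition torus_adj (m n : nat) : rel ('I_n * 'I_m) :=
  fun u v =>
    [|| grid_adj u v,
        [&& u != v, u.2 == v.2 &
            ((u.1 == 0%N :> nat) && (v.1 == n.-1 :> nat))
            || ((v.1 == 0%N :> nat) && (u.1 == n.-1 :> nat))]
      | [&& u != v, u.1 == v.1 &
            ((u.2 == 0%N :> nat) && (v.2 == m.-1 :> nat))
            || ((v.2 == 0%N :> nat) && (u.2 == m.-1 :> nat))]].

Definition grid_polytope (R : realType) (m n : nat) :=
  perfect_matching_polytope (@grid_adj m n) R.

Definition torus_polytope (R : realType) (m n : nat) :=
  perfect_matching_polytope (@torus_adj m n) R.

Arguments grid_polytope R m n : clear implicits.
Arguments torus_polytope R m n : clear implicits.

(* Main.v *)
(* The integer points of the dilates of the perfect matching polytope of a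
   bipartite graph form the monoid S generated by the perfect matchings (Hall).
   Its pulling triangulation is unimodular, and a generic point v splits the cone
   into half-open simplicial cones; h_i counts the facets whose half-open cone
   omits i faces, and reversing v counts the interior points.  If the interior
   is e + S, this gives h_i = h_(s-i).

   The inequality h_i <= h_(i+1) for 2i < s is a Lefschetz property of the monoid
   algebra over a field of characteristic 2 modulo generic linear forms
   theta_1, ..., theta_D with indeterminate coefficients.  Suppose ell u lies in
   (theta) for the generic linear form ell.  Squares have derivative zero, so
   multiplying by u and differentiating with respect to the indeterminates shows
   that u^2 times any monomial divisible by D+1 matchings lies in (theta_j^2).
   The Cartier operator twisted by e then gives u y in (theta) for all y of
   complementary degree, and duality forces u = 0.  Hence multiplication by ell
   is injective in degree i.

   The Gorenstein property says that the interior is e + S.  An even torus is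
   regular and bipartite, so there e is the all-ones vector. *)

Require Import Defs.
From HB Require Import structures.
From mathcomp Require Import all_boot all_order all_algebra finmap.
From mathcomp Require Import boolp classical_sets cardinality reals.
From mathcomp Require Import mpoly zify ring lra.

Set Implicit Arguments.
Unset Strict Implicit.
Unset Printing Implicit Defensive.

Import Order.TTheory GRing.Theory Num.Theory.
Local Open Scope ring_scope.

(** * Linear algebra over a domain and the Cartier operator *)

(** The bound 2i < s comes from a degree count. Let e have degree r, with s + r = D. For y of degree
    s - i the exponent e + 2y has degree D + (s - 2i), so it contains D + 1 matchings precisely when
    2i < s: one for the derivative that removes ell and one for each theta_j. The twist by e is
    where the Gorenstein property enters: every element of S congruent to e modulo 2 lies above e,
    so the monomial of e divides each square root produced by the Cartier operator.

    No theory of Cohen-Macaulay rings is invoked. Freeness over the theta_j is proved with an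
    explicit basis, one element for each point of S, by degenerating the coefficients along weights
    that make the triangulation regular. Duality is replaced by counting: an f that pairs to zero
    would map the span of S_n, for large n, into a space of smaller dimension, although
    multiplication by a nonzero element of a domain is injective. Since the coefficients form only a
    domain, coordinates carry a common denominator [bd n]. *)

Section SeqLinearAlgebra.
Variables (Q : idomainType) (A B : eqType).
Implicit Types (s : seq A) (t : seq B) (M : A -> B -> Q).

(** Padding with zero columns makes the matrix square and singular; over a domain a vanishing
    determinant already yields a kernel vector. *)
Lemma seq_left_kernel s t M : uniq s -> (size t < size s)%N ->
  exists2 u : A -> Q, exists2 a, a \in s & u a != 0
    & forall b, b \in t -> \sum_(a <- s) u a * M a b = 0.
Proof.
case: s => [//|a0 s0]; set s := a0 :: s0; move=> us lt_ts.
have [t0|] := boolP (t == [::]).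
  by exists (fun=> 1); [exists a0; rewrite ?mem_head ?oner_eq0 | rewrite (eqP t0)].
case: t lt_ts => [//|b0 t0] lt_ts _; set t := b0 :: t0.
pose N := \matrix_(i < size s, j < size s)
  (if (j < size t)%N then M (nth a0 s i) (nth b0 t j) else 0).
have /det0P[u nz_u uN]: \det N == 0.
  rewrite -det_tr; apply/det0P; exists (\row_j (j == Ordinal lt_ts)%:R).
    apply/negP => /eqP/rowP/(_ (Ordinal lt_ts)); rewrite !mxE eqxx => /eqP.
    by rewrite oner_eq0.
  apply/rowP=> j; rewrite !mxE big1 // => i _; rewrite !mxE.
  by case: eqP => [->|_]; rewrite ?mul0r //= ltnn mulr0.
have [i nz_ui]: exists i, u 0 i != 0.
  apply/existsP; apply: contraNT nz_u; rewrite negb_exists => /forallP u0.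
  by apply/eqP/rowP=> i; rewrite mxE; apply/eqP; move: (u0 i); rewrite negbK.
pose v a := if insub (index a s) is Some i then u 0 i else 0.
have vE (k : 'I_(size s)) : v (nth a0 s k) = u 0 k.
  by rewrite /v index_uniq // insubT //= => lt_k; congr (u 0 _); apply: val_inj.
exists v.
  by exists (nth a0 s i); [rewrite mem_nth | rewrite vE].
move=> b tb; rewrite (big_nth a0) big_mkord.
have lt_bt : (index b t < size s)%N by apply: ltn_trans lt_ts; rewrite index_mem.
move/rowP/(_ (Ordinal lt_bt)): uN; rewrite !mxE => uN.
rewrite -[RHS]uN.
by apply: eq_bigr => k _; rewrite vE [N _ _]mxE [in RHS](index_mem b t) tb nth_index.
Qed.

(** Injectivity makes the determinant nonzero, and the adjugate is an inverse up to that factor, so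
    no fraction field is needed. *)
Lemma seq_inverse s t M : uniq s -> uniq t -> size s = size t ->
    (forall x : B -> Q, (forall a, a \in s -> \sum_(b <- t) M a b * x b = 0) ->
       forall b, b \in t -> x b = 0) ->
  exists2 d : Q, d != 0 & exists2 W : B -> A -> Q,
    (forall b b', b \in t -> b' \in t ->
       \sum_(a <- s) W b a * M a b' = d * (b == b')%:R)
  & (forall a a', a \in s -> a' \in s ->
       \sum_(b <- t) M a b * W b a' = d * (a == a')%:R).
Proof.
move=> us ut; case: s us => [|a0 s0] us; case: t ut => [|b0 t0] ut // eq_st inj.
  by exists 1; rewrite ?oner_eq0 //; exists (fun _ _ => 0).
set s := a0 :: s0 in us eq_st inj *; set t := b0 :: t0 in ut eq_st inj *.
pose N := \matrix_(i < size s, j < size s) M (nth a0 s i) (nth b0 t j).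
have nzN : \det N != 0.
  apply/negP; rewrite -det_tr => /det0P[u nz_u uN]; move/negP: nz_u; apply.
  pose x b := if insub (index b t) is Some i then u 0 i else 0.
  have xE (k : 'I_(size s)) : x (nth b0 t k) = u 0 k.
    rewrite /x index_uniq -?eq_st // insubT //= => lt_k.
    by congr (u 0 _); apply: val_inj.
  apply/eqP/rowP=> i; rewrite mxE -xE; apply: inj; last first.
    by rewrite mem_nth // -eq_st.
  move=> a sa; rewrite (big_nth b0) big_mkord -eq_st.
  have lt_as : (index a s < size s)%N by rewrite index_mem.
  move/rowP/(_ (Ordinal lt_as)): uN; rewrite !mxE => uN; rewrite -[RHS]uN.
  by apply: eq_bigr => k _; rewrite xE !mxE /= nth_index // mulrC.
exists (\det N) => //.
pose W b a := if insub (index b t) is Some i then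
  if insub (index a s) is Some j then (\adj N) i j else 0 else 0.
have WE (i j : 'I_(size s)) : W (nth b0 t i) (nth a0 s j) = (\adj N) i j.
  rewrite /W !index_uniq -?eq_st // insubT //= => lt_i; rewrite insubT //= => lt_j.
  by congr (\adj N _ _); apply: val_inj.
exists W => [b b' tb tb'|a a' sa sa'].
  have lt_b : (index b t < size s)%N by rewrite eq_st index_mem.
  have lt_b' : (index b' t < size s)%N by rewrite eq_st index_mem.
  have /matrixP/(_ (Ordinal lt_b) (Ordinal lt_b')) := mul_adj_mx N.
  rewrite !mxE (big_nth a0) big_mkord => e.
  rewrite -[RHS]mulr_natr in e; rewrite -{1}(nth_index b0 tb).
  rewrite -[b in b == _](nth_index b0 tb) -[b' in _ == b'](nth_index b0 tb').
  rewrite nth_uniq ?index_mem //.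
  transitivity (\sum_(j < size s) (\adj N) (Ordinal lt_b) j * N j (Ordinal lt_b')).
    apply: eq_bigr => k _; rewrite -(WE (Ordinal lt_b) k) [N _ _]mxE.
    by congr (_ * M _ _); rewrite -[LHS](nth_index b0 tb').
  by rewrite e.
have lt_a : (index a s < size s)%N by rewrite index_mem.
have lt_a' : (index a' s < size s)%N by rewrite index_mem.
have /matrixP/(_ (Ordinal lt_a) (Ordinal lt_a')) := mul_mx_adj N.
rewrite !mxE (big_nth b0) big_mkord -eq_st => e.
rewrite -[RHS]mulr_natr in e; rewrite -{1}(nth_index a0 sa).
rewrite -[a in a == _](nth_index a0 sa) -[a' in _ == a'](nth_index a0 sa').
rewrite nth_uniq ?index_mem //.
transitivity (\sum_(j < size s) N (Ordinal lt_a) j * (\adj N) j (Ordinal lt_a')).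
  apply: eq_bigr => k _; rewrite -(WE k (Ordinal lt_a')) [N _ _]mxE.
  by congr (M _ _ * W _ _); rewrite -[LHS](nth_index a0 sa').
by rewrite e.
Qed.

End SeqLinearAlgebra.

Section CoefficientMaps.
Variables (n : nat) (Q : comNzRingType).
Implicit Types (phi : {additive Q -> Q}) (f g : {mpoly Q[n]}) (m : 'X_{1..n}).

Definition coef_map phi f : {mpoly Q[n]} :=
  \sum_(m <- msupp f) phi f@_m *: 'X_[m].

(* For a ring of characteristic 2 and [phi] a square root map, [coef_sqrt phi]
   is the Cartier operator: it sends [c X^(2m)] to [phi c X^m]. *)
Definition coef_sqrt phi f : {mpoly Q[n]} :=
  \sum_(m <- msupp f | [forall i, ~~ odd (m i)])
    phi f@_m *: 'X_[[multinom (m i)./2 | i < n]].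

Lemma sum_delta_msupp phi f (P : pred 'X_{1..n}) m0 :
    (forall m, P m = (m == m0)) ->
  \sum_(m <- msupp f) phi f@_m * (P m)%:R = phi f@_m0.
Proof.
move=> PE; have [m0f|m0f] := boolP (m0 \in msupp f).
  rewrite (bigD1_seq m0) ?msupp_uniq //= PE eqxx mulr1 big1 ?addr0 // => m.
  by rewrite PE => /negPf->; rewrite mulr0.
rewrite (memN_msupp_eq0 m0f) raddf0 big_seq big1 // => m mf; rewrite PE.
by case: eqP mf m0f => [->->|] //; rewrite mulr0.
Qed.

Lemma mcoeff_coef_map phi f m : (coef_map phi f)@_m = phi f@_m.
Proof.
rewrite /coef_map raddf_sum /= -[RHS](@sum_delta_msupp _ _ (pred1 m)) //.
by apply: eq_bigr => m1 _; rewrite mcoeffZ mcoeffX.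
Qed.

Lemma mcoeff_coef_sqrt phi f m : (coef_sqrt phi f)@_m = phi f@_(m + m).
Proof.
rewrite /coef_sqrt raddf_sum /= big_mkcond /=.
rewrite -[RHS](@sum_delta_msupp _ _ (pred1 (m + m)%MM)) //.
apply: eq_bigr => m1 _; rewrite /= mcoeffZ mcoeffX.
case: ifPn => [/forallP ev1|odd1].
  congr (_ * _%:R); congr nat_of_bool; apply/eqP/eqP => [<-|->]; apply/mnmP => i.
    by rewrite mnmDE mnmE addnn -[LHS]odd_double_half (negPf (ev1 i)).
  by rewrite mnmE mnmDE addnn doubleK.
case: eqP odd1 => [-> /forallP[] i|]; last by rewrite mulr0.
by rewrite mnmDE addnn odd_double.
Qed.

Lemma mcoeffMX_sub f m k :
  (f * 'X_[m])@_k = if (m <= k)%MM then f@_(k - m) else 0.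
Proof.
case: ifPn => [le_mk|nle_mk].
  by rewrite -{1}(submK le_mk) addmC mcoeffMX.
apply: memN_msupp_eq0; rewrite (perm_mem (msuppMX _ _)).
by apply: contra nle_mk => /mapP[m' _ ->]; rewrite lem_addr.
Qed.

Lemma coef_map_is_additive phi : additive (coef_map phi).
Proof.
move=> f g; apply/mpolyP => m.
by rewrite mcoeffB !mcoeff_coef_map mcoeffB raddfB.
Qed.

HB.instance Definition _ phi :=
  GRing.isAdditive.Build {mpoly Q[n]} {mpoly Q[n]} (coef_map phi)
    (coef_map_is_additive phi).

Lemma coef_sqrt_is_additive phi : additive (coef_sqrt phi).
Proof.
move=> f g; apply/mpolyP => m.
by rewrite mcoeffB !mcoeff_coef_sqrt mcoeffB raddfB.
Qed.

HB.instance Definition _ phi :=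
  GRing.isAdditive.Build {mpoly Q[n]} {mpoly Q[n]} (coef_sqrt phi)
    (coef_sqrt_is_additive phi).

Lemma coef_mapZX phi c m : coef_map phi (c *: 'X_[m]) = phi c *: 'X_[m].
Proof.
apply/mpolyP => m1; rewrite mcoeff_coef_map !mcoeffZ !mcoeffX.
by case: eqP; rewrite ?mulr1 ?mulr0 ?raddf0.
Qed.

Lemma coef_mapM phi :
    (forall x y : Q, phi (x * y) = phi x * y + x * phi y) ->
  forall f g, coef_map phi (f * g) = coef_map phi f * g + f * coef_map phi g.
Proof.
move=> phiM f g; elim/mpolyind: f => [|c m f _ _ IHf].
  by rewrite raddf0 !mul0r raddf0 addr0.
rewrite mulrDl !raddfD /= IHf !mulrDl -!addrA; set a := coef_map phi f * g.
suff -> : coef_map phi (c *: 'X_[m] * g) =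
  coef_map phi (c *: 'X_[m]) * g + c *: 'X_[m] * coef_map phi g.
  by rewrite -!addrA; congr (_ + _); rewrite addrCA.
elim/mpolyind: g {a IHf} => [|d m' g _ _ IHg].
  by rewrite raddf0 !mulr0 raddf0 addr0.
rewrite !(mulrDr, raddfD) /= IHg -!scalerAl -!scalerAr !scalerA -mpolyXD.
rewrite !coef_mapZX phiM -!scalerAl -!scalerAr -!mpolyXD scalerDl !scalerA.
by rewrite addrACA [d * _]mulrC.
Qed.

(** Squaring is additive in characteristic 2, so both sides are additive in [f] and it suffices to
    treat a single term, where coefficients can be compared. *)
Lemma coef_sqrtM phi : (2 \in [pchar Q])%N ->
    (forall x y : Q, phi (x ^+ 2 * y) = x * phi y) ->
  forall f g, coef_sqrt phi (f ^+ 2 * g) = f * coef_sqrt phi g.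
Proof.
move=> pcharQ phiM f g; have pcharR : (2 \in [pchar {mpoly Q[n]}])%N.
  rewrite inE /=; apply/eqP; rewrite -mpolyC_nat; case/andP: pcharQ => _ /eqP->.
  by rewrite mpolyC0.
elim/mpolyind: f => [|c m f _ _ IHf].
  by rewrite expr0n /= !mul0r raddf0.
have -> : (c *: 'X_[m] + f) ^+ 2 = (c *: 'X_[m]) ^+ 2 + f ^+ 2.
  by rewrite sqrrD -mulr_natr (pcharf0 pcharR) mulr0 addr0.
rewrite !mulrDl raddfD /= IHf; congr (_ + _).
apply/mpolyP => k; rewrite mcoeff_coef_sqrt exprZn mpolyXn mulmS mulm1n -!scalerAl.
rewrite !mcoeffZ !(mulrC 'X_[_]) !mcoeffMX_sub mcoeff_coef_sqrt.
have -> : (m + m <= k + k)%MM = (m <= k)%MM.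
  apply/mnm_lepP/mnm_lepP => le_mk i; move: (le_mk i); rewrite !mnmDE; lia.
case: ifP => [le_mk|]; last by rewrite mulr0 raddf0 mulr0.
rewrite phiM; congr (_ * phi _@_ _); apply/mnmP => i.
by move/mnm_lepP/(_ i): le_mk; rewrite !(mnmDE, mnmBE); lia.
Qed.

End CoefficientMaps.

Lemma bin_step (D y : nat) :
  ('C(y.+1 + D, D) * y.+1 = 'C(y + D, D) * (y.+1 + D))%N.
Proof.
have := mul_bin_down (y.+1 + D) D; rewrite addnK => e.
by rewrite mulnC -e mulnC addSn.
Qed.

(** The binomial is a polynomial in [y], so its ratio over a bounded shift tends to 1. In
    [size_SS_growth], with [c] the number of facets, this lets the points over a single facet
    outweigh the growth of the whole monoid from degree n to degree j + n. *)
Lemma bin_slow_growth (D q c : nat) : exists y0, forall y, (y0 <= y)%N ->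
  (c * 'C(y + q + D, D) < c.+1 * 'C(y + D, D))%N.
Proof.
elim: q c => [|q IHq] c.
  exists 0%N => y _; rewrite addn0 mulSn -{1}[(c * _)%N]add0n ltn_add2r.
  by rewrite bin_gt0 leq_addl.
(* Two factors (2c + 2)/(2c + 1) multiply to less than (c + 1)/c, because 4c(c + 1) < (2c + 1)^2. *)
have [y0 Hy0] := IHq (2 * c).+1; exists (y0 + ((2 * c).+1 * D).+1)%N => y le_y.
have {Hy0} := Hy0 y; rewrite addnS addSn; set A := 'C(y + q + D, D).
set B := 'C(_ + D, D); set A' := 'C(_, _) => IH.
have {}IH := IH ltac:(lia).
have st : ((2 * c).+1 * A' <= (2 * c).+2 * A)%N.
  have := bin_step D (y + q); rewrite addSn -/A -/A' => eA.
  rewrite -(@leq_pmul2r (y + q).+1) // -!mulnA eA.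
  have : (((2 * c).+1 * ((y + q).+1 + D)) <= (2 * c).+2 * (y + q).+1)%N by lia.
  by move=> le; rewrite [(A * _)%N]mulnC [(A * _)%N]mulnC !mulnA leq_mul2r le orbT.
have pB : (0 < B)%N by rewrite bin_gt0 leq_addl.
rewrite -(@ltn_pmul2l ((2 * c).+1 * (2 * c).+1)) //.
have : ((2 * c).+1 * (2 * c).+1 * (c * A') < (2 * c).+1 * (2 * c).+1 * (c.+1 * B))%N.
  have h1 : ((2 * c).+1 * (2 * c).+1 * (c * A') <= (2 * c).+1 * c * ((2 * c).+2 * A))%N.
    by rewrite -!mulnA leq_mul2l /= [X in (X <= _)%N]mulnCA leq_mul2l st orbT.
  apply: leq_ltn_trans h1 _.
  case: c IH {st y0 le_y} => [|c] IH; first by rewrite muln0 mul0n !mul1n.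
  have h2 : ((2 * c.+1).+1 * c.+1 * ((2 * c.+1).+2 * A) < c.+1 * (2 * c.+1).+2 * ((2 * c.+1).+2 * B))%N.
    rewrite [X in (X < _)%N](_ : _ = c.+1 * (2 * c.+1).+2 * ((2 * c.+1).+1 * A))%N; last by ring.
    by rewrite ltn_pmul2l.
  apply: leq_trans h2 _; nia.
by [].
Qed.

(** * Half-open cones and their series *)

Section CompositionCount.
Variables (N : nat) (X : eqType) (f : ('I_N -> nat) -> X) (s r : {set 'I_N}).
Hypothesis r_sub : r \subset s.

Definition half_open (c : 'I_N -> nat) :=
  (forall p, p \notin s -> c p = 0%N) /\ (forall p, p \in r -> (0 < c p)%N).

Hypothesis f_ext : forall c c', c =1 c' -> f c = f c'.
Hypothesis f_inj : forall c c', half_open c -> half_open c' -> f c = f c' -> c =1 c'.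

(** For D > 0 this is the coefficient of z^n in z^k / (1 - z)^D, the series of a simplicial cone of
    dimension D without k of its faces. *)
Definition cone_count (D n k : nat) : nat :=
  if (k <= n)%N then 'C(n - k + D.-1, D.-1) else 0%N.

(** Subtracting 1 on [r] leaves an arbitrary vector on [s] of sum n - |r|, and such vectors are
    counted as weak compositions. *)
Lemma half_open_size n (L : seq X) : (0 < #|s|)%N -> uniq L ->
    (forall m, m \in L <->
       exists c, [/\ half_open c, (\sum_p c p)%N = n & m = f c]) ->
  size L = cone_count #|s| n #|r|.
Proof.
move=> s0 uL memL; have [dp dps] := card_gt0P s0.
have inr p : p \notin s -> (p \in r) = false.
  by move=> sp; apply/negP => /(fintype.subsetP r_sub); rewrite (negPf sp).
have ho_sum c : half_open c ->
    (\sum_p c p = #|r| + \sum_(p in s) (c p - (p \in r)))%N.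
  case=> c0 c1; rewrite (bigID (mem s)) /= [X in (_ + X)%N = _]big1 ?addn0; last first.
    by move=> p /c0.
  rewrite -sum1_card; have -> : (\sum_(p in r) 1 = \sum_(p in s) (p \in r))%N.
    rewrite big_mkcond [RHS]big_mkcond; apply: eq_bigr => p _.
    by case: ifPn => [/(fintype.subsetP r_sub)->|_] //; case: ifP.
  rewrite -big_split; apply: eq_bigr => p _ /=; rewrite subnKC //.
  by case: (boolP (p \in r)) => // /c1.
rewrite /cone_count; case: leqP => [le_n|gt_n]; last first.
  apply/eqP; rewrite size_eq0; case: L uL memL => // m L _ memL.
  have /memL[c [/ho_sum hc cn _]] := mem_head m L; lia.
set k := (n - _)%N; set D := #|s| in s0 *.
pose A := [set t : D.-1.+1.-tuple 'I_k.+1 | (\sum_(i <- t) i == k)%N].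
rewrite addnC -(card_ord_partitions D.-1 k) -/A.
pose vx (j : nat) := nth dp (enum s) j.
have vx_in j : (j < D)%N -> vx j \in s by move=> ?; rewrite -mem_enum mem_nth -?cardE.
have big_vx (h : 'I_N -> nat) : (\sum_(p in s) h p = \sum_(j < D) h (vx j))%N.
  by rewrite -big_enum (big_nth dp) big_mkord -cardE.
pose cc (t : D.-1.+1.-tuple 'I_k.+1) p : nat :=
  if p \in s then ((p \in r) + nth ord0 t (index p (enum s)))%N else 0%N.
have ccE t (j : 'I_D) : cc t (vx j) = ((vx j \in r) + nth ord0 t j)%N.
  by rewrite /cc vx_in // index_uniq ?enum_uniq // -cardE.
have cc_ho t : half_open (cc t).
  split=> p; rewrite /cc; first by move/negPf->.
  by move=> rp; rewrite (fintype.subsetP r_sub) // rp.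
have cc_sum t : (\sum_p cc t p = #|r| + \sum_(i <- t) i)%N.
  rewrite ho_sum // big_vx (big_nth ord0) (_ : size t = D) ?size_tuple ?prednK //.
  by rewrite big_mkord; congr (_ + _)%N; apply: eq_bigr => j _; rewrite ccE addKn.
rewrite cardE -(size_map (fun t => f (cc t))).
apply/perm_size/uniq_perm => //.
  rewrite map_inj_in_uniq ?enum_uniq // => t t' _ _ /(f_inj (cc_ho t) (cc_ho t')) e.
  apply/val_inj/(@eq_from_nth _ ord0); first by rewrite !size_tuple.
  move=> i lt_i; have {}lt_i : (i < D)%N by move: lt_i; rewrite size_tuple; lia.
  by apply/val_inj; have := e (vx i); rewrite !(ccE _ (Ordinal lt_i)) => /addnI.
move=> m; apply/idP/mapP => [/memL[c [hc cn ->]]|[t]]; last first.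
  rewrite mem_enum inE => /eqP tk ->; apply/memL; exists (cc t); split=> //.
  by rewrite cc_sum tk subnKC.
have kE : k = (\sum_(j < D) (c (vx j) - (vx j \in r)))%N.
  by rewrite /k -cn ho_sum // addKn big_vx.
have lt_e (j : nat) : (j < D)%N -> (c (vx j) - (vx j \in r) < k.+1)%N.
  by move=> lt_j; rewrite ltnS kE (bigD1 (Ordinal lt_j)) //= leq_addr.
pose t := [tuple inord (c (vx i) - (vx i \in r)) | i < D.-1.+1] :
   D.-1.+1.-tuple 'I_k.+1.
have tE (j : 'I_D) : nth ord0 t j = (c (vx j) - (vx j \in r))%N :> nat.
  have lt_j : (j < D.-1.+1)%N by rewrite prednK.
  rewrite -[nat_of_ord j]/(nat_of_ord (Ordinal lt_j)) -tnth_nth tnth_mktuple.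
  by rewrite inordK //; apply: lt_e; apply: (ltn_ord j).
have cct : c =1 cc t.
  move=> p; have [sp|sp] := boolP (p \in s); last by case: (cc_ho t) => -> //; case: hc => ->.
  have lt_p : (index p (enum s) < D)%N by rewrite /D cardE index_mem mem_enum.
  have <- : vx (Ordinal lt_p) = p by rewrite /vx nth_index ?mem_enum.
  rewrite ccE tE subnKC //; case: (boolP (_ \in r)) => //; by case: hc => _; apply.
exists t; last exact: f_ext.
rewrite mem_enum inE; apply/eqP; apply: (@addnI #|r|).
rewrite -cc_sum -(eq_bigr _ (fun p _ => cct p)) cn /k subnKC //.
Qed.

End CompositionCount.

Section BinomialSeries.

Definition series_conv (p : {poly int}) (f : nat -> int) (n : nat) : int :=
  \sum_(j < n.+1) p`_j * f (n - j)%N.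

Lemma series_conv_poly p f n :
  series_conv p f n = (p * \poly_(i < n.+1) f i)`_n.
Proof.
rewrite coefM; apply: eq_bigr => j _; rewrite coef_poly.
by rewrite ltnS leq_subr.
Qed.

Lemma eq_series_conv p f f' n : f =1 f' -> series_conv p f n = series_conv p f' n.
Proof. by move=> e; apply: eq_bigr => j _; rewrite e. Qed.

Lemma series_conv_sum p n (I : Type) (r : seq I) (P : pred I) (f : I -> nat -> int) :
  series_conv p (fun m => \sum_(i <- r | P i) f i m) n =
  \sum_(i <- r | P i) series_conv p (f i) n.
Proof.
by rewrite exchange_big; apply: eq_bigr => j _ /=; rewrite mulr_sumr.
Qed.

Lemma binomial_series_inverse d n :
  series_conv ((1 - 'X) ^+ d.+1) (fun i => 'C(i + d, d)%:Z) n = (n == 0)%:Z.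
Proof.
elim: d => [|d IHd].
  rewrite series_conv_poly expr1 mulrBl mul1r coefB coefXM !coef_poly ltnSn bin0.
  by case: n => [|n] //=; rewrite ltnS leqnSn bin0 subrr.
rewrite -IHd !series_conv_poly exprSr -mulrA !coefM.
apply: eq_bigr => j _; congr (_ * _).
rewrite mulrBl mul1r coefB coefXM !coef_poly ltnS leq_subr.
case: (n - j)%N (leq_subr j n) => [|i] le_i /=; first by rewrite subr0 !add0n !binn.
rewrite (_ : i < n.+1)%N 1?ltnW // addSn binS -addSnnS.
by rewrite PoszD addrAC subrr add0r.
Qed.

Lemma cone_series D n k : (0 < D)%N ->
  series_conv ((1 - 'X) ^+ D) (fun i => (cone_count D i k)%:Z) n = (n == k)%:Z.
Proof.
case: D => // d _; rewrite /cone_count /=; case: (leqP k n) => [le_kn|lt_nk]; last first.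
  rewrite /series_conv big1 => [|j _]; first by rewrite (ltn_eqF lt_nk).
  by rewrite leqNgt (leq_ltn_trans (leq_subr _ _) lt_nk) mulr0.
have -> : (n == k) = ((n - k)%N == 0)%N.
  by rewrite subn_eq0 eqn_leq le_kn andbT.
rewrite -(binomial_series_inverse d) /series_conv.
rewrite [RHS](big_ord_widen n.+1 (fun j => ((1 - 'X) ^+ d.+1)`_j *
   ('C(n - k - j + d, d))%:Z)); last by rewrite ltnS leq_subr.
rewrite [RHS]big_mkcond; apply: eq_bigr => j _ /=.
rewrite ltnS (_ : (k <= n - j)%N = (j <= n - k)%N); last by have := ltn_ord j; lia.
by case: ifP => _; rewrite ?mulr0 // subnAC.
Qed.

Lemma Posz_sum (I : Type) (r : seq I) (P : pred I) (f : I -> nat) :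
  (\sum_(i <- r | P i) f i)%N%:Z = \sum_(i <- r | P i) (f i)%:Z.
Proof. exact: (big_morph Posz PoszD). Qed.

Lemma card_cone_series (D : nat) (I : finType) (P : pred I) (f : I -> nat) k :
    (0 < D)%N ->
  series_conv ((1 - 'X) ^+ D)
    (fun n => (\sum_(i | P i) cone_count D n (f i))%N%:Z) k =
  #|[set i | P i & f i == k]|%:Z.
Proof.
move=> D0; rewrite (eq_series_conv _ _ (fun n => Posz_sum _ _ _)).
rewrite series_conv_sum -sum1_card Posz_sum.
rewrite (eq_bigr _ (fun i _ => cone_series k (f i) D0)).
rewrite big_mkcond [RHS]big_mkcond; apply: eq_bigr => i _.
by rewrite inE eq_sym; case: (P i) => //=; case: eqP.
Qed.

(** Multiplying the series by (1 - z)^D isolates the multiplicities, so the counting function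
    determines how many cones omit [k] faces. *)
Lemma cone_count_eq (D : nat) (I J : finType) (P : pred I) (P' : pred J)
    (a : I -> nat) (b : J -> nat) : (0 < D)%N ->
    (forall n, (\sum_(i | P i) cone_count D n (a i) =
                \sum_(j | P' j) cone_count D n (b j))%N) ->
  forall k, #|[set i | P i & a i == k]| = #|[set j | P' j & b j == k]|.
Proof.
move=> D0 eq_ab k; apply/eqP; rewrite -eqz_nat -!(card_cone_series _ _ _ D0).
by apply/eqP/eq_series_conv => n; rewrite eq_ab.
Qed.

End BinomialSeries.

(** * Squaring generic linear forms in characteristic 2 *)

Section FrobeniusDescent.
Variables (R : comNzRingType) (D : nat) (theta : 'I_D -> R).
Hypothesis pcharR : 2 \in [pchar R].

Lemma oppr_pchar2E (x : R) : - x = x.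
Proof. exact: (oppr_pchar2 pcharR). Qed.

(* Differentiating a membership [F \in (theta)] in the direction of one
   [theta k] upgrades the generator [theta k] to its square, at the price of
   the factor [y = d (theta k)]. *)
Lemma square_generator (k : 'I_D) (d : {additive R -> R}) (y F : R)
    (t : 'I_D -> R) :
    (forall f g, d (f * g) = d f * g + f * d g) -> d F = 0 ->
    (forall j, d (theta j) = if j == k then y else 0) ->
    F = \sum_j theta j ^+ (if (j < k)%N then 2 else 1) * t j ->
  exists t' : 'I_D -> R,
    y * F = \sum_j theta j ^+ (if (j < k.+1)%N then 2 else 1) * t' j.
Proof.
move=> dM dF dth FE; set e := fun j : 'I_D => if (j < k)%N then 2%N else 1%N.
have d2 x : d (x ^+ 2) = 0.
  by rewrite expr2 dM -[X in _ + X]mulrC -{1}[d x * x]oppr_pchar2E addNr.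
(* Since F has derivative zero, differentiating its expression puts [y * t k] into the ideal of the
   current generators; the generators that are already squared have derivative zero. *)
have ytk : y * t k = \sum_j theta j ^+ e j * d (t j).
  have: d F = \sum_j ((if j == k then y * t k else 0) + theta j ^+ e j * d (t j)).
    rewrite {1}FE raddf_sum; apply: eq_bigr => j _; rewrite dM; congr (_ + _).
    rewrite /e; case: ifPn => [lt_jk|ge_jk].
      by rewrite d2 mul0r; case: eqP lt_jk => [->|]; rewrite ?ltnn.
    by rewrite dth; case: eqP => [->|]; rewrite ?mul0r.
  rewrite dF big_split /= -big_mkcond big_pred1_eq => /esym/eqP.
  by rewrite addr_eq0 oppr_pchar2E => /eqP.
(* Substituting [ytk] into [theta k * (y * t k)] produces the summand [theta k ^+ 2 * d (t k)],
   which is the origin of the square. *)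
exists (fun j => if j == k then d (t k) else y * t j + theta k * d (t j)).
rewrite FE mulr_sumr (bigD1 k) //= ltnn expr1 mulrCA ytk mulr_sumr.
rewrite [X in X + _](bigD1 k) //= [in RHS](bigD1 k) //= eqxx /e ltnn ltnSn.
rewrite expr1 expr2 mulrA -addrA; congr (_ + _); rewrite -big_split /=.
apply: eq_bigr => j nkj; rewrite (negPf nkj).
have -> : (j < k.+1)%N = (j < k)%N.
  by rewrite ltnS leq_eqVlt (inj_eq val_inj) (negPf nkj).
by rewrite mulrDr mulrCA [y * _]mulrCA addrC.
Qed.

End FrobeniusDescent.

(* A domain of characteristic 2 freely generated by the parameters [par t],
   with partial derivatives [dpar t] and a Frobenius splitting [rpar]; the
   polynomial ring over F_2 is such a domain. *)
Record generic_domain (T : finType) := GenericDomain {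
  gd_dom :> idomainType;
  gd_pchar : 2 \in [pchar gd_dom];
  par : T -> gd_dom;
  dpar : T -> {additive gd_dom -> gd_dom};
  rpar : {additive gd_dom -> gd_dom};
  dparM : forall t x y, dpar t (x * y) = dpar t x * y + x * dpar t y;
  dpar_par : forall t t', dpar t (par t') = (t' == t)%:R;
  rpar1 : rpar 1 = 1;
  rparM : forall x y, rpar (x ^+ 2 * y) = x * rpar y;
  gd_free : forall (C : comNzRingType) (c : T -> C), 2 \in [pchar C] ->
    exists f : {rmorphism gd_dom -> C}, forall t, f (par t) = c t;
  gd_ext : forall (C : comNzRingType) (f h : {rmorphism gd_dom -> C}),
    (forall t, f (par t) = h (par t)) -> f =1 h }.

(** * The polynomial ring over F_2 as a generic domain *)

Section GenericDomainExists.
Variable T : finType.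
Local Notation Q := {mpoly 'F_2[#|T|]}.

Lemma pchar_mpolyF2 : 2 \in [pchar Q].
Proof.
by rewrite inE /= -mpolyC_nat (_ : 2%:R = 0 :> 'F_2) ?mpolyC0 //; apply/eqP.
Qed.

Lemma mderiv_mpolyX (t t' : T) :
  mderiv (enum_rank t) ('X_(enum_rank t') : Q) = (t' == t)%:R.
Proof.
rewrite mderivX mnm1E (inj_eq enum_rank_inj).
case: eqP => [->|_]; last by rewrite scale0r.
rewrite scale1r (_ : (_ - _)%MM = 0%MM) ?mpolyX0 //.
by apply/mnmP => i; rewrite mnmBE subnn mnmE.
Qed.

Lemma coef_sqrt1_mpolyF2 : coef_sqrt idfun (1 : Q) = 1.
Proof.
apply/mpolyP => m; rewrite mcoeff_coef_sqrt !mcoeff1 /= mnmD_eq0 andbb //.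
Qed.

Lemma coef_sqrt_mpolyF2 (x y : Q) :
  coef_sqrt idfun (x ^+ 2 * y) = x * coef_sqrt idfun y.
Proof.
apply: coef_sqrtM => [|c d] //=.
by congr (_ * _); apply/eqP; case: c => [[|[]]].
Qed.

Section F2Morphism.
Variables (C : comNzRingType) (pcharC : 2 \in [pchar C]).

Definition natr_F2 (x : 'F_2) : C := (x : nat)%:R.

Lemma natr_F2E (k : nat) : natr_F2 k%:R = k%:R.
Proof.
rewrite /natr_F2 val_Fp_nat // [in RHS](divn_eq k 2) natrD natrM.
by rewrite (pcharf0 pcharC) mulr0 add0r.
Qed.

Lemma natr_F2_is_additive : additive natr_F2.
Proof.
move=> x y; rewrite -[x]natr_Zp -[y]natr_Zp.
have -> (k : nat) : - (k%:R : 'F_2) = k%:R.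
  by apply: oppr_pchar2; apply: pchar_Fp.
by rewrite -natrD !natr_F2E natrD (oppr_pchar2 pcharC).
Qed.

Lemma natr_F2_is_multiplicative : multiplicative natr_F2.
Proof.
split=> [x y|]; last exact: (natr_F2E 1).
by rewrite -[x]natr_Zp -[y]natr_Zp -natrM !natr_F2E natrM.
Qed.

HB.instance Definition _ :=
  GRing.isAdditive.Build 'F_2 C natr_F2 natr_F2_is_additive.
HB.instance Definition _ :=
  GRing.isMultiplicative.Build 'F_2 C natr_F2 natr_F2_is_multiplicative.

Lemma mpolyF2_free (c : T -> C) :
  exists f : {rmorphism Q -> C}, forall t, f 'X_(enum_rank t) = c t.
Proof.
exists (mmap natr_F2 (fun i => c (enum_val i))) => t.
by rewrite /= mmapX mmap1U enum_rankK.
Qed.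

End F2Morphism.

Lemma mpolyF2_ext (C : comNzRingType) (f h : {rmorphism Q -> C}) :
  (forall t : T, f 'X_(enum_rank t) = h 'X_(enum_rank t)) -> f =1 h.
Proof.
move=> fh; elim/mpolyind => [|c m p _ _ IHp]; first by rewrite !rmorph0.
rewrite !rmorphD /= IHp -mul_mpolyC !rmorphM /= -[c]natr_Zp mpolyC_nat !rmorph_nat.
rewrite mpolyXE_id !rmorph_prod /=; congr (_ * _ + _); apply: eq_bigr => i _.
by rewrite !rmorphXn /=; have := fh (enum_val i); rewrite enum_valK => ->.
Qed.

Definition mpolyF2_generic : generic_domain T :=
  @GenericDomain T Q pchar_mpolyF2 (fun t => 'X_(enum_rank t))
    (fun t => mderiv (enum_rank t)) (coef_sqrt idfun)
    (fun t => mderivM (enum_rank t)) mderiv_mpolyX coef_sqrt1_mpolyF2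
    coef_sqrt_mpolyF2
    (fun C c pcharC => mpolyF2_free pcharC c) mpolyF2_ext.

End GenericDomainExists.

Definition parameter (D N : nat) : finType := (('I_D * 'I_N) + 'I_N)%type.

Section GenericForms.
Variables (l N D : nat) (g : 'I_N -> 'X_{1..l}).
Variable Q : generic_domain (parameter D N).
Local Notation R := {mpoly Q[l]}.

Definition theta (j : 'I_D) : R :=
  \sum_(p < N) par Q (inl (j, p)) *: 'X_[g p].

Lemma thetaE j : theta j = \sum_(p < N) par Q (inl (j, p)) *: 'X_[g p].
Proof. by []. Qed.

Definition ell : R := \sum_(p < N) par Q (inr p) *: 'X_[g p].
Definition in_theta (f : R) : Prop :=
  exists t : 'I_D -> R, f = \sum_j theta j * t j.

Definition par_deriv (t : parameter D N) : R -> R := coef_map (dpar Q t).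
HB.instance Definition _ t := GRing.Additive.on (par_deriv t).

Definition poly_sqrt : R -> R := coef_sqrt (rpar Q).
HB.instance Definition _ := GRing.Additive.on poly_sqrt.

Lemma pchar_mpoly_generic : 2 \in [pchar R].
Proof. by rewrite inE /= -mpolyC_nat (pcharf0 (gd_pchar Q)) mpolyC0. Qed.

Lemma poly_sqrtM f h : poly_sqrt (f ^+ 2 * h) = f * poly_sqrt h.
Proof. by apply: coef_sqrtM; [apply: gd_pchar | apply: rparM]. Qed.

Lemma poly_sqrtX m : poly_sqrt 'X_[m + m] = 'X_[m].
Proof.
apply/mpolyP => k; rewrite mcoeff_coef_sqrt !mcoeffX.
have -> : ((m + m)%MM == (k + k)%MM) = (m == k).
  apply/eqP/eqP => [e|->//]; apply/mnmP => i; move/mnmP/(_ i): e.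
  by rewrite !mnmDE; lia.
by case: eqP; rewrite ?rpar1 ?raddf0.
Qed.

Lemma par_derivM t f h :
  par_deriv t (f * h) = par_deriv t f * h + f * par_deriv t h.
Proof. by apply: coef_mapM; apply: dparM. Qed.

Lemma dpar1 t : dpar Q t 1 = 0.
Proof.
have := dparM t (1 : Q) 1; rewrite !mulr1 !mul1r => /esym/eqP.
by rewrite -[X in _ == X]addr0 (inj_eq (addrI _)) => /eqP.
Qed.

Lemma par_derivX t m : par_deriv t 'X_[m] = 0.
Proof.
by rewrite /par_deriv -['X_[m]]scale1r coef_mapZX dpar1 scale0r.
Qed.

Lemma par_deriv_sqr t f : par_deriv t (f ^+ 2) = 0.
Proof.
rewrite expr2 par_derivM [X in _ + X]mulrC.
by rewrite -{1}[par_deriv t f * f](oppr_pchar2E pchar_mpoly_generic) addNr.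
Qed.

Lemma par_deriv_sum t (c : 'I_N -> parameter D N) :
  par_deriv t (\sum_(p < N) par Q (c p) *: 'X_[g p]) =
  \sum_(p < N) (c p == t)%:R *: 'X_[g p].
Proof.
rewrite raddf_sum /=; apply: eq_bigr => p _.
by rewrite /par_deriv coef_mapZX dpar_par.
Qed.

Lemma par_deriv_theta k p j :
  par_deriv (inl (k, p)) (theta j) = if j == k then 'X_[g p] else 0.
Proof.
rewrite par_deriv_sum (bigD1 p) //= big1 ?addr0 => [|q /negPf nqp].
  rewrite (_ : (inl (j, p) == inl (k, p) :> parameter D N) = (j == k)).
    by case: eqP; rewrite ?scale1r ?scale0r.
  by apply/eqP/eqP => [[]|->].
by case: eqP => [[_ /eqP]|]; rewrite ?nqp ?scale0r.
Qed.

Lemma par_deriv_theta_ell p j : par_deriv (inr p) (theta j) = 0.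
Proof. by rewrite par_deriv_sum big1 // => q _; rewrite scale0r. Qed.

Lemma par_deriv_ell p : par_deriv (inr p) ell = 'X_[g p].
Proof.
rewrite par_deriv_sum (bigD1 p) //= eqxx scale1r big1 ?addr0 // => q /negPf nqp.
by case: eqP => [[/eqP]|]; rewrite ?nqp ?scale0r.
Qed.

(** The squares [u ^+ 2] and the monomials have derivative zero for every parameter. Differentiating
    by the coefficient of [g p0] in [ell] removes [ell], and for each j the coefficient of [g (p j)]
    in [theta j] then squares that generator through [square_generator]. *)
Lemma theta_square_ideal (u : R) (w : 'X_{1..l}) (p0 : 'I_N)
    (p : 'I_D -> 'I_N) : in_theta (ell * u) ->
  exists t : 'I_D -> R,
    u ^+ 2 * 'X_[(w + g p0 + \big[+%MM/0%MM]_j g (p j))%MM]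
      = \sum_j theta j ^+ 2 * t j.
Proof.
case=> t lu; pose F m := u ^+ 2 * 'X_[m].
have dF s m : par_deriv s (F m) = 0.
  by rewrite par_derivM par_deriv_sqr par_derivX mul0r mulr0 addr0.
pose P k m := exists t : 'I_D -> R,
  F m = \sum_j theta j ^+ (if (j < k)%N then 2 else 1) * t j.
(* The derivative of [ell * F w] is the monomial of [g p0] times [F w]; the membership survives
   because the [theta j] do not involve the parameters of [ell]. *)
have P0 : P 0 (w + g p0)%MM.
  exists (fun j => par_deriv (inr p0) (t j * u * 'X_[w])).
  transitivity (par_deriv (inr p0) (ell * F w)).
    by rewrite par_derivM dF mulr0 addr0 par_deriv_ell /F addmC mpolyXD mulrCA.
  have -> : ell * F w = \sum_j theta j * (t j * u * 'X_[w]).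
    rewrite /F expr2 !mulrA lu !mulr_suml; apply: eq_bigr => j _.
    by rewrite !mulrA.
  rewrite raddf_sum /=; apply: eq_bigr => j _.
  by rewrite par_derivM par_deriv_theta_ell mul0r add0r expr1.
pose s k := \big[+%MM/0%MM]_(j < D | (j < k)%N) g (p j).
have Pk k : (k <= D)%N -> P k (w + g p0 + s k)%MM.
  elim: k => [_|k IHk lt_kD]; first by rewrite /s big1 // ?addm0.
  have [t' Ft'] := IHk (ltnW lt_kD); pose ko := Ordinal lt_kD.
  have [] := @square_generator _ _ theta pchar_mpoly_generic ko
    (par_deriv (inl (ko, p ko))) ('X_[g (p ko)]) _ t' _ _ _ Ft'.
  - exact: par_derivM.
  - exact: dF.
  - exact: par_deriv_theta.
  move=> t'' Ft''; exists t''; rewrite -Ft'' /F mulrCA -mpolyXD.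
  congr (_ * 'X_[_]); rewrite /s (bigD1 ko) //= ?ltnSn //.
  rewrite addmC -addmA; congr (_ + _)%MM; rewrite addmC; congr (_ + _)%MM.
  by apply: eq_bigl => j; rewrite ltnS leq_eqVlt -(inj_eq val_inj) /=; lia.
have [t' Ft'] := Pk D (leqnn D); exists t'.
transitivity (F (w + g p0 + s D)%MM).
  congr (_ * 'X_[_]); congr (_ + _)%MM.
  by apply: eq_bigl => j; rewrite ltn_ord.
by rewrite Ft'; apply: eq_bigr => j _; rewrite ltn_ord.
Qed.

End GenericForms.

(** * Triangulated monoids *)

Section MonomialSums.
Variables (l N : nat) (g : 'I_N -> 'X_{1..l}).

Definition mon_sum (c : 'I_N -> nat) : 'X_{1..l} :=
  \big[+%MM/0%MM]_p (g p *+ c p)%MM.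

Lemma eq_mon_sum c c' : c =1 c' -> mon_sum c = mon_sum c'.
Proof. by move=> e; apply: eq_bigr => p _; rewrite e. Qed.

Lemma msum_add c c' : mon_sum (fun p => c p + c' p)%N = (mon_sum c + mon_sum c')%MM.
Proof.
rewrite /mon_sum -big_split /=; apply: eq_bigr => p _.
by apply/mnmP => i; rewrite mnmDE !mulmnE mulnDr.
Qed.

Lemma msum1 p : mon_sum (fun q => q == p) = g p.
Proof.
rewrite /mon_sum (bigD1 p) //= eqxx mulm1n big1 ?addm0 // => q /negPf->.
by rewrite mulm0n.
Qed.

Lemma msumE c i : mon_sum c i = (\sum_p c p * g p i)%N.
Proof.
by rewrite /mon_sum mnm_sumE; apply: eq_bigr => p _; rewrite mulmnE mulnC.
Qed.

End MonomialSums.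

Definition admissible N (F : {set {set 'I_N}}) (rs : {set 'I_N} -> {set 'I_N})
    (s : {set 'I_N}) (c : 'I_N -> nat) :=
  [/\ s \in F, forall p, p \notin s -> c p = 0%N
    & forall p, p \in rs s -> (0 < c p)%N].

(* A graded monoid [tmS] of exponent vectors generated in degree 1 by the [tmg p],
   with a unimodular triangulation having the facets [s \in tmF]: each element
   lies in exactly one half-open cone [{sum_p c p * tmg p | admissible s c}]. *)
Record triangulated_monoid (l N D : nat) := TriangulatedMonoid {
  tmd : 'I_N;
  tmg : 'I_N -> 'X_{1..l};
  tmS : nat -> pred 'X_{1..l};
  tmSS : nat -> seq 'X_{1..l};
  SS_uniq : forall n, uniq (tmSS n);
  SSE : forall n, tmSS n =i tmS n;
  S_add : forall a b m1 m2, tmS a m1 -> tmS b m2 -> tmS (a + b) (m1 + m2)%MM;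
  S_sub : forall a b m1 m2, tmS (a + b) (m1 + m2)%MM -> tmS a m1 -> tmS b m2;
  S_height : forall a b m, tmS a m -> tmS b m -> a = b;
  S_zero : tmS 0 0%MM;
  S_g : forall p, tmS 1 (tmg p);
  tmF : {set {set 'I_N}};
  tmrs : {set 'I_N} -> {set 'I_N};
  F_card : forall s, s \in tmF -> #|s| = D;
  rs_sub : forall s, s \in tmF -> tmrs s \subset s;
  fa : 'X_{1..l} -> {set 'I_N};
  cf : 'X_{1..l} -> 'I_N -> nat;
  fa_adm : forall n m, tmS n m -> admissible tmF tmrs (fa m) (cf m);
  cf_sum : forall n m, tmS n m -> mon_sum tmg (cf m) = m;
  adm_fa : forall s c, admissible tmF tmrs s c -> fa (mon_sum tmg c) = s;
  adm_cf : forall s c, admissible tmF tmrs s c -> cf (mon_sum tmg c) =1 c }.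

Section TriangulatedMonoidTheory.
Variables (l N D : nat) (T : triangulated_monoid l N D).
Local Notation g := (tmg T).
Local Notation S := (tmS T).
Local Notation SS := (tmSS T).
Local Notation F := (tmF T).
Local Notation rs := (tmrs T).
Local Notation fa := (fa T).
Local Notation cf := (cf T).
Local Notation msum := (mon_sum g).
Local Notation admissible := (admissible F rs).

Lemma S_muln n m k : S n m -> S (n * k) (m *+ k)%MM.
Proof.
move=> Sm; elim: k => [|k IHk]; first by rewrite muln0 mulm0n S_zero.
by rewrite mulmS mulnS; apply: S_add.
Qed.

Lemma S_msum c : S (\sum_p c p)%N (msum c).
Proof.
rewrite /mon_sum; elim/big_rec2: _ => [|p m n _ Sm]; first exact: S_zero.
by apply: S_add Sm; have := S_muln (c p) (S_g T p); rewrite mul1n.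
Qed.

Lemma cf_height n m : S n m -> (\sum_p cf m p)%N = n.
Proof. by move=> Sm; apply: S_height (Sm); rewrite -{2}(cf_sum Sm) S_msum. Qed.

(** The least element of the half-open cone of [s]. The corresponding monomials will be the
    generators of the monoid algebra as a free module over the linear forms. *)
Definition rmon (s : {set 'I_N}) := msum (fun p => p \in rs s).

Lemma rs_notin s p : s \in F -> p \notin s -> (p \in rs s) = false.
Proof.
by move=> Fs sp; apply/negP => /(fintype.subsetP (rs_sub Fs)); rewrite (negPf sp).
Qed.

Lemma rs_adm s : s \in F -> admissible s (fun p => p \in rs s).
Proof.
move=> Fs; split=> // [p|p ->//].
by move=> sp; rewrite rs_notin.
Qed.

Lemma S_rmon s : S #|rs s| (rmon s).
Proof.
have := S_msum (fun p => p \in rs s); rewrite -/(rmon s).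
by rewrite -[X in S X]big_mkcond /= sum1_card.
Qed.

Definition vtx (s : {set 'I_N}) (j : 'I_D) : 'I_N := nth (tmd T) (enum s) j.

Lemma vtx_in s j : s \in F -> vtx s j \in s.
Proof. by move=> Fs; rewrite -mem_enum mem_nth // -cardE (F_card Fs). Qed.

Lemma vtx_inj s : s \in F -> injective (vtx s).
Proof.
move=> Fs i j /eqP; rewrite nth_uniq -?cardE ?(F_card Fs) ?enum_uniq //.
by move/eqP/val_inj.
Qed.

Lemma vtx_surj s p : s \in F -> p \in s -> exists j, vtx s j = p.
Proof.
move=> Fs sp; have lt_p : (index p (enum s) < D)%N.
  by rewrite -(F_card Fs) cardE index_mem mem_enum.
by exists (Ordinal lt_p); rewrite /vtx nth_index // mem_enum.
Qed.

Lemma big_vtx (A : Type) (idx : A) (op : Monoid.com_law idx) s (f : 'I_N -> A) :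
  s \in F -> \big[op/idx]_(p in s) f p = \big[op/idx]_(j < D) f (vtx s j).
Proof.
move=> Fs; rewrite -big_enum /= (big_nth (tmd T)) big_mkord.
by rewrite -cardE (F_card Fs).
Qed.

(** Coordinates of [m] above the least element of its half-open cone. Numbering the vertices of
    every facet by ['I_D] pairs the j-th vertex with [theta j], so that [bas] can use these numbers
    as exponents. *)
Definition excess (m : 'X_{1..l}) (j : 'I_D) : nat :=
  (cf m (vtx (fa m) j) - (vtx (fa m) j \in rs (fa m)))%N.

Lemma faD n m j : S n m -> fa (m + g (vtx (fa m) j)) = fa m.
Proof.
move=> Sm; have [Fs c0 c1] := fa_adm Sm; set s := fa m in Fs c0 c1 *.
rewrite -{1}(cf_sum Sm) -msum1 -msum_add; apply: adm_fa; split=> // p sp.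
  by rewrite c0 //; case: eqP sp => [->|//]; rewrite vtx_in.
by rewrite addn_gt0 c1.
Qed.

Lemma cfD n m j : S n m ->
  cf (m + g (vtx (fa m) j)) =1 (fun p => cf m p + (p == vtx (fa m) j))%N.
Proof.
move=> Sm; have [Fs c0 c1] := fa_adm Sm; set s := fa m in Fs c0 c1 *.
rewrite -{1}(cf_sum Sm) -msum1 -msum_add; apply: (@adm_cf _ _ _ T s); split=> // p sp.
  by rewrite c0 //; case: eqP sp => [->|//]; rewrite vtx_in.
by rewrite addn_gt0 c1.
Qed.

Lemma excessD n m i j : S n m ->
  excess (m + g (vtx (fa m) j)) i = (excess m i + (i == j))%N.
Proof.
move=> Sm; have [Fs c0 c1] := fa_adm Sm.
rewrite /excess (faD _ Sm) (cfD _ Sm) (inj_eq (vtx_inj Fs)).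
by rewrite addnBAC //; case: (boolP (_ \in rs _)) => // /c1.
Qed.

Lemma fa_rmon s : s \in F -> fa (rmon s) = s.
Proof. by move=> Fs; apply: adm_fa; apply: rs_adm. Qed.

Lemma excess_rmon s j : s \in F -> excess (rmon s) j = 0%N.
Proof.
move=> Fs; rewrite /excess fa_rmon //.
by rewrite (adm_cf (rs_adm Fs)) subnn.
Qed.

Lemma excess_eq0 n m : S n m -> (forall j, excess m j = 0%N) -> m = rmon (fa m).
Proof.
move=> Sm e0; have [Fs c0 c1] := fa_adm Sm; rewrite -[LHS](cf_sum Sm).
apply: eq_mon_sum => p; have [sp|sp] := boolP (p \in fa m); last first.
  by rewrite c0 // rs_notin.
have [j jp] := vtx_surj Fs sp; move: (e0 j) (c1 p); rewrite /excess jp.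
case: (p \in rs _) => /=; last by rewrite subn0.
by move=> e1 /(_ isT) e2; lia.
Qed.

Lemma excess_gt0 n m j : S n m -> (0 < excess m j)%N ->
  exists2 n', n = n'.+1 & exists2 m', S n' m'
    & [/\ m = (m' + g (vtx (fa m') j))%MM, fa m' = fa m
      & forall p, p \in rs (fa m) -> (0 < cf m' p)%N].
Proof.
move=> Sm ej; have [Fs c0 c1] := fa_adm Sm; set s := fa m in Fs c0 c1 *.
pose c p := (cf m p - (p == vtx s j))%N.
have cE p : cf m p = (c p + (p == vtx s j))%N.
  rewrite subnK //; case: eqP => [->|//]; move: ej; rewrite /excess -/s; lia.
have ac : admissible s c.
  split=> // p sp; first by rewrite /c c0.
  rewrite /c; case: eqP => [pj|_]; last by rewrite subn0 c1.
  by move: ej; rewrite /excess -/s -pj sp subn_gt0.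
have mE : m = (msum c + g (vtx s j))%MM.
  by rewrite -msum1 -msum_add -{1}(cf_sum Sm); apply: eq_mon_sum.
have nE : n = (\sum_p c p)%N.+1.
  apply: S_height Sm _; rewrite mE -addn1; apply: S_add; first exact: S_msum.
  exact: S_g.
exists (\sum_p c p)%N => //; exists (msum c); first exact: S_msum.
split; [by rewrite (adm_fa ac) | exact: adm_fa ac |].
by move=> p ps; rewrite (adm_cf ac); case: ac => _ _; apply.
Qed.

Lemma excess_height n m : S n m -> n = (#|rs (fa m)| + \sum_j excess m j)%N.
Proof.
move=> Sm; have [Fs c0 c1] := fa_adm Sm; rewrite -(cf_height Sm).
rewrite (bigID (mem (fa m))) /= [X in (_ + X)%N = _]big1 ?addn0; last first.
  by move=> p /c0.
rewrite (big_vtx _ _ Fs) -sum1_card.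
have -> : (\sum_(p in rs (fa m)) 1 = \sum_(p in fa m) (p \in rs (fa m)))%N.
  rewrite big_mkcond [RHS]big_mkcond; apply: eq_bigr => p _.
  case: ifPn => [/(fintype.subsetP (rs_sub Fs))->|_] //; by case: ifP.
rewrite (big_vtx _ _ Fs) -big_split /=; apply: eq_bigr => j _.
rewrite /excess subnKC //.
by case: (boolP (_ \in rs _)) => // /c1.
Qed.

Lemma half_open_count n s : s \in F -> (0 < D)%N ->
  count (fun m => fa m == s) (SS n) = cone_count D n #|rs s|.
Proof.
move=> Fs D0; rewrite -size_filter.
have ha c : half_open s (rs s) c <-> admissible s c.
  by split=> [[]|[]]; split.
have inj c c' : half_open s (rs s) c -> half_open s (rs s) c' ->
    msum c = msum c' -> c =1 c'.
  by move=> /ha ac /ha ac' e p; rewrite -(adm_cf ac) e (adm_cf ac').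
rewrite -[X in cone_count X](F_card Fs).
apply: (half_open_size (rs_sub Fs) (@eq_mon_sum _ _ g) inj).
- by rewrite (F_card Fs).
- by rewrite filter_uniq ?SS_uniq.
move=> m; rewrite mem_filter SSE; split=> [/andP[/eqP fam Sm]|[c [/ha ac cn ->]]].
  have := fa_adm Sm; rewrite fam => /ha hc; exists (cf m).
  by split; rewrite ?(cf_height Sm) ?(cf_sum Sm).
by rewrite (adm_fa ac) eqxx -cn; apply: S_msum.
Qed.

End TriangulatedMonoidTheory.

(** * Degeneration to the triangulation *)

(* The weights [cw] come from a convex function that is linear exactly on the
   cones of the triangulation, and [cht] orders the facets as in a shelling. *)
Record coherent l N D (T : triangulated_monoid l N D) := Coherent {
  cw : 'I_N -> nat;
  cht : {set 'I_N} -> nat;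
  cpsi := fun m => (\sum_p cf T m p * cw p)%N;
  cpsi_le : forall n m p, tmS T n m -> (cpsi (m + tmg T p) <= cpsi m + cw p)%N;
  cpsi_eq : forall n m p, tmS T n m -> cpsi (m + tmg T p) = (cpsi m + cw p)%N ->
    p \in fa T (m + tmg T p)
    /\ forall q, (0 < cf T m q)%N -> q \in fa T (m + tmg T p);
  cht_lt : forall s s', s \in tmF T -> s' \in tmF T -> tmrs T s \subset s' ->
    s' != s -> (cht s' < cht s)%N }.

Section GenericBasis.
Variables (l N D : nat) (T : triangulated_monoid l N D) (Q : generic_domain (parameter D N)).
Variable W : coherent T.
Local Notation g := (tmg T).
Local Notation S := (tmS T).
Local Notation SS := (tmSS T).
Local Notation F := (tmF T).
Local Notation rs := (tmrs T).
Local Notation fa := (fa T).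
Local Notation cf := (cf T).
Local Notation msum := (mon_sum g).
Local Notation admissible := (admissible F rs).
Local Notation vtx := (vtx T).
Local Notation rmon := (rmon T).
Local Notation excess := (excess T).
Local Notation w := (cw W).
Local Notation psi := (cpsi W).
Local Notation a j p := (par Q (inl (j, p))).

(** Specializing the parameters to 0 and 1 turns the matrix into the identity. *)
Lemma minor_neq0 s : s \in F -> \det (\matrix_(i, j) a i (vtx s j)) != 0.
Proof.
move=> Fs; pose c (t : parameter D N) : 'F_2 :=
  if t is inl (j, p) then (vtx s j == p)%:R else 0.
have [|f fE] := gd_free Q c; first exact: pchar_Fp.
apply/negP => /eqP/(congr1 f); rewrite -det_map_mx rmorph0.
suff -> : map_mx f (\matrix_(i, j) a i (vtx s j)) = 1%:M.
  by move/eqP; rewrite det1 oner_eq0.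
by apply/matrixP => i j; rewrite !mxE fE /c (inj_eq (vtx_inj Fs)).
Qed.

Lemma generic_minor_solve s (z : 'I_N -> Q) : s \in F ->
  (forall j, \sum_(p in s) a j p * z p = 0) -> forall p, p \in s -> z p = 0.
Proof.
move=> Fs zs p sp; have [j <-] := vtx_surj Fs sp.
apply/eqP; apply: contraNT (minor_neq0 Fs) => nz.
rewrite -det_tr; apply/det0P; exists (\row_i z (vtx s i)).
  by apply: contraNN nz => /eqP/rowP/(_ j); rewrite !mxE => ->.
apply/rowP => i; rewrite !mxE -[RHS](zs i) (big_vtx _ _ Fs).
by apply: eq_bigr => k _; rewrite !mxE mulrC.
Qed.

(* The substitution [a j p -> a j p X^(w p)] used for the degeneration of the
   monoid algebra to the Stanley-Reisner ring of the triangulation. *)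
Lemma degeneration : exists f : {rmorphism Q -> {poly Q}},
  (forall j p, f (a j p) = (a j p)%:P * 'X^(w p)) /\ injective f.
Proof.
pose c (t : parameter D N) : {poly Q} :=
  if t is inl (j, p) then (par Q t)%:P * 'X^(w p) else (par Q t)%:P.
have [|f fE] := gd_free Q c.
  rewrite inE /= -polyC_natr (pcharf0 (gd_pchar Q)) polyC0 eqxx //.
exists f; split=> [j p|]; first exact: fE.
(* Evaluation at 1 undoes the substitution. *)
apply: (can_inj (g := horner_eval 1)).
have h : horner_eval 1 \o f =1 idfun.
  apply: gd_ext => t; rewrite /= fE /c /horner_eval.
  by case: t => [[j p]|p]; rewrite ?hornerM ?hornerXn ?expr1n ?mulr1 hornerC.
by move=> x; exact: h.
Qed.

(** After the degeneration and a shift by [psi], the lowest coefficients of a nonzero functional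
    satisfy the equations of the Stanley-Reisner ring of the triangulation. There the facets are
    treated in the order of [cht]: the equations reduce to one generic square system per facet,
    whose only solution is zero. *)
Lemma dual_vanishing n (xi : 'X_{1..l} -> Q) :
    (forall s, s \in F -> #|rs s| = n -> xi (rmon s) = 0) ->
    (forall n' j m, n = n'.+1 -> S n' m -> \sum_p a j p * xi (m + g p)%MM = 0) ->
  forall m, S n m -> xi m = 0.
Proof.
move=> xi_r xi_th; have [f [fa_ f_inj]] := degeneration.
pose xi' m := f (xi m) * 'X^(psi m).
case: (pselect (exists m, S n m /\ xi m <> 0)) => [[m0 [Sm0 nz0]]|no]; last first.
  by move=> m Sm; apply: contrapT => nz; apply: no; exists m.
have nz' m : xi m <> 0 -> xi' m != 0.
  move=> nz; apply: mulf_neq0; last by rewrite monic_neq0 ?monicXn.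
  by apply/eqP => fx0; apply: nz; apply: f_inj; rewrite rmorph0.
(* [mu] is the lowest order that occurs among all [xi' m] of degree [n]; [ze] collects the
   coefficients of that order. *)
have ex_mu : exists k, has (fun m => (xi' m)`_k != 0) (SS n).
  exists (size (xi' m0)).-1; apply/hasP; exists m0; first by rewrite SSE.
  by rewrite -lead_coefE lead_coef_eq0 nz'.
case: (ex_minnP ex_mu) => mu /hasP[m1 Sm1 nz1] mu_min {m0 Sm0 nz0}.
rewrite SSE in Sm1; pose ze m := (xi' m)`_mu.
have xi'0 m k : S n m -> (k < mu)%N -> (xi' m)`_k = 0.
  move=> Sm; apply: contraTeq => nz; rewrite -leqNgt; apply: mu_min.
  by apply/hasP; exists m; rewrite ?SSE.
(* The term of [p] is shifted up by e = psi m + w p - psi (m + g p), so at order [mu] only the terms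
   with e = 0 survive. *)
have ze_th n' j m : n = n'.+1 -> S n' m ->
    \sum_(p | psi (m + g p) == (psi m + w p)%N) a j p * ze (m + g p)%MM = 0.
  move=> nE Sm; have Smp p : S n (m + g p)%MM by rewrite nE -addn1; apply/S_add/S_g.
  have /(congr1 f) := xi_th _ j _ nE Sm; rewrite rmorph_sum rmorph0 /=.
  move/(congr1 (fun q => (q * 'X^(psi m))`_mu)); rewrite mul0r coef0 => e0.
  rewrite -[RHS]e0 mulr_suml coef_sum big_mkcond; apply: eq_bigr => p _.
  rewrite rmorphM /= fa_ -!mulrA coefCM; set e := (psi m + w p - psi (m + g p))%N.
  have -> : 'X^(w p) * (f (xi (m + g p)%MM) * 'X^(psi m)) = 'X^e * xi' (m + g p)%MM.
    rewrite /xi' mulrCA [RHS]mulrCA -!exprD; congr (_ * 'X^ _).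
    by have := cpsi_le W p Sm; rewrite /e; lia.
  rewrite coefXnM; case: eqP => [ee|ne].
    by have -> : e = 0%N by [rewrite /e ee subnn]; rewrite subn0.
  have e0' : (0 < e)%N by have := cpsi_le W p Sm; rewrite /e; lia.
  by case: ltnP => [_|le]; rewrite ?mulr0 // xi'0 ?mulr0 //; lia.
suff ze0 k m : (cht W (fa m) < k)%N -> S n m -> ze m = 0.
  by case/eqP: nz1; apply: ze0 Sm1.
elim: k m => [//|k IHk] m le_k Sm; have [Fs c0 c1] := fa_adm Sm.
case: (pselect (exists j, (0 < excess m j)%N)) => [[j ej]|no]; last first.
  have mE : m = rmon (fa m).
    apply: (excess_eq0 Sm) => j; apply/eqP; rewrite -leqn0 leqNgt; apply/negP => ej.
    by apply: no; exists j.
  have rn : #|rs (fa m)| = n by apply: (S_height (S_rmon T (fa m))); rewrite -mE.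
  by rewrite /ze /xi' mE xi_r // rmorph0 mul0r coef0.
have [n' nE [m' Sm' [mE fam' rpos]]] := excess_gt0 Sm ej.
have [_ c0' c1'] := fa_adm Sm'; set s := fa m in Fs c0 c1 rpos fam' le_k *.
have adm_p p : p \in s -> admissible s (fun q => cf m' q + (q == p))%N.
  move=> sp; split=> // q qs; last by rewrite addn_gt0 rpos.
  by rewrite c0' ?fam' //; case: eqP qs => [->|//]; rewrite sp.
have m'pE p : (m' + g p)%MM = msum (fun q => cf m' q + (q == p))%N.
  by rewrite msum_add msum1 (cf_sum Sm').
have Smp p : S n (m' + g p)%MM by rewrite nE -addn1; apply/S_add/S_g.
rewrite mE fam'; apply: (@generic_minor_solve s (fun p => ze (m' + g p)%MM)) => //; last first.
  exact: vtx_in.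
move=> i; rewrite -[RHS](ze_th _ i _ nE Sm') big_mkcond [RHS]big_mkcond.
apply: eq_bigr => p _; case: ifPn => sp.
  rewrite ifT // /cpsi m'pE; apply/eqP.
  rewrite (eq_bigr (fun q => cf m' q * w q + (q == p) * w q)%N); last first.
    by move=> q _; rewrite (adm_cf (adm_p p sp)) mulnDl.
  rewrite big_split /=; congr (_ + _)%N.
  by rewrite (bigD1 p) //= eqxx mul1n big1 ?addn0 // => q /negPf->.
(* A surviving term outside [s] lies over a facet that contains [rs s] and differs from [s];
   [cht_lt] places that facet lower, so the term vanishes by induction. *)
case: ifPn => // /eqP/(cpsi_eq Sm')[pin sub].
rewrite IHk ?mulr0 //; rewrite -ltnS; apply: leq_trans le_k; rewrite ltnS.
have [Fs' _ _] := fa_adm (Smp p).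
apply: cht_lt => //; last by apply: contraNneq sp => <-.
by apply/fintype.subsetP => q /rpos; apply: sub.
Qed.

End GenericBasis.

(** * Coordinates modulo generic linear forms *)

Section Coordinates.
Variables (l N D : nat) (T : triangulated_monoid l N D) (Q : generic_domain (parameter D N)).
Variable W : coherent T.
Local Notation g := (tmg T).
Local Notation S := (tmS T).
Local Notation SS := (tmSS T).
Local Notation F := (tmF T).
Local Notation rs := (tmrs T).
Local Notation fa := (fa T).
Local Notation vtx := (vtx T).
Local Notation rmon := (rmon T).
Local Notation excess := (excess T).
Local Notation a j p := (par Q (inl (j, p))).

Local Notation R := {mpoly Q[l]}.
Local Notation theta := (theta g Q).
Local Notation in_theta := (@in_theta l N D g Q).

Definition inS n (f : R) := forall m, f@_m != 0 -> S n m.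

Lemma inS_X n m : S n m -> inS n 'X_[m].
Proof. by move=> Sm k; rewrite mcoeffX; have [<-|] := eqVneq m k; rewrite ?eqxx. Qed.

Lemma inS_Z n c f : inS n f -> inS n (c *: f).
Proof. by move=> Sf k; rewrite mcoeffZ mulf_eq0 negb_or => /andP[_ /Sf]. Qed.

Lemma inS_sum n (I : eqType) (r : seq I) (P : pred I) (f : I -> R) :
  (forall i, i \in r -> P i -> inS n (f i)) -> inS n (\sum_(i <- r | P i) f i).
Proof.
move=> Sf m nz; have [i [ri Pi nzi]] : exists i, [/\ i \in r, P i & (f i)@_m != 0].
  apply: contrapT => no; case/eqP: nz; rewrite raddf_sum big_seq_cond big1 //= => i.
  case/andP=> ri Pi; apply/eqP; apply: contrapT => /negP nz; by apply: no; exists i.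
exact: Sf nzi.
Qed.

Lemma inS_M a b f h : inS a f -> inS b h -> inS (a + b) (f * h).
Proof.
move=> Sf Sh m; rewrite -mcoeff_msupp => /msuppM_le/allpairsP[[m1 m2] /= []].
by rewrite !mcoeff_msupp => /Sf S1 /Sh S2 ->; apply: S_add.
Qed.

Lemma inS_theta j : inS 1 (theta j).
Proof. by apply: inS_sum => p _ _; apply/inS_Z/inS_X/S_g. Qed.

Lemma inS_ell : inS 1 (ell g Q).
Proof. by apply: inS_sum => p _ _; apply/inS_Z/inS_X/S_g. Qed.

Definition proj n (f : R) : R := \sum_(m <- SS n) f@_m *: 'X_[m].

Lemma mcoeff_proj n f m : (proj n f)@_m = if S n m then f@_m else 0.
Proof.
rewrite raddf_sum /=; case: ifPn => Sm.
  rewrite (bigD1_seq m) ?SS_uniq ?SSE //= mcoeffZ mcoeffX eqxx mulr1 big1 ?addr0 //.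
  by move=> k /negPf nkm; rewrite mcoeffZ mcoeffX nkm mulr0.
rewrite big_seq big1 // => k; rewrite SSE mcoeffZ mcoeffX.
by have [-> Sm'|] := eqVneq k m; [case/negP: Sm | rewrite mulr0].
Qed.

Lemma proj_id n f : inS n f -> proj n f = f.
Proof.
move=> Sf; apply/mpolyP => m; rewrite mcoeff_proj; case: ifPn => // nSm.
by apply/esym/eqP; apply: contraNT nSm => /Sf.
Qed.

Lemma inS_proj n f : inS n (proj n f).
Proof. by move=> m; rewrite mcoeff_proj; case: ifP; rewrite ?eqxx. Qed.

Lemma proj_is_linear n : linear (proj n).
Proof.
move=> c f h; apply/mpolyP => m; rewrite mcoeffD mcoeffZ !mcoeff_proj.
by rewrite mcoeffD mcoeffZ; case: ifP; rewrite ?mulr0 ?addr0.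
Qed.

HB.instance Definition _ n :=
  GRing.isLinear.Build Q R R *:%R (proj n) (proj_is_linear n).

(** By [S_sub], the cofactor of an element of S inside an element of S is again in S; this makes the
    projections compatible with multiplication. *)
Lemma projXM a n m f : S a m -> proj (a + n) ('X_[m] * f) = 'X_[m] * proj n f.
Proof.
move=> Sm; apply/mpolyP => k; rewrite mcoeff_proj !(mulrC 'X_[m]) !mcoeffMX_sub.
rewrite mcoeff_proj; have [le_mk|] := boolP (m <= k)%MM; last by case: ifP.
congr (if _ then _ else _); rewrite -{1}(submK le_mk) addmC.
by apply/idP/idP => [/S_sub-> //|]; apply: S_add.
Qed.

Lemma proj_theta n j f : proj n.+1 (theta j * f) = theta j * proj n f.
Proof.
rewrite thetaE !mulr_suml linear_sum /=; apply: eq_bigr => p _.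
by rewrite -!scalerAl linearZ /= -add1n projXM ?S_g.
Qed.

Lemma S0E m : S 0 m -> m = 0%MM.
Proof.
move=> S0; rewrite -(cf_sum S0) /mon_sum big1 // => p _.
have := cf_height S0; move/eqP; rewrite sum_nat_eq0 => /forallP/(_ p)/= /eqP->.
by rewrite mulm0n.
Qed.

Lemma proj0_theta j f : proj 0 (theta j * f) = 0.
Proof.
rewrite thetaE !mulr_suml linear_sum big1 //= => p _.
rewrite -!scalerAl linearZ /= (_ : proj 0 _ = 0) ?scaler0 //.
apply/mpolyP => m; rewrite mcoeff0 mcoeff_proj mulrC mcoeffMX_sub.
case: ifP => // /S0E->; case: ifP => // /mnm_lepP le0; exfalso.
have g0 : g p = 0%MM by apply/mnmP => i; have := le0 i; rewrite mnm0E leqn0 => /eqP.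
have := S_g T p; rewrite g0 => S10; by have := S_height S10 (S_zero T).
Qed.

(** Membership in [in_theta] allows arbitrary polynomials as coefficients; projecting them one
    degree lower places them in the monoid algebra. *)
Lemma in_theta_graded n f : inS n f -> in_theta f ->
  f = 0 \/ exists n', n = n'.+1 /\
    exists2 t : 'I_D -> R, forall j, inS n' (t j) & f = \sum_j theta j * t j.
Proof.
move=> Sf [t fE]; case: n Sf => [|n] Sf; [left|right].
  by rewrite -(proj_id Sf) fE linear_sum big1 //= => j _; rewrite proj0_theta.
exists n; split=> //; exists (fun j => proj n (t j)) => [j|]; first exact: inS_proj.
rewrite -(proj_id Sf) fE linear_sum; apply: eq_bigr => j _; exact: proj_theta.
Qed.

(** The monomial of [m] with each vertex in excess replaced by the linear form of the same index.
    That these elements form a basis in each degree expresses freeness over the [theta j]. *)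
Definition bas m : R := 'X_[rmon (fa m)] * \prod_j theta j ^+ excess m j.

Lemma basE m : bas m = 'X_[rmon (fa m)] * \prod_j theta j ^+ excess m j.
Proof. by []. Qed.

Lemma theta_bas n m j : S n m -> theta j * bas m = bas (m + g (vtx (fa m) j)).
Proof.
move=> Sm; rewrite /bas (faD _ Sm) mulrCA; congr (_ * _).
under [RHS]eq_bigr do rewrite (excessD _ _ Sm) exprD.
rewrite big_split mulrC /=; congr (_ * _); rewrite (bigD1 j) //= eqxx expr1.
by rewrite big1 ?mulr1 // => i /negPf->.
Qed.

Lemma bas_rmon s : s \in F -> bas (rmon s) = 'X_[rmon s].
Proof.
move=> Fs; rewrite /bas fa_rmon // big1 ?mulr1 // => j _.
by rewrite excess_rmon.
Qed.

Lemma theta_prod_closed (P : nat -> R -> Prop) k f (al : 'I_D -> nat) :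
    (forall n h j, P n h -> P n.+1 (theta j * h)) -> P k f ->
  P (k + \sum_j al j)%N (f * \prod_j theta j ^+ al j).
Proof.
move=> Pth; elim: (index_enum _) k f => [|j r IHr] k f Pf.
  by rewrite !big_nil addn0 mulr1.
rewrite !big_cons addnA mulrA; apply: IHr; elim: (al j) => [|b IHb].
  by rewrite addn0 expr0 mulr1.
by rewrite addnS exprS mulrCA; apply: Pth.
Qed.

Lemma inS_bas n m : S n m -> inS n (bas m).
Proof.
move=> Sm; rewrite (excess_height Sm); apply: (theta_prod_closed (P := inS)); last first.
  exact/inS_X/S_rmon.
by move=> k h j Sh; rewrite -add1n; apply: inS_M => //; apply: inS_theta.
Qed.

Definition pairing n (xi : 'X_{1..l} -> Q) (f : R) := \sum_(m <- SS n) f@_m * xi m.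

Lemma pairing_sum n xi (I : Type) (r : seq I) (f : I -> R) :
  pairing n xi (\sum_(i <- r) f i) = \sum_(i <- r) pairing n xi (f i).
Proof.
rewrite /pairing exchange_big; apply: eq_bigr => m _ /=.
by rewrite raddf_sum mulr_suml.
Qed.

Lemma pairingZX n xi c m : S n m -> pairing n xi (c *: 'X_[m]) = c * xi m.
Proof.
move=> Sm; rewrite /pairing (bigD1_seq m) ?SS_uniq ?SSE //= mcoeffZ mcoeffX eqxx.
rewrite mulr1 big1 ?addr0 // => k /negPf nkm.
by rewrite mcoeffZ mcoeffX eq_sym nkm mulr0 mul0r.
Qed.

Lemma pairing_theta n xi j f : inS n f ->
  pairing n.+1 xi (theta j * f) =
  pairing n (fun m => \sum_p a j p * xi (m + g p)%MM) f.
Proof.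
move=> Sf; rewrite -{1}(proj_id Sf) /proj mulr_sumr pairing_sum.
rewrite [RHS]/pairing big_seq [RHS]big_seq; apply: eq_bigr => m; rewrite SSE => Sm.
rewrite thetaE mulr_suml pairing_sum mulr_sumr; apply: eq_bigr => p _.
rewrite -scalerAl -scalerAr scalerA -mpolyXD addmC pairingZX; first by ring.
by rewrite -addn1; apply/S_add/S_g.
Qed.

(** The transpose of multiplication by [theta j] sends [xi] to a functional of degree one less that
    again vanishes on all [bas]; by induction it is zero, and [dual_vanishing] applies. *)
Lemma pairing_bas_vanish n xi : (forall m, S n m -> pairing n xi (bas m) = 0) ->
  forall m, S n m -> xi m = 0.
Proof.
elim: n xi => [|n IHn] xi pr0.
  apply: (dual_vanishing W) => // s Fs rn.
  have Sr : S 0 (rmon s) by rewrite -rn; apply: S_rmon.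
  by have := pr0 _ Sr; rewrite bas_rmon // -[X in pairing _ _ X]scale1r pairingZX // mul1r.
apply: (dual_vanishing W) => [s Fs rn|n' j m [<-] Sm].
  have Sr : S n.+1 (rmon s) by rewrite -rn; apply: S_rmon.
  by have := pr0 _ Sr; rewrite bas_rmon // -[X in pairing _ _ X]scale1r pairingZX // mul1r.
apply: (IHn (fun m => \sum_p a j p * xi (m + g p)%MM)) Sm => {}m Sm.
rewrite -pairing_theta ?(theta_bas _ Sm); last exact: inS_bas.
by apply: pr0; rewrite -addn1; apply/S_add/S_g.
Qed.

Lemma basis_inverse n : exists dV : Q * ('X_{1..l} -> 'X_{1..l} -> Q),
  [/\ dV.1 != 0,
     forall m m', S n m -> S n m' ->
       \sum_(k <- SS n) dV.2 m k * (bas k)@_m' = dV.1 * (m == m')%:R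
   & forall m m', S n m -> S n m' ->
       \sum_(k <- SS n) (bas m)@_k * dV.2 k m' = dV.1 * (m == m')%:R].
Proof.
have [||//||d nzd [V V1 V2]] := @seq_inverse Q _ _ (SS n) (SS n) (fun m k => (bas m)@_k).
- exact: SS_uniq.
- exact: SS_uniq.
- move=> x x0 m; rewrite SSE; apply: pairing_bas_vanish => k Sk.
  by apply: x0; rewrite SSE.
by exists (d, V); split=> // m m' Sm Sm'; [apply: V1|apply: V2]; rewrite SSE.
Qed.

(** A common denominator for coordinates in the basis [bas]: [co] computes [bd n] times the true
    coordinates and therefore stays in the domain. *)
Definition bd n : Q := (projT1 (cid (basis_inverse n))).1.
Definition co n (f : R) m : Q :=
  \sum_(k <- SS n) f@_k * (projT1 (cid (basis_inverse n))).2 k m.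

Lemma bd_neq0 n : bd n != 0.
Proof. by have [] := projT2 (cid (basis_inverse n)). Qed.

Lemma co_bas n m m' : S n m -> S n m' -> co n (bas m) m' = bd n * (m == m')%:R.
Proof. by have [_ _] := projT2 (cid (basis_inverse n)); apply. Qed.

Lemma co_expand n f : inS n f -> bd n *: f = \sum_(m <- SS n) co n f m *: bas m.
Proof.
move=> Sf; apply/mpolyP => k; rewrite mcoeffZ raddf_sum /=.
under eq_bigr do rewrite mcoeffZ.
have [Sk|nSk] := boolP (S n k); last first.
  rewrite big_seq big1 => [|m]; last first.
    rewrite SSE => Sm; apply/eqP; rewrite mulf_eq0; apply/orP; right.
    by apply: contraNT nSk; apply: inS_bas.
  by apply/eqP; rewrite mulf_eq0; apply/orP; right; apply: contraNT nSk => /Sf.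
rewrite /co /bd; have [_ dV1 _] := projT2 (cid (basis_inverse n)).
under eq_bigr do rewrite mulr_suml.
rewrite exchange_big /= -[in LHS](proj_id Sf) raddf_sum mulr_sumr big_seq [RHS]big_seq.
apply: eq_bigr => m; rewrite SSE => Sm; under eq_bigr do rewrite -mulrA.
by rewrite -mulr_sumr dV1 //= mcoeffZ mcoeffX; ring.
Qed.

Lemma co_sum n (I : Type) (r : seq I) (P : pred I) (f : I -> R) m :
  co n (\sum_(i <- r | P i) f i) m = \sum_(i <- r | P i) co n (f i) m.
Proof.
rewrite /co exchange_big; apply: eq_bigr => k _ /=.
by rewrite raddf_sum mulr_suml.
Qed.

Lemma coZ n c f m : co n (c *: f) m = c * co n f m.
Proof. by rewrite mulr_sumr; apply: eq_bigr => k _; rewrite mcoeffZ mulrA. Qed.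

Lemma co_theta n f j m : inS n f -> S n.+1 m ->
  bd n * co n.+1 (theta j * f) m =
  bd n.+1 * \sum_(k <- SS n | (k + g (vtx (fa k) j))%MM == m) co n f k.
Proof.
move=> Sf Sm; rewrite -coZ scalerAr co_expand // mulr_sumr co_sum mulr_sumr.
rewrite big_seq [RHS]big_seq_cond big_mkcondr; apply: eq_bigr => k; rewrite SSE => Sk.
rewrite -scalerAr coZ (theta_bas _ Sk) co_bas //.
  by case: eqP => _; rewrite ?mulr1 ?mulr0 // mulrC.
by rewrite -addn1; apply/S_add/S_g.
Qed.

(** Multiplication by [theta j] raises an excess by 1, so it never reaches the basis element at
    [rmon s], all of whose excesses are 0. *)
Lemma co_in_theta n f s : s \in F -> #|rs s| = n -> inS n f -> in_theta f ->
  co n f (rmon s) = 0.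
Proof.
move=> Fs rn Sf If; case: (in_theta_graded Sf If) => [->|[n' [nE [t St ->]]]].
  by rewrite /co big1 // => k _; rewrite mcoeff0 mul0r.
rewrite co_sum big1 // => j _; apply/eqP.
have Sr : S n (rmon s) by rewrite -rn; apply: S_rmon.
rewrite nE in Sr *; rewrite -(mulrI_eq0 _ (lregP (bd_neq0 n'))) co_theta //.
rewrite big_seq_cond big1 ?mulr0 // => k /andP[]; rewrite SSE => Sk /eqP kE.
by have := excess_rmon j Fs; rewrite -kE (excessD _ _ Sk) eqxx addn1.
Qed.

End Coordinates.

(** * Duality and injectivity *)

Section Duality.
Variables (l N D : nat) (T : triangulated_monoid l N D) (Q : generic_domain (parameter D N)).
Variable W : coherent T.
Local Notation g := (tmg T).
Local Notation S := (tmS T).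
Local Notation SS := (tmSS T).
Local Notation F := (tmF T).
Local Notation rs := (tmrs T).
Local Notation fa := (fa T).
Local Notation cf := (cf T).
Local Notation msum := (mon_sum g).
Local Notation rmon := (rmon T).
Local Notation excess := (excess T).
Local Notation w := (cw W).
Local Notation a j p := (par Q (inl (j, p))).

Local Notation R := {mpoly Q[l]}.
Local Notation theta := (theta g Q).
Local Notation in_theta := (@in_theta l N D g Q).

Local Notation inS := (@inS l N D T Q).
Local Notation bas := (bas T Q).
Local Notation bd := (bd Q W).
Local Notation co := (@co l N D T Q W).

Lemma S_decomp k a m : S (a + k) m -> exists w (p : 'I_k -> 'I_N),
  S a w /\ m = (w + \big[+%MM/0%MM]_j g (p j))%MM.
Proof.
elim: k m => [|k IHk] m.
  rewrite addn0 => Sm; exists m, (fun=> tmd T).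
  by rewrite big_ord0 addm0.
rewrite addnS => Sm; have [q pos] : exists q, (0 < cf m q)%N.
  have := cf_height Sm; case: (pickP (fun q => (0 < cf m q)%N)) => [q|c0]; first by exists q.
  by rewrite big1 // => q _; apply/eqP; rewrite -leqn0 leqNgt c0.
pose c p := (cf m p - (p == q))%N.
have cE : cf m =1 (fun p => c p + (p == q))%N.
  by move=> p; rewrite /c subnK //; case: eqP => [->|].
have mE : m = (msum c + g q)%MM by rewrite -{1}(cf_sum Sm) (eq_mon_sum _ cE) msum_add msum1.
have /IHk[w [p [Sw cwE]]] : S (a + k) (msum c).
  by apply: (@S_sub _ _ _ T 1 _ (g q)); rewrite ?S_g // add1n addmC -mE.
exists w, (fun j => oapp p q (unlift ord_max j)); split=> //.
rewrite mE cwE big_ord_recr /= unlift_none /= -addmA; congr (_ + (_ + _))%MM.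
apply: eq_bigr => j _; rewrite -[widen_ord _ j](_ : lift ord_max j = _) ?liftK //.
by apply: val_inj; rewrite /= /bump leqNgt ltn_ord.
Qed.

Lemma mpolyX_neq0 m : 'X_[m] != 0 :> R.
Proof.
by apply/negP => /eqP/mpolyP/(_ m)/eqP; rewrite mcoeffX eqxx mcoeff0 oner_eq0.
Qed.

Lemma factorX (e : 'X_{1..l}) (f : R) : (forall k, f@_k != 0 -> (e <= k)%MM) ->
  exists h, f = 'X_[e] * h.
Proof.
move=> ef; exists (\sum_(k <- msupp f) f@_k *: 'X_[k - e]).
rewrite {1}[f]mpolyE mulr_sumr big_seq [RHS]big_seq; apply: eq_bigr => k.
by rewrite mcoeff_msupp => /ef ek; rewrite -scalerAr -mpolyXD addmC submK.
Qed.

(** * The Cartier operator twisted by e *)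

Section Cartier.
Variables (sd r : nat) (e : 'X_{1..l}).
Hypotheses (D0 : (0 < D)%N) (sdr : (sd + r)%N = D) (Se : S r e).
Hypothesis Ge : forall n m, S n m -> (forall i, odd (m i) = odd (e i)) -> (e <= m)%MM.

Lemma ell_torsion i u y : inS i u -> in_theta (ell g Q * u) ->
  S (sd - i) y -> (i.*2 < sd)%N -> in_theta (u * 'X_[y]).
Proof.
move=> Su Iu Sy lt_i; set m := (e + y + y)%MM.
(* The degree r + 2(sd - i) is rewritten with sd + r = D; [i.*2 < sd] leaves room for the D + 1
   matchings that are split off next. *)
have Sm : S (((sd - i.*2.+1) + 1) + D) m.
  rewrite (_ : _ + D = r + (sd - i) + (sd - i))%N; last by rewrite -sdr; lia.
  by do 2?apply: S_add.
have [w1 [p [Sw1 mE]]] := S_decomp Sm.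
have [w [p0 [Sw w1E]]] := S_decomp Sw1; rewrite big_ord1 in w1E.
have [t] := theta_square_ideal w (p0 ord0) p Iu; rewrite -w1E -mE => tE.
set n2 := (i + i + (r + (sd - i) + (sd - i)) - 2)%N.
have {}tE : u ^+ 2 * 'X_[m] = \sum_j theta j ^+ 2 * proj T n2 (t j).
  have SL : inS n2.+2 (u ^+ 2 * 'X_[m]).
    rewrite (_ : n2.+2 = i + i + ((sd - i.*2.+1) + 1 + D))%N; last by rewrite /n2 -sdr; lia.
    by apply: inS_M; [rewrite expr2; apply: inS_M | apply: inS_X].
  rewrite -(proj_id SL) tE linear_sum; apply: eq_bigr => j _.
  by rewrite /= expr2 -!mulrA !proj_theta.
(* The factor for [e] turns the exponent e + m into 2(e + y), so the square root of the left side is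
   u times the monomial of e + y. *)
pose tau j := poly_sqrt ('X_[e] * proj T n2 (t j)).
have tauE : 'X_[e] * (u * 'X_[y]) = \sum_j theta j * tau j.
  transitivity (poly_sqrt ('X_[e] * (u ^+ 2 * 'X_[m]))).
    rewrite [X in poly_sqrt X]mulrCA -mpolyXD poly_sqrtM mulrCA -mpolyXD; congr (_ * _).
    rewrite -poly_sqrtX; congr (poly_sqrt 'X_[_]); apply/mnmP => k.
    by rewrite !mnmDE; lia.
  rewrite tE mulr_sumr raddf_sum; apply: eq_bigr => j _ /=.
  by rewrite mulrCA poly_sqrtM.
(* An exponent k of [tau j] has 2k - e in S, congruent to e modulo 2. By [Ge] it is at least e, so k
   is at least e and the twist can be divided out. *)
have tau_e j k : (tau j)@_k != 0 -> (e <= k)%MM.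
  rewrite mcoeff_coef_sqrt mulrC mcoeffMX_sub mcoeff_proj.
  case: ifP => [le_ek|]; last by rewrite raddf0 eqxx.
  case: ifP => [Sk _|]; last by rewrite raddf0 eqxx.
  have le : (e <= k + k - e)%MM.
    apply: Ge Sk _ => x; move/mnm_lepP/(_ x): le_ek.
    by rewrite mnmBE !mnmDE => le; rewrite oddB // addnn odd_double addFb.
  apply/mnm_lepP => x; move/mnm_lepP/(_ x): le; rewrite mnmBE mnmDE; lia.
have /choice[h hE] j : exists h, tau j = 'X_[e] * h by apply/factorX/tau_e.
exists h; apply: (mulfI (mpolyX_neq0 e)); rewrite tauE mulr_sumr.
by apply: eq_bigr => j _; rewrite hE mulrCA.
Qed.

End Cartier.

(** * Nondegeneracy of the socle functional *)

Section Nondegenerate.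
Variables (s0 : {set 'I_N}).
Hypotheses (D0 : (0 < D)%N) (Fs0 : s0 \in F).

(* [cov n f] says that the coordinates of [f] over the facet [s0] vanish; with
   [s0] of top degree this is the kernel of the socle functional. *)
Definition cov n f := inS n f /\ forall m, S n m -> fa m = s0 -> co n f m = 0.

Lemma cov_theta n f j : cov n f -> cov n.+1 (theta j * f).
Proof.
case=> Sf f0; split=> [|m Sm fam]; first by rewrite -add1n; apply/inS_M/Sf/inS_theta.
apply/eqP; rewrite -(mulrI_eq0 _ (lregP (bd_neq0 Q W n))) co_theta //.
rewrite big_seq_cond big1 ?mulr0 // => k /andP[]; rewrite SSE => Sk /eqP kE.
by apply: f0 => //; rewrite -fam -kE (faD _ Sk).
Qed.

(** Expanding [h] in the basis [bas] reduces the claim to the generators [rmon s], because [cov] is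
    stable under the [theta j]. *)
Lemma cov_all j f : inS j f ->
    (forall s, s \in F -> cov (j + #|rs s|) (f * 'X_[rmon s])) ->
  forall n h, inS n h -> cov (j + n) (f * h).
Proof.
move=> Sf f0 n h Sh; split=> [|m Sm fam]; first exact: inS_M.
apply/eqP; rewrite -(mulrI_eq0 _ (lregP (bd_neq0 Q W n))) -coZ scalerAr.
rewrite co_expand // mulr_sumr co_sum big_seq big1 // => k; rewrite SSE => Sk.
rewrite -scalerAr coZ basE mulrA; have [Fk _ _] := fa_adm Sk.
have [_ ->//] : cov (j + n) (f * 'X_[rmon (fa k)] * \prod_i theta i ^+ excess k i).
  2: by rewrite mulr0.
rewrite (excess_height Sk) addnA; apply: (theta_prod_closed (P := cov)).
  exact: cov_theta.
exact: f0.
Qed.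

Lemma size_SS n : size (SS n) = (\sum_(s in F) count (fun m => fa m == s) (SS n))%N.
Proof.
transitivity (\sum_(m <- SS n) 1)%N; first by rewrite sum1_size.
under [RHS]eq_bigr do rewrite -sum1_count big_mkcond /=.
rewrite exchange_big big_seq [RHS]big_seq /=; apply: eq_bigr => m; rewrite SSE => Sm.
have [Fs _ _] := fa_adm Sm.
by rewrite (bigD1 (fa m)) //= eqxx big1 // => s /andP[_ /negPf]; rewrite eq_sym => ->.
Qed.

Lemma rs_card_le s : s \in F -> (#|rs s| <= D)%N.
Proof.
by move=> Fs; have := subset_leq_card (rs_sub Fs); rewrite (F_card Fs).
Qed.

Lemma size_SS_growth j : exists n,
  (size (SS (j + n)) < size (SS n) + count (fun m => fa m == s0) (SS (j + n)))%N.
Proof.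
have [y0 /(_ y0 (leqnn _)) lt_y] := bin_slow_growth D.-1 (j + D) #|F|.
exists (y0 + D)%N; rewrite half_open_count // /cone_count ifT; last first.
  by have := rs_card_le Fs0; lia.
apply: leq_ltn_trans (leq_trans lt_y _).
  rewrite size_SS -sum_nat_const; apply: leq_sum => s Fs.
  rewrite half_open_count // /cone_count; case: ifP => // _; apply: leq_bin2l.
  by lia.
rewrite mulSn addnC; apply: leq_add.
  rewrite size_SS -sum_nat_const; apply: leq_sum => s Fs.
  rewrite half_open_count // /cone_count ifT; last by have := rs_card_le Fs; lia.
  by apply: leq_bin2l; have := rs_card_le Fs; lia.
by apply: leq_bin2l; have := rs_card_le Fs0; lia.
Qed.

(** The products [f * h] with [h] of degree n have no coordinates over [s0], so they lie in a space
    that [size_SS_growth] makes smaller than degree n for a suitable n. Some nonzero [h] is then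
    killed by [f], and polynomials over a domain have no zero divisors. *)
Lemma cov_nondegenerate j f : inS j f ->
  (forall s, s \in F -> cov (j + #|rs s|) (f * 'X_[rmon s])) -> f = 0.
Proof.
move=> Sf f0; apply/eqP; apply: contrapT => /negP nzf.
have [n lt_n] := size_SS_growth j.
have [||u [m0 Sm0 nz0] u0] := @seq_left_kernel Q _ _ (SS n)
    [seq m <- SS (j + n) | fa m != s0] (fun k m => co (j + n) (f * 'X_[k]) m).
- exact: SS_uniq.
- rewrite size_filter; move: lt_n.
  by rewrite -{1}(count_predC (fun m => fa m == s0)) [(size _ + _)%N]addnC ltn_add2l.
pose h := \sum_(k <- SS n) u k *: 'X_[k] : R.
have Sh : inS n h by apply: inS_sum => k; rewrite SSE => Sk _; apply/inS_Z/inS_X.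
have nzh : h != 0.
  apply: contraNneq nz0 => /mpolyP/(_ m0); rewrite raddf_sum mcoeff0 /= => <-.
  rewrite (bigD1_seq m0) ?SS_uniq //= mcoeffZ mcoeffX eqxx mulr1 big1 ?addr0 //.
  by move=> k /negPf nk; rewrite mcoeffZ mcoeffX nk mulr0.
have /negP[] : f * h != 0 by rewrite mulf_neq0.
have [Sfh fh0] := cov_all Sf f0 Sh.
rewrite -(mulrI_eq0 _ (lregP (_ : (bd (j + n))%:MP != 0))); last first.
  by rewrite mpolyC_eq0 bd_neq0.
rewrite mul_mpolyC co_expand // big_seq big1 // => m Sm.
rewrite SSE in Sm; have [fam|nfam] := eqVneq (fa m) s0; first by rewrite fh0 ?scale0r.
suff -> : co (j + n) (f * h) m = 0 by rewrite scale0r.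
rewrite /h mulr_sumr co_sum -[RHS](u0 m) ?mem_filter ?nfam ?SSE //.
by apply: eq_bigr => k _; rewrite -scalerAr coZ.
Qed.

End Nondegenerate.

(** * Perfect pairing and the increasing half of the h-vector *)

Section Symmetric.
Variables (sd r : nat) (e : 'X_{1..l}).
Hypotheses (D0 : (0 < D)%N) (sdr : (sd + r)%N = D) (Se : S r e).
Hypothesis Ge : forall n m, S n m -> (forall i, odd (m i) = odd (e i)) -> (e <= m)%MM.
Local Notation hn k := #|[set s in F | #|rs s| == k]|.
Hypothesis hn_sym : forall k, (k <= sd)%N -> hn k = hn (sd - k)%N.
Hypothesis rs_le : forall s, s \in F -> (#|rs s| <= sd)%N.

Lemma sum_by_degree (G : nat -> nat) :
  (\sum_(s in F) G #|rs s| = \sum_(k < sd.+1) hn k * G k)%N.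
Proof.
rewrite (partition_big (fun s => inord #|rs s| : 'I_sd.+1) xpredT) //=.
apply: eq_bigr => k _; rewrite -sum_nat_const; apply: eq_big => s.
  rewrite inE; case Fs: (s \in F) => //=.
  by rewrite -(inj_eq val_inj) /= inordK // ltnS rs_le.
by case/andP=> Fs /eqP <-; rewrite inordK // ltnS rs_le.
Qed.

Lemma sum_degree_sym (G : nat -> nat) :
  (\sum_(s in F) G (sd - #|rs s|) = \sum_(s in F) G #|rs s|)%N.
Proof.
rewrite (sum_by_degree (fun k => G (sd - k)%N)) sum_by_degree.
rewrite (reindex_inj rev_ord_inj); apply: eq_bigr => k _ /=.
by rewrite subSS hn_sym ?leq_subr // subKn // -ltnS.
Qed.

(** The facet of 0 omits no face, and the symmetry turns it into one that omits [sd]. *)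
Lemma top_facet : exists2 s, s \in F & #|rs s| = sd.
Proof.
have hn0 : (0 < hn 0)%N.
  have [Fs _ _] := fa_adm (S_zero T); apply/card_gt0P; exists (fa 0%MM).
  by have := excess_height (S_zero T); rewrite inE Fs /=; lia.
move: hn0; rewrite hn_sym // subn0 => /card_gt0P[s]; rewrite inE => /andP[Fs /eqP].
by exists s.
Qed.

Lemma in_theta_sum (I : Type) (rI : seq I) (P : pred I) (f : I -> R) :
  (forall i, P i -> in_theta (f i)) -> in_theta (\sum_(i <- rI | P i) f i).
Proof.
move=> If; elim/big_rec: _ => [|i h Pi [t ->]].
  by exists (fun=> 0); rewrite big1 // => j _; rewrite mulr0.
have [t' ->] := If i Pi; exists (fun j => t' j + t j).
by rewrite -big_split; apply: eq_bigr => j _; rewrite mulrDr.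
Qed.

Lemma in_thetaZ c f : in_theta f -> in_theta (c *: f).
Proof.
case=> t ->; exists (fun j => c *: t j); rewrite scaler_sumr.
by apply: eq_bigr => j _; rewrite scalerAr.
Qed.

(** If [U s1] were nonzero, a nonzero [f] of degree sd - i could be chosen by linear algebra to
    satisfy all conditions of [cov_nondegenerate] but one, and the hypothesis on [U] would force the
    remaining one. *)
Lemma perfect_pairing i (U : {set 'I_N} -> Q) : (i <= sd)%N ->
    (forall y, S (sd - i) y ->
      in_theta ((\sum_(s in F | #|rs s| == i) U s *: 'X_[rmon s]) * 'X_[y])) ->
  forall s, s \in F -> #|rs s| = i -> U s = 0.
Proof.
move=> le_i IU s1 Fs1 rs1; have [s0 Fs0 rs0] := top_facet.
set j := (sd - i)%N in IU; apply/eqP; apply: contrapT => /negP nzU.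
pose t0 := [seq (s, m) | s <- enum F, m <- [seq m <- SS (j + #|rs s|) | fa m == s0]].
have mem_t0 s m : ((s, m) \in t0) = [&& s \in F, S (j + #|rs s|) m & fa m == s0].
  apply/allpairsPdep/and3P => [[s' [m' []]]|[Fs Sm fam]].
    by rewrite mem_enum mem_filter SSE => Fs /andP[fam Sm] [-> ->].
  by exists s, m; split; rewrite ?mem_enum ?mem_filter ?fam ?SSE.
have x_t0 : (s1, rmon s0) \in t0.
  rewrite mem_t0 Fs1 fa_rmon // eqxx andbT /= rs1.
  by rewrite (_ : j + i = #|rs s0|)%N ?S_rmon // rs0 subnK.
(* As [s0] omits [sd] faces, it has as many points in degree j + k as a facet omitting sd - k faces
   has in degree j. By symmetry the conditions are as many as the unknowns, so dropping one leaves a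
   nonzero solution. *)
have size_t0 : size t0 = size (SS j).
  rewrite size_allpairs_dep sumnE big_map big_enum /= (size_SS j).
  pose G k := (if (k <= j)%N then 'C(j - k + D.-1, D.-1) else 0)%N.
  transitivity (\sum_(s in F) G (sd - #|rs s|))%N.
    apply: eq_bigr => s Fs; rewrite size_filter half_open_count // rs0 /G /cone_count.
    have le := rs_le Fs; rewrite (_ : (sd - #|rs s| <= j)%N = (sd <= j + #|rs s|)%N); last lia.
    by rewrite subnBA.
  rewrite sum_degree_sym; apply: eq_bigr => s Fs.
  by rewrite half_open_count.
have [||u [y0 Sy0 nz0] u0] := @seq_left_kernel Q _ _ (SS j) (rem (s1, rmon s0) t0)
    (fun y sm => co (j + #|rs sm.1|) ('X_[y] * 'X_[rmon sm.1]) sm.2).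
- exact: SS_uniq.
- by rewrite size_rem // -size_t0 prednK //; case: (t0) x_t0.
pose f := \sum_(y <- SS j) u y *: 'X_[y] : R.
have Sf : inS j f by apply: inS_sum => k; rewrite SSE => Sk _; apply/inS_Z/inS_X.
have fE s m : \sum_(y <- SS j) u y * co (j + #|rs s|) ('X_[y] * 'X_[rmon s]) m =
    co (j + #|rs s|) (f * 'X_[rmon s]) m.
  by rewrite mulr_suml co_sum; apply: eq_bigr => y _; rewrite -scalerAl coZ.
have f_rest s m : s \in F -> S (j + #|rs s|) m -> fa m = s0 ->
    (s, m) != (s1, rmon s0) -> co (j + #|rs s|) (f * 'X_[rmon s]) m = 0.
  move=> Fs Sm fam ne; rewrite -fE; apply: (u0 (s, m)).
  have : (s, m) \in t0 by rewrite mem_t0 Fs Sm fam eqxx.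
  by rewrite (perm_mem (perm_to_rem x_t0)) inE (negPf ne).
(* The product of [f] with the given combination lies in the ideal, so its coordinate at [rmon s0]
   is zero; by the choice of [f] only the summand of [s1] contributes to it. *)
have f_x : co sd (f * 'X_[rmon s1]) (rmon s0) = 0.
  set v := \sum_(s in F | _) _ in IU.
  have Iv : in_theta (f * v).
    rewrite mulr_suml big_seq; apply: in_theta_sum => y; rewrite SSE => Sy.
    by rewrite -scalerAl mulrC; apply/in_thetaZ/IU.
  have Sv : inS i v.
    apply: inS_sum => s _ /andP[_ /eqP <-]; exact/inS_Z/inS_X/S_rmon.
  have Sfv : inS sd (f * v) by rewrite -(subnK le_i); apply: inS_M.
  have := co_in_theta W Fs0 rs0 Sfv Iv; rewrite /v mulr_sumr co_sum.
  rewrite (bigD1 s1) /= ?Fs1 ?rs1 //= big1 => [|s]; last first.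
    case/andP=> /andP[Fs /eqP rsi] ns; rewrite -scalerAr coZ.
    have := @f_rest s (rmon s0) Fs; rewrite rsi subnK // fa_rmon //.
    rewrite -{1}rs0 S_rmon => -> //; first by rewrite mulr0.
    by apply: contra ns => /eqP[->].
  rewrite addr0 -scalerAr coZ => /eqP; rewrite mulf_eq0 (negPf nzU) => /eqP.
  exact.
have f0 : f = 0.
  apply: (cov_nondegenerate D0 Fs0 Sf) => s Fs; split.
    by apply: inS_M Sf _; apply/inS_X/S_rmon.
  move=> m Sm fam; have [[-> mE]|ne] := eqVneq (s, m) (s1, rmon s0).
    by rewrite rs1 subnK // mE.
  exact: f_rest.
case/eqP: nz0; move/mpolyP/(_ y0): f0; rewrite raddf_sum mcoeff0 /= => <-.
rewrite (bigD1_seq y0) ?SS_uniq //= mcoeffZ mcoeffX eqxx mulr1 big1 ?addr0 //.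
by move=> k /negPf nk; rewrite mcoeffZ mcoeffX nk mulr0.
Qed.

Lemma bas_in_theta n m : S n m -> m != rmon (fa m) -> in_theta (bas m).
Proof.
move=> Sm ne; have [j ej] : exists j, (0 < excess m j)%N.
  apply: contrapT => no; case/eqP: ne; apply: (excess_eq0 Sm) => j; apply/eqP.
  by rewrite -leqn0 leqNgt; apply/negP => ej; apply: no; exists j.
have [n' _ [m' Sm' [-> _ _]]] := excess_gt0 Sm ej.
exists (fun i => if i == j then bas m' else 0); rewrite (bigD1 j) //= eqxx.
rewrite big1 => [|i /negPf->]; last by rewrite mulr0.
by rewrite addr0 (theta_bas _ _ Sm').
Qed.

(** A drop from i to i + 1 would give a nonzero combination [v] of the generators of degree i for
    which [ell * v] has no coordinates at the generators of degree i + 1, hence lies in the ideal up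
    to the denominator. [ell_torsion] and [perfect_pairing] then make [v] zero. *)
Theorem h_increasing i : (i.*2 < sd)%N -> (hn i <= hn i.+1)%N.
Proof.
move=> lt_i; rewrite leqNgt; apply/negP => gt_h.
have [||U [s1 s1in nz1] U0] := @seq_left_kernel Q _ _
    (enum [set s in F | #|rs s| == i]) (enum [set s in F | #|rs s| == i.+1])
    (fun s s' => co i.+1 (ell g Q * 'X_[rmon s]) (rmon s')).
- exact: enum_uniq.
- by rewrite -!cardE.
move: s1in; rewrite mem_enum inE => /andP[Fs1 /eqP rs1].
pose v := \sum_(s in F | #|rs s| == i) U s *: 'X_[rmon s] : R.
have Sv : inS i v by apply: inS_sum => s _ /andP[_ /eqP <-]; exact/inS_Z/inS_X/S_rmon.
have Slv : inS i.+1 (ell g Q * v) by rewrite -add1n; apply: inS_M => //; apply: inS_ell.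
have lv0 s : s \in F -> #|rs s| = i.+1 -> co i.+1 (ell g Q * v) (rmon s) = 0.
  move=> Fs rsi; rewrite -(U0 s) ?mem_enum ?inE ?Fs ?rsi ?eqxx // big_enum /=.
  rewrite mulr_sumr co_sum; apply: eq_big => s'; first by rewrite inE.
  by move=> _; rewrite -scalerAr coZ.
have Ilv : in_theta (ell g Q * (bd i.+1 *: v)).
  rewrite -scalerAr co_expand // big_seq; apply: in_theta_sum => m; rewrite SSE => Sm.
  have [mE|ne] := eqVneq m (rmon (fa m)); last exact/in_thetaZ/(bas_in_theta Sm).
  have [Fm _ _] := fa_adm Sm; have rsm : #|rs (fa m)| = i.+1.
    by apply: (S_height (S_rmon T (fa m))); rewrite -mE.
  rewrite mE lv0 // scale0r; exists (fun=> 0).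
  by rewrite big1 // => j _; rewrite mulr0.
have le_i : (i <= sd)%N by lia.
suff /eqP : bd i.+1 * U s1 = 0 by rewrite mulf_eq0 (negPf nz1) orbF (negPf (bd_neq0 _ _ _)).
apply: (@perfect_pairing i (fun s => bd i.+1 * U s)) => // y Sy.
have -> : \sum_(s in F | #|rs s| == i) (bd i.+1 * U s) *: 'X_[rmon s] = bd i.+1 *: v.
  by rewrite scaler_sumr; apply: eq_bigr => s _; rewrite scalerA.
by apply: (ell_torsion _ sdr Se Ge _ Ilv Sy lt_i) => //; apply: inS_Z.
Qed.

End Symmetric.

End Duality.

(** * The pulling triangulation of perfect matchings *)

Section MatchingMonoid.
Variables (V : finType) (l : nat) (A : V -> {set 'I_l}) (v0 : V).

Definition mS (n : nat) : pred 'X_{1..l} :=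
  fun m => [forall v, (\sum_(e in A v) m e)%N == n].

Definition pmatch (M : {set 'I_l}) := [forall v, #|M :&: A v| == 1%N].

Hypothesis covered : forall e, exists v, e \in A v.
Hypothesis hall : forall n m, mS n.+1 m ->
  exists2 M, pmatch M & forall e, e \in M -> (0 < m e)%N.

Definition npm := #|[set M | pmatch M]|.
Local Notation N := npm.
Definition pmt (i : 'I_N) : {set 'I_l} := enum_val i.
Definition pmg (i : 'I_N) : 'X_{1..l} := [multinom nat_of_bool (e \in pmt i) | e < l].

Lemma pmt_pm i : pmatch (pmt i).
Proof. by have := enum_valP i; rewrite inE. Qed.

Lemma pmt_surj M : pmatch M -> exists i, pmt i = M.
Proof.
move=> pM; have inM : M \in [set M | pmatch M] by rewrite inE.
by exists (enum_rank_in inM M); rewrite /pmt enum_rankK_in.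
Qed.

Lemma pmgE i e : pmg i e = (e \in pmt i).
Proof. exact: mnmE. Qed.

Lemma mSP n (m : 'X_{1..l}) : reflect (forall v, (\sum_(e in A v) m e)%N = n) (mS n m).
Proof. by apply: (iffP forallP) => h v; apply/eqP; apply: h. Qed.

Lemma mS_add a b m1 m2 : mS a m1 -> mS b m2 -> mS (a + b) (m1 + m2)%MM.
Proof.
move=> /mSP S1 /mSP S2; apply/mSP => v.
by rewrite (eq_bigr _ (fun e _ => mnmDE e m1 m2)) big_split /= S1 S2.
Qed.

Lemma mS_subn n a m1 m2 : mS n (m1 + m2)%MM -> mS a m1 ->
  (a <= n)%N /\ mS (n - a) m2.
Proof.
move=> /mSP S12 /mSP S1.
have e v : (a + \sum_(e in A v) m2 e = n)%N.
  by rewrite -(S12 v) (eq_bigr _ (fun e _ => mnmDE e m1 m2)) big_split /= S1.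
split; first by rewrite -(e v0) leq_addr.
by apply/mSP => v; rewrite -(e v) addKn.
Qed.

Lemma mS_sub a b m1 m2 : mS (a + b) (m1 + m2)%MM -> mS a m1 -> mS b m2.
Proof. by move=> S12 S1; have [_] := mS_subn S12 S1; rewrite addKn. Qed.

Lemma mS_height a b m : mS a m -> mS b m -> a = b.
Proof. by move=> /mSP/(_ v0) <- /mSP/(_ v0). Qed.

Lemma mS_zero : mS 0 0%MM.
Proof. by apply/mSP => v; rewrite big1 // => e _; rewrite mnm0E. Qed.

Lemma mS_g i : mS 1 (pmg i).
Proof.
apply/mSP => v; have /forallP/(_ v)/eqP := pmt_pm i => <-.
rewrite -sum1_card big_mkcond [RHS]big_mkcond; apply: eq_bigr => e _.
by rewrite inE pmgE; do 2!case: (_ \in _).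
Qed.

Lemma mS_muln n m k : mS n m -> mS (n * k) (m *+ k)%MM.
Proof.
move=> Sm; elim: k => [|k IHk]; first by rewrite muln0 mulm0n mS_zero.
by rewrite mulmS mulnS; apply: mS_add.
Qed.

Lemma mS0E m : mS 0 m -> m = 0%MM.
Proof.
move=> /mSP S0; apply/mnmP => e; rewrite mnm0E; have [v ve] := covered e.
by have /eqP := S0 v; rewrite sum_nat_eq0 => /forallP/(_ e); rewrite ve => /eqP.
Qed.

Lemma mS_bound n (m : 'X_{1..l}) e : mS n m -> (m e <= n)%N.
Proof.
move=> /mSP Sm; have [v ve] := covered e.
by rewrite -(Sm v) (bigD1 e) //= leq_addr.
Qed.

Definition mSS n : seq 'X_{1..l} :=
  [seq m <- [seq [multinom (f e : nat) | e < l]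
     | f : {ffun 'I_l -> 'I_n.+1} <- enum {ffun 'I_l -> 'I_n.+1}]
  | mS n m].

Lemma mSS_uniq n : uniq (mSS n).
Proof.
rewrite filter_uniq // map_inj_uniq ?enum_uniq // => f f' /mnmP ff'.
by apply/ffunP => e; apply: val_inj; have := ff' e; rewrite !mnmE.
Qed.

Lemma mSSE n : mSS n =i mS n.
Proof.
move=> m; rewrite mem_filter andb_idr // => Sm; apply/mapP.
exists [ffun e => inord (m e)]; first by rewrite mem_enum.
by apply/mnmP => e; rewrite mnmE ffunE inordK // ltnS mS_bound.
Qed.

Local Notation msum := (mon_sum pmg).

Lemma mS_msum c : mS (\sum_i c i)%N (msum c).
Proof.
rewrite /mon_sum; elim/big_rec2: _ => [|p m n _ Sm]; first exact: mS_zero.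
by apply: mS_add Sm; have := mS_muln (c p) (mS_g p); rewrite mul1n.
Qed.

(* The pulling triangulation for the given order of the matchings: [t] is
   standard when, for every [i], subtracting [pmt i] from a sum of later
   matchings of [t] is impossible. *)
Definition standard (t : {set 'I_N}) := forall i : 'I_N,
  exists2 e, e \in pmt i & forall k, k \in t -> (i < k)%N -> e \notin pmt k.

Lemma standardS (t t' : {set 'I_N}) : t' \subset t -> standard t -> standard t'.
Proof.
move=> sub st i; have [e ei et] := st i; exists e => // k kt.
exact: et (fintype.subsetP sub _ kt).
Qed.

(** Greedy choice: the matchings are taken in order and each is subtracted as often as possible,
    which leaves one of its edges with weight zero. That edge is the witness required by
    [standard]. *)
Lemma standard_exists n m : mS n m ->
  exists2 c, msum c = m & standard [set i | (0 < c i)%N].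
Proof.
move=> Sm.
pose inv (k : nat) c r := [/\ forall i : 'I_N, (k <= i)%N -> c i = 0%N,
  m = (msum c + r)%MM, exists n', mS n' r &
  forall i : 'I_N, (i < k)%N -> exists2 e, e \in pmt i
    & r e = 0%N /\ forall j : 'I_N, (i < j)%N -> (0 < c j)%N -> e \notin pmt j].
have step k : (k <= N)%N -> exists c r, inv k c r.
  elim: k => [_|k IHk lt_k].
    exists (fun=> 0%N), m; split=> //; last by exists n.
    by rewrite /mon_sum big1 ?add0m // => i _; rewrite mulm0n.
  have [c [r [c0 mE [n' Sr] wit]]] := IHk (ltnW lt_k); pose ik := Ordinal lt_k.
  have [e0 e0k] : exists e, e \in pmt ik.
    have /forallP/(_ v0)/eqP/esym := pmt_pm ik.
    by case: (set_0Vmem (pmt ik :&: A v0)) => [->|[e /setIP[]]]; [rewrite cards0 | exists e].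
  pose e1 := [arg min_(e < e0 in pmt ik) r e].
  have [e1k e1min] : e1 \in pmt ik /\ forall e, e \in pmt ik -> (r e1 <= r e)%N.
    by rewrite /e1; case: arg_minnP.
  pose a := r e1; pose c' i := (c i + (i == ik) * a)%N.
  pose r' := (r - pmg ik *+ a)%MM.
  have rE : r = (pmg ik *+ a + r')%MM.
    apply/mnmP => e; rewrite mnmDE mnmBE mulmnE pmgE subnKC //.
    by case: (boolP (e \in _)) => [/e1min|_]; rewrite ?mul1n ?mul0n.
  exists c', r'; split.
  - by move=> i lt_i; rewrite /c' c0 ?(ltnW lt_i) // -(inj_eq val_inj) /= gtn_eqF.
  - rewrite {1}mE rE addmA; congr (_ + _)%MM; rewrite msum_add; congr (_ + _)%MM.
    rewrite /mon_sum (bigD1 ik) //= eqxx mul1n big1 ?addm0 // => i /negPf->.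
    by rewrite mul0n mulm0n.
  - move: Sr; rewrite {1}rE => /mS_subn/(_ (mS_muln a (mS_g ik)))[_ Sr'].
    by exists (n' - 1 * a)%N.
  move=> i; rewrite ltnS leq_eqVlt => /orP[/eqP ei|lt_i].
    have -> : i = ik by apply: val_inj.
    exists e1 => //; split=> [|j lt_j].
      by rewrite mnmBE mulmnE pmgE e1k mul1n subnn.
    rewrite /c' c0; last exact: ltnW lt_j.
    have -> : (j == ik) = false by rewrite -(inj_eq val_inj) /= gtn_eqF.
    by rewrite mul0n.
  have [e ei [re ewit]] := wit i lt_i; exists e => //; split=> [|j lt_j].
    by rewrite mnmBE re.
  rewrite /c'; have [->|nj] := eqVneq j ik; last by rewrite addn0; apply: ewit.
  rewrite c0 // add0n mul1n => a0; apply/negP => /e1min.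
  by rewrite re leqNgt a0.
have [c [r [_ mE [n' Sr] wit]]] := step N (leqnn N).
(* A remainder of positive degree would contain a matching, but every matching now has an edge on
   which the remainder vanishes. *)
have r0 : r = 0%MM.
  case: n' Sr => [|n'] Sr; first exact: mS0E.
  have [M pM posM] := hall Sr; have [i iM] := pmt_surj pM.
  have [e ei [re _]] := wit i (ltn_ord i).
  by have := posM e; rewrite -iM ei re => /(_ isT).
exists c; first by rewrite mE r0 addm0.
move=> i; have [e ei [_ ewit]] := wit i (ltn_ord i); exists e => // k.
by rewrite inE => ck lt_k; apply: ewit.
Qed.

(** Once the earlier coefficients agree, the witness edge of [i] meets no later matching of the
    first sum, so the coefficient of [i] there is the largest possible. Exchanging the two sums
    gives equality. *)
Lemma standard_unique c c' :
    standard [set i | (0 < c i)%N] -> standard [set i | (0 < c' i)%N] ->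
  msum c = msum c' -> c =1 c'.
Proof.
move=> st st' e; suff h n (i : 'I_N) : (i < n)%N -> c i = c' i.
  by move=> i; apply: (h N).
elim: n i => [//|n IHn] i; rewrite ltnS leq_eqVlt => /orP[/eqP iE|]; last exact: IHn.
have le_c (d d' : 'I_N -> nat) : standard [set i | (0 < d i)%N] -> msum d = msum d' ->
    (forall j : 'I_N, (j < i)%N -> d j = d' j) -> (d' i <= d i)%N.
  move=> sd /mnmP eqd IH; have [x xi xwit] := sd i.
  have := eqd x; rewrite !msumE (bigID (fun j : 'I_N => j < i)%N) /=.
  rewrite [RHS](bigID (fun j : 'I_N => j < i)%N) /=.
  rewrite (eq_bigr (fun j => d' j * pmg j x)%N) => [/addnI|j lt_j]; last by rewrite IH.
  rewrite (bigD1 i) ?ltnn //= [RHS](bigD1 i) ?ltnn //= pmgE xi !muln1.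
  rewrite [X in (d i + X)%N]big1 ?addn0 => [->|j]; first exact: leq_addr.
  rewrite -leqNgt => /andP[le_ij nji]; rewrite pmgE.
  have [->//|dj] := posnP (d j); rewrite (negPf (xwit j _ _)) ?muln0 ?inE //.
  by rewrite ltn_neqAle le_ij andbT eq_sym.
apply/eqP; rewrite eqn_leq; apply/andP; split; apply: le_c => // j lt_j; last first.
  by apply: IHn; rewrite -iE.
by rewrite IHn // -iE.
Qed.

(** At the witness edge of [i] only matchings up to [i] contribute, with coefficient 1 at [i]: the
    system is unitriangular. The same triangularity gives the integrality in [facet_or_functional],
    that is, unimodularity. *)
Lemma standard_indep (R : pzRingType) t (c : 'I_N -> R) : standard t ->
    (forall i, i \notin t -> c i = 0) ->
    (forall e, \sum_i c i * (e \in pmt i)%:R = 0) ->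
  forall i, c i = 0.
Proof.
move=> st c0 ce; suff h n (i : 'I_N) : (i < n)%N -> c i = 0.
  by move=> i; apply: (h N).
elim: n i => [//|n IHn] i; rewrite ltnS leq_eqVlt => /orP[/eqP iE|]; last exact: IHn.
have [x xi xwit] := st i; have := ce x; rewrite (bigD1 i) //= xi mulr1.
rewrite big1 ?addr0 // => j nji; have [tj|tj] := boolP (j \in t); last first.
  by rewrite c0 ?mul0r.
have [lt_ji|lt_ij|/val_inj eij] := ltngtP j i; last by rewrite eij eqxx in nji.
  by rewrite IHn ?mul0r // -iE.
by rewrite (negPf (xwit j tj lt_ij)) mulr0.
Qed.

(** Spanning is required over the integers, so unimodularity is part of the notion;
    [facet_or_functional] derives it from spanning over the rationals. *)
Definition facet (t : {set 'I_N}) : Prop := standard t /\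
  forall k, exists2 la : 'I_N -> int, forall i, i \notin t -> la i = 0
    & forall e, (e \in pmt k)%:R = \sum_i la i * (e \in pmt i)%:R.

Lemma common_denominator (q : 'I_l -> rat) : exists2 d : int, d != 0
  & exists z : 'I_l -> int, forall e, d%:~R * q e = (z e)%:~R.
Proof.
exists (\prod_e denq (q e)); first by apply/prodf_neq0 => e _; apply: denq_neq0.
exists (fun e => numq (q e) * \prod_(e' | e' != e) denq (q e')) => e.
rewrite (bigD1 e) //= !intrM mulrAC; congr (_ * _).
by rewrite -[in X in _ * X](divq_num_den (q e)) mulrC divfK // intr_eq0 denq_neq0.
Qed.

(** If the rational span of [t] misses a matching, a column of the cokernel, cleared of
    denominators, is the functional [mu]. *)
Lemma facet_or_functional t : standard t -> facet t \/
  exists mu : 'I_l -> int, (forall i, i \in t -> \sum_(e in pmt i) mu e = 0)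
    /\ exists k, \sum_(e in pmt k) mu e != 0.
Proof.
move=> st; pose B : 'M[rat]_(#|t|, l) := \matrix_(j, e) (e \in pmt (enum_val j))%:R.
pose P : 'M[rat]_(N, l) := \matrix_(i, e) (e \in pmt i)%:R.
have sumP (f : 'I_l -> rat) i : \sum_e P i e * f e = \sum_(e in pmt i) f e.
  rewrite [RHS]big_mkcond; apply: eq_bigr => e _; rewrite mxE.
  by case: ifP; rewrite ?mul1r ?mul0r.
have [/submxP[Dm PE]|nPB] := boolP (P <= B)%MS; [left|right].
  split=> // k; pose la i := \sum_(j | enum_val j == i) Dm k j.
  have la0 i : i \notin t -> la i = 0.
    by move=> ti; rewrite /la big1 // => j /eqP ji; rewrite -ji enum_valP in ti.
  have laE e : (e \in pmt k)%:R = \sum_i la i * (e \in pmt i)%:R.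
    move/matrixP/(_ k e): PE; rewrite !mxE => ->.
    under [RHS]eq_bigr do rewrite mulr_suml.
    rewrite (exchange_big_dep xpredT) //=; apply: eq_bigr => j _.
    by rewrite (big_pred1 (enum_val j)) ?mxE // => i; rewrite eq_sym.
  have la_int n (i : 'I_N) : (i < n)%N -> la i \is a Num.int.
    elim: n i => [//|n IHn] i; rewrite ltnS leq_eqVlt => /orP[/eqP iE|]; last exact: IHn.
    have [x xi xwit] := st i; have := laE x; rewrite (bigD1 i) //= xi mulr1.
    move=> e; rewrite (_ : la i = (x \in pmt k)%:R - \sum_(j | j != i) la j * (x \in pmt j)%:R).
      2: by rewrite e addrK.
    rewrite rpredB ?rpred_nat // rpred_sum // => j nji.
    have [tj|tj] := boolP (j \in t); last by rewrite la0 ?mul0r ?rpred0.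
    have [lt_ji|lt_ij|/val_inj eij] := ltngtP j i; last by rewrite eij eqxx in nji.
      by rewrite rpredM ?rpred_nat // IHn // -iE.
    by rewrite (negPf (xwit j tj lt_ij)) mulr0 rpred0.
  have /choice[z zE] i : exists z : int, la i = z%:~R.
    by apply/intrP; apply: (la_int N).
  exists z => [i /la0|e]; first by rewrite zE => /eqP; rewrite intr_eq0 => /eqP.
  apply: (@intr_inj rat); rewrite rmorph_nat laE rmorph_sum; apply: eq_bigr => i _.
  by rewrite zE rmorphM /= rmorph_nat.
rewrite submxE in nPB; have [k [j nz]] : exists k j, (P *m cokermx B) k j != 0.
  apply: contrapT => no; case/eqP: nPB; apply/matrixP => k j; rewrite [RHS]mxE.
  by apply/eqP; apply: contrapT => /negP nz; apply: no; exists k, j.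
have [d nzd [z zE]] := common_denominator (fun e => cokermx B e j).
have sumz i : (\sum_(e in pmt i) z e)%:~R = d%:~R * (P *m cokermx B) i j.
  rewrite mxE sumP mulr_sumr rmorph_sum; apply: eq_bigr => e _.
  exact: esym (zE e).
exists z; split=> [i ti|]; last first.
  by exists k; rewrite -(intr_eq0 rat) sumz mulf_neq0 // intr_eq0.
apply/eqP; rewrite -(intr_eq0 rat) sumz mulf_eq0; apply/orP; right; apply/eqP.
have /matrixP/(_ (enum_rank_in ti i) j) := mulmx_coker B.
rewrite [RHS]mxE mxE => h; rewrite mxE -[RHS]h; apply: eq_bigr => e _.
by rewrite [P _ _]mxE [B _ _]mxE enum_rankK_in.
Qed.

Definition lam (t : {set 'I_N}) k : 'I_N -> int :=
  if pselect (exists2 la : 'I_N -> int, forall i, i \notin t -> la i = 0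
    & forall e, (e \in pmt k)%:R = \sum_i la i * (e \in pmt i)%:R)
  is left h then s2val (cid2 h) else fun=> 0.

Lemma lam_out (t : {set 'I_N}) k i : i \notin t -> lam t k i = 0.
Proof. by rewrite /lam; case: pselect => // h; case: cid2 => /= la la0 _ /la0. Qed.

Lemma lamE t k e : facet t ->
  (e \in pmt k)%:R = \sum_i lam t k i * (e \in pmt i)%:R.
Proof.
case=> _ /(_ k) h; rewrite /lam; case: pselect => // h'.
by case: cid2 => /= la _ ->.
Qed.

Definition coord t (c : 'I_N -> int) i := \sum_k c k * lam t k i.

Lemma coord_out (t : {set 'I_N}) c i : i \notin t -> coord t c i = 0.
Proof. by move=> ti; rewrite /coord big1 // => k _; rewrite lam_out ?mulr0. Qed.

Lemma coordE t c e : facet t ->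
  \sum_k c k * (e \in pmt k)%:R = \sum_i coord t c i * (e \in pmt i)%:R.
Proof.
move=> ft; under [RHS]eq_bigr do rewrite mulr_suml.
rewrite exchange_big; apply: eq_bigr => k _ /=; rewrite (lamE k e ft) mulr_sumr.
by apply: eq_bigr => i _; rewrite mulrA.
Qed.

Lemma standard_coord_unique (t : {set 'I_N}) (c c' : 'I_N -> int) : standard t ->
    (forall i, i \notin t -> c i = 0) -> (forall i, i \notin t -> c' i = 0) ->
    (forall e, \sum_i c i * (e \in pmt i)%:R = \sum_i c' i * (e \in pmt i)%:R) ->
  c =1 c'.
Proof.
move=> st c0 c0' ee i; apply/eqP; rewrite -subr_eq0; apply/eqP.
apply: (@standard_indep _ t (fun i => c i - c' i) st) => [j tj|e].
  by rewrite c0 // c0' // subrr.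
by under eq_bigr do rewrite mulrBl; rewrite sumrB ee subrr.
Qed.

Lemma sum_pmt_exchange (c : 'I_N -> int) (mu : 'I_l -> int) :
  \sum_k c k * \sum_(e in pmt k) mu e =
  \sum_e mu e * \sum_k c k * (e \in pmt k)%:R.
Proof.
under [RHS]eq_bigr do rewrite mulr_sumr.
rewrite [RHS]exchange_big; apply: eq_bigr => k _ /=; rewrite mulr_sumr big_mkcond.
by apply: eq_bigr => e _; case: ifP; rewrite ?mulr0 // mulr1 mulrC.
Qed.

Lemma msum_int c e :
  (msum c e)%:Z = \sum_i (c i)%:Z * (e \in pmt i)%:R.
Proof.
rewrite msumE Posz_sum; apply: eq_bigr => i _.
by rewrite PoszM pmgE; case: (_ \in _).
Qed.

Definition tpow (x k : nat) : int := (x ^ k)%N%:Z.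

(** On the moment curve, the value of [mu t] at the vector with coefficients x^k is a nonzero
    polynomial in x. A positive integer that is a root of none of these finitely many polynomials
    avoids the span of every standard set that is not a facet. *)
Lemma generic_vector_exists : exists x (mu : {set 'I_N} -> 'I_l -> int), (0 < x)%N /\
  forall t, standard t -> ~ facet t ->
    (forall i, i \in t -> \sum_(e in pmt i) mu t e = 0)
    /\ \sum_(k < N) tpow x k * \sum_(e in pmt k) mu t e != 0.
Proof.
have /choice[mu muP] (t : {set 'I_N}) : exists mu : 'I_l -> int,
    standard t -> ~ facet t ->
    (forall i, i \in t -> \sum_(e in pmt i) mu e = 0)
    /\ exists k, \sum_(e in pmt k) mu e != 0.
  case: (pselect (standard t /\ ~ facet t)) => [[st nf]|no].
    by have [//|[mu hmu]] := facet_or_functional st; exists mu.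
  by exists (fun=> 0) => st nf; case: no.
pose q t : {poly int} := if `[< standard t /\ ~ facet t >]
  then \poly_(k < N) (if insub k is Some k' then \sum_(e in pmt k') mu t e else 0)
  else 1.
have qE t (k : 'I_N) : standard t -> ~ facet t -> (q t)`_k = \sum_(e in pmt k) mu t e.
  by move=> st nf; rewrite /q (asboolT (conj st nf)) coef_poly ltn_ord valK.
have nzq t : q t != 0.
  case: (pselect (standard t /\ ~ facet t)) => [[st nf]|no]; last first.
    by rewrite /q asboolF // oner_eq0.
  have [_ [k nzk]] := muP t st nf; apply: contraNneq nzk => q0.
  by rewrite -(qE t k) // q0 coef0.
pose Qp := \prod_t q t; have nzQ : Qp != 0 by apply/prodf_neq0 => t _.
pose s := [seq k%:Z | k <- iota 1 (size Qp)].
have /allPn[z /mapP[x]] : ~~ all (root Qp) s.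
  apply/negP => rs; have us : uniq s by rewrite map_inj_uniq ?iota_uniq // => a b [].
  by have := max_poly_roots nzQ rs us; rewrite size_map size_iota ltnn.
rewrite mem_iota => /andP[x0 _] -> nroot; exists x, mu; split=> // t st nf.
have [mu0 _] := muP t st nf; split=> //.
have : (q t).[x%:Z] != 0.
  apply: contraNneq nroot => q0; rewrite /root /Qp horner_prod.
  by rewrite (bigD1 t) //= q0 mul0r.
rewrite (horner_coef_wide (n := N)); last first.
  by rewrite /q (asboolT (conj st nf)) size_poly.
congr (_ != 0); apply: eq_bigr => k _; rewrite qE // mulrC; congr (_ * _).
by rewrite /tpow -[RHS]natz natrX natz.
Qed.

Lemma lam_height t k : facet t -> \sum_i lam t k i = 1.
Proof.
move=> ft; have one i : \sum_(e in A v0) (e \in pmt i)%:R = 1 :> int.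
  have /mSP/(_ v0) := mS_g i; move/(congr1 Posz); rewrite Posz_sum => e1.
  by rewrite -[RHS]e1; apply: eq_bigr => e _; rewrite pmgE; case: (_ \in _).
rewrite -[RHS](one k); under [RHS]eq_bigr do rewrite (lamE k _ ft).
rewrite exchange_big; apply: eq_bigr => i _ /=.
by rewrite -mulr_sumr one mulr1.
Qed.

Lemma facet_remove t i : facet t -> i \in t -> ~ facet (t :\ i).
Proof.
move=> ft ti ft'; have [st _] := ft.
have : (fun j => (j == i)%:R) =1 lam (t :\ i) i.
  apply: (standard_coord_unique st) => [j tj|j tj|e].
  - by case: eqP tj => [->|//]; rewrite ti.
  - by apply: lam_out; rewrite !inE (negPf tj) andbF.
  rewrite -(lamE i e ft') (bigD1 i) //= eqxx mul1r big1 ?addr0 // => j /negPf->.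
  by rewrite mul0r.
by move/(_ i); rewrite eqxx lam_out // !inE eqxx.
Qed.

(** * Half-open decomposition by a generic vector *)

Section Triangulation.
Variables (x : nat) (mu : {set 'I_N} -> 'I_l -> int) (K : nat).
Local Notation vf := (tpow x).
Local Notation gv := (msum (fun k => x ^ k)%N).
Local Notation vc t := (coord t (fun k : 'I_N => vf k)).
Local Notation muv t := (\sum_(k < N) vf k * \sum_(e in pmt k) mu t e).
Hypothesis x_gt0 : (0 < x)%N.
Hypothesis mu_van : forall t, standard t -> ~ facet t ->
  forall i, i \in t -> \sum_(e in pmt i) mu t e = 0.
Hypothesis muv_neq0 : forall t, standard t -> ~ facet t -> muv t != 0.
Hypothesis K_muv : forall t, `|muv t| < K%:Z.
Hypothesis K_vc : forall t i, `|vc t i| < K%:Z.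
Hypothesis K_gv : forall e, (gv e < K)%N.

(** Otherwise the generic vector would lie in the span of [t :\ i], which is standard but not a
    facet. *)
Lemma vc_neq0 t i : facet t -> i \in t -> vc t i != 0.
Proof.
move=> ft ti; have st' : standard (t :\ i) by apply: standardS (subD1set _ _) ft.1.
have nf := facet_remove ft ti; apply: contraNneq (muv_neq0 st' nf) => v0'.
rewrite sum_pmt_exchange; under eq_bigr do rewrite (coordE _ _ ft).
rewrite -sum_pmt_exchange big1 // => j _.
have [->|nji] := eqVneq j i; first by rewrite v0' mul0r.
have [tj|tj] := boolP (j \in t); last by rewrite coord_out ?mul0r.
by rewrite mu_van ?mulr0 // !inE nji.
Qed.

(** If the support were not a facet, its functional [mu t] would vanish on K m + eps gv, making its
    nonzero value at [gv] a multiple of [K], which exceeds it in absolute value. The sign 1 serves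
    the monoid, -1 its interior. *)
Lemma perturbed_support (eps : int) (m : 'X_{1..l}) (d : 'I_N -> int) (c : 'I_N -> nat) :
    `|eps| = 1 -> standard [set i | (0 < c i)%N] ->
    (forall e, (m e)%:Z = \sum_k d k * (e \in pmt k)%:R) ->
    (forall e, (msum c e)%:Z = K%:Z * (m e)%:Z + eps * (gv e)%:Z) ->
  let t := [set i | (0 < c i)%N] in
  facet t /\ forall i, (c i)%:Z = K%:Z * coord t d i + eps * vc t i.
Proof.
move=> eps1 st md cE t.
have c_out i : i \notin t -> (c i)%:Z = 0 by rewrite inE -eqn0Ngt => /eqP->.
have ft : facet t.
  apply: contrapT => nf; have nz : muv t != 0 := muv_neq0 st nf.
  have lt := K_muv t.
  have : \sum_k (c k)%:Z * \sum_(e in pmt k) mu t e = 0.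
    rewrite big1 // => k _; have [tk|/c_out->] := boolP (k \in t); last by rewrite mul0r.
    by rewrite mu_van ?mulr0.
  rewrite sum_pmt_exchange; under eq_bigr do rewrite -msum_int cE mulrDr.
  rewrite big_split /=; under eq_bigr do rewrite mulrCA.
  rewrite -mulr_sumr; under [X in _ + X]eq_bigr do rewrite mulrCA msum_int.
  rewrite -mulr_sumr -sum_pmt_exchange; set q := \sum_e _.
  rewrite -[X in eps * X]/(muv t) => /eqP; rewrite addr_eq0 => /eqP e0.
  have : `|K%:Z * q| = `|muv t| by rewrite e0 normrN normrM eps1 mul1r.
  rewrite normrM (ger0_norm (x := K%:Z)) // => eK; move: lt nz; rewrite -eK.
  have [q0|nzq] := eqVneq q 0.
    by rewrite -normr_eq0 -eK q0 normr0 mulr0 eqxx.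
  have q1 : 1 <= `|q| by rewrite -gtz0_ge1 normr_gt0.
  by move=> lt _; nia.
split=> //; apply: (standard_coord_unique st) => [i|i ti|e]; first exact: c_out.
  by rewrite !coord_out // !mulr0 addr0.
rewrite -msum_int cE md [X in K%:Z * X](coordE d e ft) msum_int.
rewrite [X in eps * X](coordE (fun k => vf k) e ft).
rewrite !mulr_sumr -big_split; apply: eq_bigr => i _ /=.
by rewrite mulrDl !mulrA.
Qed.

Definition stdc (m : 'X_{1..l}) : 'I_N -> nat :=
  if pselect (exists2 c, msum c = m & standard [set i | (0 < c i)%N]) is left h
  then s2val (cid2 h) else fun=> 0%N.

Lemma stdcP n m : mS n m -> msum (stdc m) = m /\ standard [set i | (0 < stdc m i)%N].
Proof.
by move=> /standard_exists h; rewrite /stdc; case: pselect => // h'; case: cid2.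
Qed.

Lemma stdc_unique n m c : mS n m -> msum c = m -> standard [set i | (0 < c i)%N] ->
  stdc m =1 c.
Proof.
by move=> Sm cm sc; have [e s] := stdcP Sm; apply: standard_unique => //; rewrite e.
Qed.

(* [gv] is a generic point of the cone and [m *+ K + gv] a perturbation of [m]
   into the interior of the facet cone [tfa m] containing [m]; the coordinates
   of [gv] that are negative on a facet mark the faces that its half-open cone
   omits. *)
Definition tfa m := [set i | (0 < stdc (m *+ K + gv)%MM i)%N].
Definition tcf m i := `|coord (tfa m) (fun k => (stdc m k)%:Z) i|%N.
Definition tF := [set t | `[< facet t >]].
Definition trs (t : {set 'I_N}) := [set i in t | vc t i < 0].
Definition tpos (t : {set 'I_N}) := [set i in t | 0 < vc t i].

Lemma tFP t : reflect (facet t) (t \in tF).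
Proof. by rewrite inE; apply: asboolP. Qed.

Lemma trsE t : facet t -> t :\: trs t = tpos t.
Proof.
move=> ft; apply/setP => i; rewrite !inE andbC; case: (boolP (i \in t)) => //= ti.
by rewrite -leNgt lt_neqAle eq_sym vc_neq0.
Qed.

Lemma mS_gv : mS (\sum_(k < N) x ^ k)%N gv.
Proof. exact: mS_msum. Qed.

Lemma mS_perturb n m : mS n m -> exists n', mS n' (m *+ K + gv)%MM.
Proof. by move=> Sm; exists (n * K + \sum_(k < N) x ^ k)%N; apply/mS_add/mS_gv/mS_muln. Qed.

Lemma stdc_int n m e : mS n m ->
  (m e)%:Z = \sum_k (stdc m k)%:Z * (e \in pmt k)%:R.
Proof. by move=> Sm; have [e0 _] := stdcP Sm; rewrite -{1}e0 msum_int. Qed.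

Lemma tfa_spec n m : mS n m -> facet (tfa m) /\ forall i,
  (stdc (m *+ K + gv)%MM i)%:Z =
  K%:Z * coord (tfa m) (fun k => (stdc m k)%:Z) i + vc (tfa m) i.
Proof.
move=> Sm; have [n' Sy] := mS_perturb Sm; have [ye ys] := stdcP Sy.
have [|ft h] := @perturbed_support 1 m _ _ (normr1 _) ys (fun e => stdc_int e Sm).
  by move=> e; rewrite ye mnmDE mulmnE PoszD PoszM mul1r mulrC.
by split=> // i; rewrite h mul1r.
Qed.

(** For integers d and v with |v| < K, the inequality K d + v > 0 forces d >= 0, and d > 0 when v <
    0. Hence the absolute value in [tcf] changes nothing, and the faces with negative v are
    omitted. *)
Lemma tcf_spec n m : mS n m ->
  (forall i, (tcf m i)%:Z = coord (tfa m) (fun k => (stdc m k)%:Z) i)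
  /\ (forall i, i \in trs (tfa m) -> (0 < tcf m i)%N).
Proof.
move=> Sm; have [ft h] := tfa_spec Sm; set d := coord _ _ in h *.
have dpos i : i \in tfa m -> 0 <= d i /\ (vc (tfa m) i < 0 -> 0 < d i).
  move=> ti; have := h i; have := K_vc (tfa m) i; move: ti; rewrite inE => ti.
  by rewrite ltr_norml => /andP[lo up] e; split=> [|neg]; nia.
have dE i : (tcf m i)%:Z = d i.
  have [ti|ti] := boolP (i \in tfa m); last by rewrite /tcf -/d /d coord_out.
  by have [d0 _] := dpos i ti; rewrite /tcf -/d gez0_abs.
split=> // i; rewrite inE => /andP[ti neg]; have [_ /(_ neg)] := dpos i ti.
by rewrite -dE.
Qed.

Lemma tri_fa_adm n m : mS n m -> admissible tF trs (tfa m) (tcf m).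
Proof.
move=> Sm; have [ft _] := tfa_spec Sm; have [dE pos] := tcf_spec Sm.
split=> //; first exact/tFP.
by move=> i ti; apply/eqP; rewrite -eqz_nat dE coord_out.
Qed.

Lemma tri_cf_sum n m : mS n m -> msum (tcf m) = m.
Proof.
move=> Sm; have [ft _] := tfa_spec Sm; have [dE _] := tcf_spec Sm.
apply/mnmP => e; apply/eqP; rewrite -eqz_nat msum_int (stdc_int e Sm); apply/eqP.
by rewrite [RHS](coordE _ _ ft); apply: eq_bigr => i _; rewrite dE.
Qed.

Lemma admissible_perturb t c : admissible tF trs t c ->
  exists2 c', msum c' = (msum c *+ K + gv)%MM & [set i | (0 < c' i)%N] = t.
Proof.
case=> /tFP ft c0 c1; pose z i := K%:Z * (c i)%:Z + vc t i.
have zpos i : i \in t -> 0 < z i.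
  move=> ti; have := K_vc t i; have := vc_neq0 ft ti; rewrite /z.
  rewrite neq_lt => /orP[neg|pos]; rewrite ltr_norml => /andP[lo up]; last by nia.
  by have := c1 i; rewrite inE ti neg => /(_ isT); nia.
have z0 i : i \notin t -> z i = 0 by move=> ti; rewrite /z c0 // coord_out // mulr0 addr0.
have zE i : (`|z i|%N)%:Z = z i.
  by apply: gez0_abs; have [/zpos/ltW|/z0->] := boolP (i \in t).
exists (fun i => `|z i|%N).
  apply/mnmP => e; apply/eqP; rewrite -eqz_nat msum_int mnmDE mulmnE PoszD PoszM.
  rewrite !msum_int (coordE (fun k => vf k) e ft) mulr_suml -big_split.
  by apply/eqP; apply: eq_bigr => i _ /=; rewrite zE /z mulrDl; ring.
apply/setP => i; rewrite inE; have [ti|ti] := boolP (i \in t).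
  by rewrite absz_gt0 gt_eqF ?zpos.
by rewrite z0 // absz0.
Qed.

Lemma tri_adm_fa t c : admissible tF trs t c -> tfa (msum c) = t.
Proof.
move=> ac; have [c' c'E sE] := admissible_perturb ac; case: (ac) => /tFP ft _ _.
have [n' Sy] := mS_perturb (mS_msum c).
by rewrite -sE; apply/setP => i; rewrite !inE (stdc_unique Sy c'E) // sE; case: ft.
Qed.

Lemma tri_adm_cf t c : admissible tF trs t c -> tcf (msum c) =1 c.
Proof.
move=> ac i; have fat := tri_adm_fa ac; case: (ac) => /tFP ft c0 _.
have Sm := mS_msum c; have [dE _] := tcf_spec Sm.
have h : (fun i => (tcf (msum c) i)%:Z) =1 (fun i => (c i)%:Z).
  apply: (standard_coord_unique ft.1) => [j tj|j tj|e].
  - by rewrite dE fat coord_out.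
  - by rewrite c0.
  by rewrite -!msum_int (tri_cf_sum Sm).
by apply/eqP; rewrite -eqz_nat h.
Qed.

Lemma facet_card_le t t' : facet t -> facet t' -> (#|t| <= #|t'|)%N.
Proof.
move=> ft ft'; pose B (u : {set 'I_N}) : 'M[rat]_(#|u|, l) :=
  \matrix_(j, e) (e \in pmt (enum_val j))%:R.
have frB : row_free (B t).
  apply: inj_row_free => u uB; apply/rowP => j; rewrite mxE.
  pose c i := \sum_(j | enum_val j == i) u 0 j.
  have cE : c (enum_val j) = u 0 j.
    by rewrite /c (big_pred1 j) // => j'; rewrite (inj_eq enum_val_inj).
  rewrite -cE; apply: (@standard_indep _ t c ft.1) => [i ti|e].
    by rewrite /c big1 // => j' /eqP ji; rewrite -ji enum_valP in ti.
  move/rowP/(_ e): uB; rewrite !mxE => uB; rewrite -[RHS]uB.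
  under eq_bigr do rewrite mulr_suml.
  rewrite (exchange_big_dep xpredT) //=; apply: eq_bigr => j' _.
  by rewrite (big_pred1 (enum_val j')) ?mxE // => i; rewrite eq_sym.
rewrite -(eqP frB); apply: leq_trans (rank_leq_row (B t')); apply: mxrankS.
apply/row_subP => j; apply/submxP.
exists (\row_j' (lam t' (enum_val j) (enum_val j'))%:~R).
apply/rowP => e; rewrite !mxE -[LHS](rmorph_nat (intmul (1 : rat))) (lamE _ _ ft').
rewrite (bigID (mem t')) /= addrC big1 ?add0r => [|i ti]; last by rewrite lam_out ?mul0r.
rewrite big_enum_val rmorph_sum; apply: eq_bigr => j' _.
by rewrite !mxE rmorphM /= rmorph_nat.
Qed.

Lemma facet_card t t' : facet t -> facet t' -> #|t| = #|t'|.
Proof. by move=> ft ft'; apply/eqP; rewrite eqn_leq !facet_card_le. Qed.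

Lemma facet_card_gt0 t : facet t -> (0 < N)%N -> (0 < #|t|)%N.
Proof.
move=> ft N0; rewrite card_gt0; apply/eqP => t0.
have := lam_height (Ordinal N0) ft; rewrite big1 // => i _.
by rewrite lam_out // t0 inE.
Qed.

Lemma lam_in t k i : facet t -> k \in t -> lam t k i = (i == k)%:R.
Proof.
move=> ft tk; suff: lam t k =1 (fun i => (i == k)%:R) by apply.
apply: (standard_coord_unique ft.1) => [j|j tj|e]; first exact: lam_out.
  by case: eqP tj => [->|//]; rewrite tk.
rewrite -lamE // (bigD1 k) //= eqxx mul1r big1 ?addr0 // => j /negPf->.
by rewrite mul0r.
Qed.

(** * Interior points and reciprocity *)

Definition essential e := [exists i, e \in pmt i].
(** An edge in no perfect matching vanishes on the whole cone, so relative interior means positivity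
    on the other edges. *)
Definition interior (m : 'X_{1..l}) := [forall e, essential e ==> (0 < m e)%N].
Definition tfo m := [set i | (0 < stdc (m *+ K - gv)%MM i)%N].

Lemma gv_gt0 e : essential e -> (0 < gv e)%N.
Proof.
case/existsP=> i ei; rewrite msumE (bigD1 i) //= pmgE ei muln1.
by rewrite addn_gt0 expn_gt0 x_gt0.
Qed.

Lemma gv_eq0 e : ~~ essential e -> gv e = 0%N.
Proof.
rewrite negb_exists => /forallP ne; rewrite msumE big1 // => i _.
by rewrite pmgE (negPf (ne i)) muln0.
Qed.

Lemma mS_perturb_int n m : mS n m -> interior m ->
  (m *+ K - gv + gv)%MM = (m *+ K)%MM /\ exists n', mS n' (m *+ K - gv)%MM.
Proof.
move=> Sm /forallP im; have le : (gv <= m *+ K)%MM.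
  apply/mnm_lepP => e; rewrite mulmnE; have := im e.
  have [_|/gv_eq0->//] := boolP (essential e); rewrite /= => m0.
  by apply: leq_trans (ltnW (K_gv e)) _; rewrite leq_pmull.
have E := submK le; split=> //.
have S' : mS (n * K) (gv + (m *+ K - gv))%MM by rewrite addmC E; apply: mS_muln.
by have [_ ?] := mS_subn S' mS_gv; exists (n * K - \sum_(k < N) x ^ k)%N.
Qed.

(** For interior [m] the bound on [K] keeps K m - gv in the monoid. The reversed perturbation omits
    the faces with positive coordinate of [gv], and since no coordinate on [t] is zero these are the
    complement of [trs t]. *)
Lemma count_interior n t : facet t -> (0 < N)%N ->
  count (fun m => interior m && (tfo m == t)) (mSS n) = cone_count #|t| n #|t :\: trs t|.
Proof.
move=> ft N0; rewrite (trsE ft) -size_filter.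
have sub : tpos t \subset t by apply/fintype.subsetP => i; rewrite inE => /andP[].
have stc c : half_open t (tpos t) c -> standard [set i | (0 < c i)%N].
  case=> c0 _; apply: standardS ft.1; apply/fintype.subsetP => i; rewrite inE.
  by apply: contraTT => /c0->.
apply: (half_open_size sub (@eq_mon_sum _ _ pmg)).
- by move=> c c' /stc sc /stc sc'; apply: standard_unique.
- exact: facet_card_gt0.
- by rewrite filter_uniq ?mSS_uniq.
move=> m; rewrite mem_filter mSSE; split=> [/andP[/andP[im /eqP fm] Sm]|[c [hc cn ->]]].
  have [yE [n' Sy]] := mS_perturb_int Sm im; have [ye ys] := stdcP Sy.
  have [|_ h] := @perturbed_support (- 1) m _ _ (normrN1 _) ys (fun e => stdc_int e Sm).
    move=> e; have := congr1 (fun q : 'X_{1..l} => (q e)%:Z) yE.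
    rewrite ye mnmDE mulmnE PoszD PoszM => h; rewrite mulN1r [K%:Z * _]mulrC -h.
    by rewrite addrK.
  rewrite -/(tfo m) fm in h; set d := coord t _ in h.
  have dpos i : i \in t -> 0 <= d i /\ (0 < vc t i -> 0 < d i).
    move=> ti; have := h i; have := K_vc t i; move: ti; rewrite -{1}fm inE => ti.
    by rewrite ltr_norml => /andP[lo up] e; split=> [|pos]; nia.
  have dE i : (`|d i|%N)%:Z = d i.
    have [/dpos[d0 _]|ti] := boolP (i \in t); first by rewrite gez0_abs.
    by rewrite /d coord_out.
  have mE : m = msum (fun i => `|d i|%N).
    apply/mnmP => e; apply/eqP; rewrite -eqz_nat msum_int (stdc_int e Sm); apply/eqP.
    by rewrite (coordE _ _ ft); apply: eq_bigr => i _; rewrite dE.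
  exists (fun i => `|d i|%N); split=> //; last by apply: (mS_height (mS_msum _)); rewrite -mE.
  split=> i; first by move=> ti; rewrite /d coord_out.
  rewrite inE => /andP[ti pos]; have [_ /(_ pos)] := dpos i ti.
  by rewrite absz_gt0 => /gt_eqF->.
have [c0 c1] := hc; pose z i := K%:Z * (c i)%:Z - vc t i.
have zpos i : i \in t -> 0 < z i.
  move=> ti; have := K_vc t i; have := vc_neq0 ft ti; rewrite /z.
  rewrite neq_lt => /orP[neg|pos]; rewrite ltr_norml => /andP[lo up]; first by nia.
  by have := c1 i; rewrite inE ti pos => /(_ isT); nia.
have z0 i : i \notin t -> z i = 0 by move=> ti; rewrite /z c0 // coord_out // mulr0 subr0.
have zE i : (`|z i|%N)%:Z = z i.
  by apply: gez0_abs; have [/zpos/ltW|/z0->] := boolP (i \in t).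
have yE : (msum (fun i => `|z i|%N) + gv)%MM = (msum c *+ K)%MM.
  apply/mnmP => e; apply/eqP; rewrite -eqz_nat mnmDE mulmnE PoszD PoszM.
  rewrite !msum_int (coordE (fun k => vf k) e ft) mulr_suml -big_split.
  by apply/eqP; apply: eq_bigr => i _ /=; rewrite zE /z mulrBl; ring.
have sE : [set i | (0 < `|z i|)%N] = t.
  apply/setP => i; rewrite inE; have [ti|ti] := boolP (i \in t).
    by rewrite absz_gt0 gt_eqF ?zpos.
  by rewrite z0 // absz0.
have Sc : mS n (msum c) by rewrite -cn; apply: mS_msum.
rewrite [_ \in _]Sc andbT; apply/andP; split.
  apply/forallP => e; apply/implyP => /gv_gt0 ge.
  have := congr1 (fun q : 'X_{1..l} => q e) yE; rewrite mnmDE mulmnE.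
  by case: (msum c e) => //; lia.
have yE' : (msum c *+ K - gv)%MM = msum (fun i => `|z i|%N) by rewrite -yE addmK.
rewrite /tfo yE'; apply/eqP/setP => i; rewrite -[in RHS]sE !inE.
by rewrite (stdc_unique (mS_msum _) (erefl _)) // sE; case: ft.
Qed.

Lemma count_interior_total n : (0 < N)%N ->
  (count interior (mSS n) = \sum_(t in tF) cone_count #|t| n #|t :\: trs t|)%N.
Proof.
move=> N0; transitivity (\sum_(m <- mSS n | interior m) 1)%N; first by rewrite sum1_count.
under [RHS]eq_bigr => t /tFP ft do rewrite -count_interior // -sum1_count big_mkcond /=.
rewrite exchange_big big_mkcond big_seq [RHS]big_seq /=; apply: eq_bigr => m.
rewrite mSSE => Sm; case: ifP => im; last by rewrite big1.
have [yE [n' Sy]] := mS_perturb_int Sm im; have [ye ys] := stdcP Sy.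
have [|ft _] := @perturbed_support (- 1) m _ _ (normrN1 _) ys (fun e => stdc_int e Sm).
  move=> e; have := congr1 (fun q : 'X_{1..l} => (q e)%:Z) yE.
  rewrite ye mnmDE mulmnE PoszD PoszM => h; rewrite mulN1r [K%:Z * _]mulrC -h.
  by rewrite addrK.
rewrite (bigD1 (tfo m)) /=; last exact/tFP.
by rewrite eqxx big1 // => t /andP[_ /negPf]; rewrite eq_sym => ->.
Qed.

Variable k0 : 'I_N.
Local Notation D := #|tfa 0%MM|.

Lemma tri_F_card t : t \in tF -> #|t| = D.
Proof. by move/tFP => ft; apply: facet_card ft (tfa_spec mS_zero).1. Qed.

Lemma trs_sub t : t \in tF -> trs t \subset t.
Proof. by move=> _; apply/fintype.subsetP => i; rewrite inE => /andP[]. Qed.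

Definition matching_triangulation : triangulated_monoid l N D :=
  @TriangulatedMonoid l N D k0 pmg mS mSS mSS_uniq mSSE mS_add mS_sub mS_height
    mS_zero mS_g tF trs tri_F_card trs_sub tfa tcf tri_fa_adm tri_cf_sum
    tri_adm_fa tri_adm_cf.

(** * Regularity of the triangulation and the order of its facets *)

Lemma base_positive (b : nat) (z : nat -> int) i0 n : (i0 < n)%N ->
    (forall i, (i < i0)%N -> z i = 0) -> 1 <= z i0 ->
    (forall i, `|z i| < b%:Z) ->
  0 < \sum_(i < n) z i * (b ^ (n.-1 - i))%N%:Z.
Proof.
move=> lt_n z0 z1 zb; elim: n lt_n => [//|n IHn]; rewrite ltnS leq_eqVlt.
rewrite big_ord_recr /= subnn expn0 mulr1.
have -> : \sum_(i < n) z i * (b ^ (n - i))%N%:Z =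
    b%:Z * \sum_(i < n) z i * (b ^ (n.-1 - i))%N%:Z.
  rewrite mulr_sumr; apply: eq_bigr => i _; rewrite mulrCA -PoszM -expnS.
  by congr (_ * Posz (_ ^ _)%N); have := ltn_ord i; lia.
case/orP=> [/eqP ni|/IHn pos]; last first.
  by have := zb n; rewrite ltr_norml => /andP[lo up]; nia.
rewrite -ni big1 => [|i _]; first by rewrite mulr0 add0r; lia.
by rewrite z0 ?mul0r // ni.
Qed.

(** Let [i0] be the first index of disagreement and evaluate at its witness edge. Later matchings of
    [t] avoid this edge, so besides [i0] only [k] itself can contribute; the difference at [i0] is 0
    or 1, and it is not 0. *)
Lemma lam_lex t k : facet t -> k \notin t -> exists2 i0 : 'I_N,
  lam t k i0 - (i0 == k)%:R = 1
  & forall i : 'I_N, (i < i0)%N -> lam t k i - (i == k)%:R = 0.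
Proof.
move=> ft tk; pose z i := lam t k i - (i == k)%:R.
have zk : z k != 0 by rewrite /z lam_out // eqxx sub0r oppr_eq0 oner_eq0.
have [i0 nz0 min0] := @arg_minnP _ k (fun i => z i != 0) (fun i => i) zk.
have z_lt (i : 'I_N) : (i < i0)%N -> z i = 0.
  by move=> lt; apply/eqP; apply: contraTT lt => /min0; rewrite -leqNgt.
exists i0 => //; have [e ei ewit] := ft.1 i0.
have := lamE k e ft; move/eqP; rewrite eq_sym -subr_eq0 => /eqP sum0.
have {sum0} : \sum_i z i * (e \in pmt i)%:R = 0.
  under eq_bigr do rewrite mulrBl; rewrite sumrB -[RHS]sum0; congr (_ - _).
  by rewrite (bigD1 k) //= eqxx mul1r big1 ?addr0 // => j /negPf->; rewrite mul0r.
rewrite (bigD1 i0) //= ei mulr1 => sum0.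
have rest j : j != i0 -> z j * (e \in pmt j)%:R = - ((j == k) && (e \in pmt k))%:R.
  move=> nj; have [lt|lt|/val_inj ej] := ltngtP j i0; last by rewrite ej eqxx in nj.
    rewrite z_lt // mul0r; case: eqP => [jk|_]; last by rewrite oppr0.
    by move: zk; rewrite -jk z_lt ?eqxx.
  have [->|njk] := eqVneq j k.
    by rewrite /z lam_out // eqxx sub0r mulN1r.
  rewrite /= oppr0 /z (negPf njk) subr0; have [tj|tj] := boolP (j \in t).
    by rewrite (negPf (ewit j tj lt)) mulr0.
  by rewrite lam_out ?mul0r.
rewrite (eq_bigr _ rest) sumrN in sum0; move/eqP: sum0; rewrite subr_eq0 => /eqP z1.
apply/eqP; rewrite -[lam _ _ _ - _]/(z i0); move: nz0; rewrite z1.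
have [ki|nk] := eqVneq k i0.
  by rewrite big1 ?eqxx // => j; rewrite ki => /negPf->.
rewrite (bigD1 k) ?nk //= eqxx big1 ?addr0 => [|j /andP[_ /negPf->]] //.
by case: (e \in _).
Qed.

(* A facet and a matching outside it are compared at the first index where they
   differ, where the difference is 1; powers of a base exceeding all coefficients
   turn this lexicographic comparison into a strict inequality of weights. *)
Definition wbase : nat := (2 + \sum_t \sum_k \sum_i `|lam t k i|)%N.
(** The constant keeps the weights natural. It cancels in comparisons because the coordinates of a
    matching in a facet sum to 1. *)
Definition tw (k : 'I_N) : nat := (wbase ^ N - wbase ^ (N.-1 - k))%N.

Lemma twE k : (tw k)%:Z = (wbase ^ N)%N%:Z - (wbase ^ (N.-1 - k))%N%:Z.
Proof.
rewrite -subzn // leq_pexp2l //; have := ltn_ord k; lia.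
Qed.

(** The value at [k] of the linear function that agrees with [tw] on the facet [t]. By [wt_out] it
    lies strictly below [tw] off the facet, which is regularity. *)
Definition wt t k : int := \sum_i lam t k i * (tw i)%:Z.

Lemma wt_in t k : facet t -> k \in t -> wt t k = (tw k)%:Z.
Proof.
move=> ft tk; rewrite /wt (bigD1 k) //= lam_in // eqxx mul1r big1 ?addr0 // => i.
by rewrite lam_in // => /negPf->; rewrite mul0r.
Qed.

Lemma wt_out t k : facet t -> k \notin t -> wt t k < (tw k)%:Z.
Proof.
move=> ft tk; have [i0 z1 z0] := lam_lex ft tk.
pose z (n : nat) : int := if insub n is Some i then lam t k i - (i == k)%:R else 0.
have zE (i : 'I_N) : z i = lam t k i - (i == k)%:R by rewrite /z valK.
have := @base_positive wbase z i0 N (ltn_ord i0); rewrite zE z1 => pos.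
have : 0 < \sum_(i < N) z i * (wbase ^ (N.-1 - i))%N%:Z.
  apply: pos => // [i lt_i|n].
    by rewrite /z; case: insubP => // i' _ ii'; apply: z0; rewrite ii'.
  rewrite /z; case: insubP => [i _ _|_]; last by rewrite normr0.
  have : (`|lam t k i| <= \sum_t \sum_k \sum_i `|lam t k i|)%N.
    by rewrite (bigD1 t) //= (bigD1 k) //= (bigD1 i) //= -!addnA leq_addr.
  by rewrite /wbase; case: (i == k); lia.
under eq_bigr do rewrite zE mulrBl.
rewrite sumrB [X in _ - X](bigD1 k) //= eqxx mul1r [X in _ - (_ + X)]big1 ?addr0; last first.
  by move=> i /negPf->; rewrite mul0r.
rewrite subr_gt0 => lt; rewrite /wt; under eq_bigr do rewrite twE mulrBr.
rewrite sumrB -mulr_suml lam_height // mul1r twE.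
by rewrite ltrD2l ltrN2.
Qed.

Lemma wt_le t k : facet t -> wt t k <= (tw k)%:Z.
Proof.
by move=> ft; have [/(wt_in ft)->|/(wt_out ft)/ltW] := boolP (k \in t).
Qed.

Lemma sum_coord_wt t c : \sum_i coord t c i * (tw i)%:Z = \sum_k c k * wt t k.
Proof.
under eq_bigr do rewrite mulr_suml; rewrite exchange_big; apply: eq_bigr => k _ /=.
by rewrite mulr_sumr; apply: eq_bigr => i _; rewrite mulrA.
Qed.

Local Notation psi m := (\sum_p tcf m p * tw p)%N.

Lemma psi_add n m p : mS n m -> (psi (m + pmg p)%MM)%:Z =
  \sum_k (tcf m k + (k == p))%N%:Z * wt (tfa (m + pmg p)%MM) k.
Proof.
move=> Sm; have Smp := mS_add Sm (mS_g p); have [dE _] := tcf_spec Smp.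
have [ft _] := tfa_spec Smp; rewrite -sum_coord_wt Posz_sum; apply: eq_bigr => i _.
rewrite PoszM; congr (_ * _); move: i.
apply: (standard_coord_unique ft.1) => [i ti|i|e]; last 2 first.
- exact: coord_out.
- rewrite -msum_int (tri_cf_sum Smp) -(coordE _ _ ft) -msum_int.
  by rewrite msum_add msum1 (tri_cf_sum Sm).
by rewrite dE coord_out.
Qed.

Lemma psi_sum m p : (psi m + tw p)%N%:Z = \sum_k (tcf m k + (k == p))%N%:Z * (tw k)%:Z.
Proof.
under [RHS]eq_bigr do rewrite PoszD mulrDl.
rewrite big_split PoszD Posz_sum /=.
rewrite (eq_bigr (fun k => (tcf m k)%:Z * (tw k)%:Z)) => [|k _]; last exact: PoszM.
congr (_ + _); rewrite (bigD1 p) //= eqxx mul1r big1 ?addr0 // => k /negPf->.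
by rewrite mul0r.
Qed.

Lemma psi_le n m p : mS n m -> (psi (m + pmg p)%MM <= psi m + tw p)%N.
Proof.
move=> Sm; rewrite -lez_nat (psi_add p Sm) psi_sum; apply: ler_sum => k _.
have [ft _] := tfa_spec (mS_add Sm (mS_g p)).
by apply: ler_wpM2l => //; apply: wt_le.
Qed.

(** Both sides are sums over the generators of m and p, of [wt] for the facet of the sum and of
    [tw]. Equality holds term by term, so every generator that occurs lies in that facet. *)
Lemma psi_eq n m p : mS n m -> psi (m + pmg p)%MM = (psi m + tw p)%N ->
  p \in tfa (m + pmg p)%MM /\ forall q, (0 < tcf m q)%N -> q \in tfa (m + pmg p)%MM.
Proof.
move=> Sm /(congr1 Posz)/eqP; rewrite (psi_add p Sm) psi_sum eq_sym -subr_eq0 -sumrB.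
have [ft _] := tfa_spec (mS_add Sm (mS_g p)); set t := tfa _ in ft *.
rewrite psumr_eq0 => [/allP eq0|k _]; last first.
  by rewrite subr_ge0; apply: ler_wpM2l => //; apply: wt_le.
have in_t k : (0 < tcf m k + (k == p))%N -> k \in t.
  move=> pos; apply: contraTT (eq0 k (mem_index_enum k)) => tk.
  rewrite implyTb gt_eqF // subr_gt0 ltr_pM2l //; exact: wt_out.
split=> [|q pos]; apply: in_t; first by rewrite eqxx addn1.
by rewrite addn_gt0 pos.
Qed.

(** The linear function of the facet [t] evaluated at the generic vector [gv]; its values order the
    facets as in a line shelling, and [trank] makes them natural numbers. *)
Definition tval t : int := \sum_i vc t i * (tw i)%:Z.
Definition trank t := #|[set t' in tF | tval t' < tval t]|.

(** Expand [gv] in [t]. Vertices with negative coordinate lie in [t'], where [wt t'] equals [tw]; at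
    the others [wt t'] is at most [tw], strictly so at a vertex of [t] outside [t']. *)
Lemma tval_lt t t' : facet t -> facet t' -> trs t \subset t' -> t' != t ->
  tval t' < tval t.
Proof.
move=> ft ft' sub ne.
have vE : vc t' =1 coord t' (vc t).
  apply: (standard_coord_unique ft'.1) => [i|i|e]; [exact: coord_out.. |].
  by rewrite -!coordE.
have -> : tval t' = \sum_i vc t i * wt t' i.
  by rewrite -sum_coord_wt; apply: eq_bigr => i _; rewrite vE.
have le i : vc t i * wt t' i <= vc t i * (tw i)%:Z.
  have [neg|pos] := ltP (vc t i) 0; last by apply: ler_wpM2l => //; apply: wt_le.
  have ti : i \in t by apply: contraTT neg => /coord_out->; rewrite ltxx.
  by rewrite wt_in // (fintype.subsetP sub) // inE ti neg.
have [i ti ti'] : exists2 i, i \in t & i \notin t'.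
  apply/subsetPn; apply: contra ne => sub'; rewrite eq_sym.
  by rewrite eqEcard sub' (facet_card ft' ft) leqnn.
rewrite /tval (bigD1 i) //= [ltRHS](bigD1 i) //= ltr_leD ?ler_sum //.
rewrite ltr_pM2l ?wt_out // lt_neqAle eq_sym vc_neq0 // leNgt.
by apply: contra ti' => neg; rewrite (fintype.subsetP sub) // inE ti neg.
Qed.

Lemma trank_lt t t' : t \in tF -> t' \in tF -> trs t \subset t' -> t' != t ->
  (trank t' < trank t)%N.
Proof.
move=> /tFP ft /[dup] t'F /tFP ft' sub ne; have lt := tval_lt ft ft' sub ne.
apply: proper_card; apply/properP; split.
  apply/fintype.subsetP => u; rewrite !inE => /andP[-> h] /=; exact: lt_trans h lt.
by exists t'; [rewrite finset.in_set t'F | rewrite finset.in_set ltxx andbF].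
Qed.

Definition matching_coherent : coherent matching_triangulation :=
  @Coherent _ _ _ matching_triangulation tw trank psi_le psi_eq trank_lt.

End Triangulation.

Lemma absz_lt_sum (I : finType) (z : I -> int) (b : nat) i :
  (\sum_i `|z i| < b)%N -> `|z i| < b%:Z.
Proof.
move=> lt; have : (`|z i| <= \sum_i `|z i|)%N by rewrite (bigD1 i) //= leq_addr.
by lia.
Qed.

(** By parity (m + e)/2 is an integral point, and it is interior; being at least e, it gives m >=
    e. *)
Lemma interior_half n r e m : mS r e -> interior e ->
    (forall n m, mS n m -> interior m -> (e <= m)%MM) ->
  mS n m -> (forall i, odd (m i) = odd (e i)) -> (e <= m)%MM.
Proof.
move=> Se ie Ge Sm par; pose y := [multinom ((m i + e i)./2)%N | i < l].
have yE i : (y i + y i = m i + e i)%N.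
  by rewrite mnmE addnn -[RHS]odd_double_half oddD par addbb.
have Sy : mS ((n + r)./2) y.
  apply/mSP => v; have /mSP/(_ v) := mS_add Sm Se.
  rewrite (eq_bigr (fun i => y i + y i)%N) => [|i _]; last by rewrite mnmDE yE.
  by rewrite big_split /= => <-; rewrite addnn doubleK.
have iy : interior y.
  apply/forallP => i; apply/implyP => ei; have /forallP/(_ i) := ie.
  by rewrite ei /= => e0; have := yE i; have := par i; case: (m i) => [|?]; lia.
apply/mnm_lepP => i; have /mnm_lepP/(_ i) := Ge _ _ Sy iy.
by have := yE i; lia.
Qed.

Lemma count_interior_shift n r e : mS r e -> interior e ->
    (forall n m, mS n m -> interior m -> (e <= m)%MM) ->
  count interior (mSS n) = if (r <= n)%N then size (mSS (n - r)) else 0%N.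
Proof.
move=> Se ie Ge; have sub m : mS n m -> interior m -> (r <= n)%N /\ mS (n - r) (m - e)%MM.
  by move=> Sm im; apply: mS_subn Se; rewrite addmC submK ?(Ge _ _ Sm im).
case: leqP => [le_rn|lt_nr]; last first.
  apply/eqP; rewrite -leqn0 leqNgt -has_count; apply/hasPn => m.
  by rewrite mSSE => Sm; apply/negP => /(sub m Sm)[]; lia.
rewrite -size_filter -(size_map (fun m => (m + e)%MM) (mSS (n - r))).
apply/perm_size/uniq_perm.
- by rewrite filter_uniq ?mSS_uniq.
- by rewrite map_inj_uniq ?mSS_uniq //; apply: addIm.
move=> m; rewrite mem_filter mSSE; apply/andP/mapP => [[im Sm]|[m']].
  by have [_ S'] := sub m Sm im; exists (m - e)%MM; rewrite ?mSSE // submK ?(Ge _ _ Sm im).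
rewrite mSSE => Sm' ->; split; last by rewrite -(subnK le_rn); apply: mS_add.
apply/forallP => i; apply/implyP => ei; have /forallP/(_ i) := ie.
by rewrite ei /= mnmDE addn_gt0 => ->; rewrite orbT.
Qed.

Theorem matching_h_vector (k0 : 'I_N) :
  exists D (F : {set {set 'I_N}}) (h : {set 'I_N} -> nat),
  [/\ exists2 t, facet t & #|t| = D, (0 < D)%N,
     forall n, size (mSS n) = (\sum_(s in F) cone_count D n (h s))%N
   & forall r e, mS r e -> interior e ->
     (forall n m, mS n m -> interior m -> (e <= m)%MM) ->
     exists sd, [/\ forall s, s \in F -> (h s <= sd)%N,
       forall i, (i <= sd)%N -> #|[set s in F | h s == i]| = #|[set s in F | h s == (sd - i)%N]|
     & forall i, (i.*2 < sd)%N ->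
       (#|[set s in F | h s == i]| <= #|[set s in F | h s == i.+1]|)%N]].
Proof.
have [x [mu [x0 muP]]] := generic_vector_exists.
pose muv t := \sum_(k < N) tpow x k * \sum_(e in pmt k) mu t e.
pose K := (1 + \sum_t `|muv t| + \sum_t \sum_i `|coord t (fun k : 'I_N => tpow x k) i|
  + \sum_e mon_sum pmg (fun k : 'I_N => x ^ k) e)%N.
have mu_van t : standard t -> ~ facet t ->
    forall i, i \in t -> \sum_(e in pmt i) mu t e = 0.
  by move=> st nf; case: (muP t st nf).
have muv_neq0 t : standard t -> ~ facet t -> muv t != 0.
  by move=> st nf; case: (muP t st nf).
have K_muv t : `|muv t| < K%:Z by apply: absz_lt_sum; rewrite /K; lia.
have K_vc t i : `|coord t (fun k : 'I_N => tpow x k) i| < K%:Z.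
  apply: absz_lt_sum; rewrite /K [X in (_ + X + _)%N](bigD1 t) //=; lia.
have K_gv e : (mon_sum pmg (fun k : 'I_N => x ^ k) e < K)%N.
  by rewrite /K [X in (_ + X)%N](bigD1 e) //=; lia.
pose T := matching_triangulation x0 mu_van muv_neq0 K_muv K_vc k0.
pose W := matching_coherent x0 mu_van muv_neq0 K_muv K_vc k0.
set D := #|_| in T W.
have N0 : (0 < N)%N by apply: leq_ltn_trans (ltn_ord k0).
have [ft _] := tfa_spec x0 mu_van muv_neq0 K_muv mS_zero.
have D0 : (0 < D)%N by apply: facet_card_gt0 ft N0.
exists D, (tmF T), (fun s => #|tmrs T s|); split=> //; first by exists (tfa x K 0%MM).
  move=> n; rewrite (size_SS T); apply: eq_bigr => s Fs; exact: half_open_count.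
move=> r e Se ie Ge.
have rsD s : s \in tmF T -> (#|tmrs T s| <= D)%N by apply: rs_card_le.
(* The interior is counted in two ways: by the reversed half-open cones, and as the translate e +
   S. *)
have eqc j : #|[set s in tmF T | (D - #|tmrs T s|)%N == j]| =
    #|[set s in tmF T | (r + #|tmrs T s|)%N == j]|.
  apply: (cone_count_eq D0) => n.
  transitivity (count interior (mSS n)).
    rewrite (count_interior_total x0 mu_van muv_neq0 K_muv K_vc K_gv n N0).
    apply: eq_bigr => s Fs; rewrite cardsD (F_card Fs).
    by rewrite -[trs x s]/(tmrs T s) (finset.setIidPr (rs_sub Fs)).
  rewrite (count_interior_shift n Se ie Ge); case: leqP => [le_rn|lt_nr]; last first.
    by rewrite big1 // => s _; rewrite /cone_count ifF //; lia.
  rewrite (size_SS T); apply: eq_bigr => s Fs; rewrite half_open_count // /cone_count.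
  by rewrite (_ : (r + #|tmrs T s| <= n)%N = (#|tmrs T s| <= n - r)%N) ?subnDA //; lia.
have ex_sym s : s \in tmF T -> exists2 s', s' \in tmF T & (D - #|tmrs T s'| = r + #|tmrs T s|)%N.
  move=> Fs; have : (0 < #|[set s' in tmF T | (r + #|tmrs T s'|)%N == (r + #|tmrs T s|)%N]|)%N.
    by apply/card_gt0P; exists s; rewrite finset.in_set Fs eqxx.
  rewrite -eqc => /card_gt0P[s']; rewrite finset.in_set => /andP[Fs' /eqP].
  by exists s'.
have le_sd s : s \in tmF T -> (#|tmrs T s| <= D - r)%N.
  by move=> /ex_sym[s' _]; lia.
have le_rD : (r <= D)%N.
  have [F0 _ _] := fa_adm (S_zero T); have [s' _] := ex_sym _ F0; lia.
have sym i : (i <= D - r)%N -> #|[set s in tmF T | #|tmrs T s| == i]| =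
    #|[set s in tmF T | #|tmrs T s| == (D - r - i)%N]|.
  move=> le_i; transitivity #|[set s in tmF T | (r + #|tmrs T s|)%N == (r + i)%N]|.
    by apply: eq_card => s; rewrite !finset.in_set eqn_add2l.
  rewrite -eqc; apply: eq_card => s; rewrite finset.in_set [RHS]finset.in_set.
  case: (boolP (s \in tmF T)) => //= Fs; move: (rsD s Fs) (le_sd s Fs).
  by move: #|tmrs T s| => q le1 le2; apply/eqP/eqP; lia.
exists (D - r)%N; split=> // i lt_i.
apply: (@h_increasing _ _ _ T (mpolyF2_generic _) W (D - r) r e D0) => //.
  by rewrite subnK.
by move=> n m Sm par; apply: interior_half Se ie Ge Sm par.
Qed.

End MatchingMonoid.

(** * Hall's theorem *)

Section Hall.
Variables (T : finType) (r : rel T).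
Implicit Types X Y Z : {set T}.

Definition nbhd Z : {set T} := [set b | [exists a in Z, r a b]].

Lemma nbhdU Z Z' : nbhd (Z :|: Z') = nbhd Z :|: nbhd Z'.
Proof.
apply/setP => b; rewrite !inE; apply/exists_inP/orP => [[a]|].
  by rewrite inE => /orP[aZ|aZ] rab; [left|right]; apply/exists_inP; exists a.
by case=> /exists_inP[a aZ rab]; exists a; rewrite // inE aZ ?orbT.
Qed.

(** Induction on |X|. A critical proper nonempty subset splits the problem in two; without one,
    every such subset has a neighbour to spare, so an arbitrary pair can be matched and removed. *)
Theorem hall_marriage X Y :
    (forall Z, Z \subset X -> (#|Z| <= #|nbhd Z :&: Y|)%N) ->
  exists f : T -> T, (forall a, a \in X -> r a (f a) && (f a \in Y))
    /\ {in X &, injective f}.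
Proof.
have [n] := ubnP #|X|; elim: n X Y => // n IHn X Y; rewrite ltnS => leX HX.
have [X0|[a aX]] := set_0Vmem X.
  by exists id; split=> [a|a b]; rewrite X0 inE.
have [/existsP[Z0 /and4P[sub0 prop0 nz0 crit0]]|ncrit] :=
    boolP [exists Z : {set T}, [&& Z \subset X, Z != X, Z != finset.set0
      & (#|nbhd Z :&: Y| <= #|Z|)%N]].
  have pX : Z0 \proper X by rewrite finset.properEneq prop0.
  have [||f1 [f1r f1i]] := IHn Z0 Y.
  - by apply: leq_trans leX; apply: proper_card.
  - by move=> Z ZZ0; apply: HX; apply: fintype.subset_trans sub0.
  have [||f2 [f2r f2i]] := IHn (X :\: Z0) (Y :\: nbhd Z0).
  - apply: leq_trans leX; apply: proper_card; rewrite properE subsetDl.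
    have [z zZ] : exists z, z \in Z0 by apply/set0Pn.
    apply/subsetPn; exists z; first exact: (fintype.subsetP sub0).
    by rewrite inE zZ.
  - move=> Z /subsetDP[ZX disZ]; have subU : Z :|: Z0 \subset X by rewrite finset.subUset ZX.
    have := HX _ subU; rewrite nbhdU cardsU (_ : Z :&: Z0 = finset.set0) ?cards0 ?subn0; last first.
      by apply/eqP; rewrite finset.setI_eq0.
    have -> : (nbhd Z :|: nbhd Z0) :&: Y =
        (nbhd Z :&: (Y :\: nbhd Z0)) :|: (nbhd Z0 :&: Y).
      apply/setP => b; rewrite !inE; case: (b \in Y); rewrite ?andbF //= ?andbT.
      by case: [exists a in Z0, r a b]; rewrite ?orbT ?orbF ?andbT.
    move=> le; have := leq_trans le (leq_card_setU _ _).
    by move=> le'; rewrite -(leq_add2r #|Z0|); apply: leq_trans le' _; rewrite leq_add2l.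
  exists (fun x => if x \in Z0 then f1 x else f2 x); split=> [x xX|x y xX yX].
    case: ifPn => [/f1r//|xZ]; have := f2r x; rewrite inE xX xZ => /(_ isT)/andP[-> /=].
    by rewrite inE => /andP[].
  have nf u v : u \in X -> u \in Z0 -> v \in X -> v \notin Z0 -> f1 u <> f2 v.
    move=> uX uZ vX vZ e; have /andP[ru _] := f1r u uZ.
    have := f2r v; rewrite inE vX vZ => /(_ isT)/andP[_]; rewrite inE -e => /andP[/negP[]].
    by rewrite inE; apply/exists_inP; exists u.
  case: ifPn => xZ; case: ifPn => yZ; first exact: f1i.
  - by move/(nf _ _ xX xZ yX yZ).
  - by move/esym/(nf _ _ yX yZ xX xZ).
  by apply: f2i; rewrite inE ?xZ ?yZ.
have [b] : exists b, b \in nbhd [set a] :&: Y.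
  by apply/card_gt0P; rewrite -(cards1 a); apply: HX; rewrite finset.sub1set.
rewrite !inE => /andP[/exists_inP[a' /set1P-> rab] bY].
have [||f [fr fi]] := IHn (X :\ a) (Y :\ b).
- by apply: leq_trans leX; rewrite [X in (_ < X)%N](cardsD1 a) aX.
- move=> Z ZX; have [->|nzZ] := eqVneq Z finset.set0; first by rewrite cards0.
  have ZX' : Z \subset X by apply: fintype.subset_trans ZX (subD1set _ _).
  have : (#|Z| < #|nbhd Z :&: Y|)%N.
    rewrite ltnNge; apply: contra ncrit => le; apply/existsP; exists Z.
    rewrite ZX' nzZ le !andbT /=; apply: contraTneq aX => <-.
    by apply/negP => /(fintype.subsetP ZX); rewrite !inE eqxx.
  have -> : nbhd Z :&: (Y :\ b) = (nbhd Z :&: Y) :\ b.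
    by apply/setP => c; rewrite !inE andbCA.
  by rewrite [X in (_ < X)%N -> _](cardsD1 b); case: (b \in _); rewrite ?add0n // => /ltnW.
exists (fun x => if x == a then b else f x); split=> [x xX|x y xX yX].
  case: eqP => [->|/eqP xa]; first by rewrite rab.
  by have := fr x; rewrite !inE xa => /(_ xX)/and3P[-> _ ->].
have nb u : u \in X -> u != a -> f u <> b.
  by move=> uX ua; have := fr u; rewrite !inE ua => /(_ uX)/and3P[_ /eqP].
case: eqP => [->|/eqP xa]; case: eqP => [->|/eqP ya] //.
- by move/esym/(nb _ yX ya).
- by move/(nb _ xX xa).
by apply: fi; rewrite !inE ?xa ?ya.
Qed.

End Hall.

(** * Perfect matchings on the positive edges of a weighted bipartite graph *)

Section Bipartite.
Variables (T : finType) (adj : rel T) (col : T -> bool).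
Hypothesis bip : forall u v, adj u v -> col u != col v.
Local Notation E := (edge adj).

Lemma edge_ends (e : E) : exists u v, [/\ col u, ~~ col v & val e = [set u; v]].
Proof.
case: e => e /= /existsP[u /existsP[v /andP[/bip uv /eqP->]]].
case cu: (col u) uv; case cv: (col v) => // _; first by exists u, v; rewrite cu cv.
by exists v, u; rewrite cu cv finset.setUC.
Qed.

Lemma card_edge_side (e : E) b : #|[set v in val e | col v == b]| = 1%N.
Proof.
have [u [v [cu cv ->]]] := edge_ends e; apply/eqP/cards1P; exists (if b then u else v).
apply/setP => w; rewrite !inE; case: b; apply/andP/eqP.
- by case=> /orP[/eqP->//|/eqP->]; rewrite (negPf cv).
- by move->; rewrite eqxx cu.
- by case=> /orP[/eqP->|/eqP->//]; rewrite cu.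
by move->; rewrite eqxx orbT (negPf cv).
Qed.

Section Weighted.
Variables (F : realDomainType) (x : E -> F) (c : F).
Hypotheses (x_ge0 : forall e, 0 <= x e) (c_gt0 : 0 < c).
Hypothesis x_sum : forall v : T, \sum_(e : E | v \in val e) x e = c.

Lemma sum_over_vertices (Z : {set T}) :
  c *+ #|Z| = \sum_e x e *+ #|val e :&: Z|.
Proof.
rewrite -sumr_const (eq_bigr (fun v : T => \sum_(e : E | v \in val e) x e)); last first.
  by move=> v _; rewrite x_sum.
rewrite (exchange_big_dep xpredT) //=; apply: eq_bigr => e _.
by rewrite -sumr_const; apply: eq_bigl => v; rewrite inE andbC.
Qed.

(** Hall's condition follows by double counting: c|Z| is the weight of the edges meeting Z, and each
    edge of positive weight among them ends in the neighbourhood of Z. A general real domain covers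
    both the integer monoid and the real polytope. *)
Lemma regular_matching : exists2 M, perfect_matching M & forall e : E, e \in M -> 0 < x e.
Proof.
pose X := [set v | col v]; pose Y := [set v | ~~ col v].
pose r : rel T := fun u v => [exists e : E, (val e == [set u; v]) && (0 < x e)].
have Xe (e : E) : #|val e :&: X| = 1%N.
  by rewrite -(card_edge_side e true); apply: eq_card => v; rewrite !inE; case: (col v).
have Ye (e : E) : #|val e :&: Y| = 1%N.
  by rewrite -(card_edge_side e false); apply: eq_card => v; rewrite !inE; case: (col v).
have cXY : #|X| = #|Y|.
  suff : c *+ #|X| = c *+ #|Y| by apply: mulrIn; rewrite gt_eqF.
  by rewrite !sum_over_vertices; apply: eq_bigr => e _; rewrite Xe Ye.
have [Z ZX|f [fr fi]] := @hall_marriage T r X Y.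
  rewrite -(ler_pMn2l c_gt0) !sum_over_vertices; apply: ler_sum => e _.
  have [->|xe] := eqVneq (x e) 0; first by rewrite !mul0rn.
  have x0 : 0 < x e by rewrite lt_def xe x_ge0.
  rewrite ler_pMn2l //; case: (set_0Vmem (val e :&: Z)) => [->|[u]].
    by rewrite cards0.
  rewrite inE => /andP[ue uZ]; apply: leq_trans (_ : 1 <= _)%N.
    by rewrite -(Xe e); apply: subset_leq_card; apply: finset.setIS.
  have cu : col u by have /(_ u uZ) := fintype.subsetP ZX; rewrite inE.
  have [u' [v [cu' cv ev]]] := edge_ends e.
  apply/card_gt0P; exists v; rewrite !inE ev !inE eqxx orbT cv andbT /=.
  apply/exists_inP; exists u => //; apply/existsP; exists e; rewrite x0 andbT ev.
  move: ue; rewrite ev !inE => /orP[/eqP->//|/eqP uv]; first by rewrite uv (negPf cv) in cu.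
have frX u : col u -> r u (f u) /\ ~~ col (f u).
  by move=> cu; have := fr u; rewrite !inE => /(_ cu)/andP[].
have fY : f @: X = Y.
  apply/eqP; rewrite eqEcard card_in_imset // cXY leqnn andbT.
  by apply/fintype.subsetP => w /finset.imsetP[u]; rewrite !inE => cu ->; case: (frX u cu).
pose M := [set e : E | [exists u, (u \in X) && (val e == [set u; f u])]].
have Mx (e : E) : e \in M -> 0 < x e.
  rewrite inE => /existsP[u /andP[]]; rewrite inE => cu /eqP ve.
  have [/existsP[e' /andP[/eqP ve' x0]] _] := frX u cu.
  by have -> : e = e' by apply: val_inj; rewrite ve ve'.
exists M => //; apply/forallP => v.
have [u cu uv] : exists2 u, col u & v \in [set u; f u].
  case cv: (col v); first by exists v; rewrite // !inE eqxx.
  have : v \in Y by rewrite inE cv.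
  by rewrite -fY => /finset.imsetP[u]; rewrite inE => cu ->; exists u; rewrite // !inE eqxx orbT.
have [/existsP[e /andP[/eqP ve x0]] cfu] := frX u cu.
apply/cards1P; exists e; apply/setP => e'; rewrite !inE; apply/andP/eqP => [|->]; last first.
  by split; [apply/existsP; exists u; rewrite inE cu ve eqxx|rewrite ve].
case=> /existsP[u' /andP[]]; rewrite inE => cu' /eqP ve'.
suff eu : v \in val e' -> u' = u by move=> /eu eu'; apply: val_inj; rewrite ve ve' eu'.
rewrite ve' !inE; move: uv; rewrite !inE; have [_ cfu'] := frX u' cu'.
case/orP=> /eqP->; case/orP=> /eqP //.
- by move=> uf; rewrite -uf cu in cfu'.
- by move=> uf; rewrite uf cu' in cfu.
by move=> /esym; apply: fi; rewrite inE.
Qed.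

End Weighted.

End Bipartite.

(** * The perfect matching polytope *)

Section MatchingPolytope.
Variables (R : realType) (T : finType) (adj : rel T) (col : T -> bool) (v0 : T).
Hypothesis bip : forall u v, adj u v -> col u != col v.
Local Notation E := (edge adj).
Local Notation l := #|E|.
Local Notation P := (perfect_matching_polytope adj R).

Definition star (v : T) : {set 'I_l} := [set i : 'I_l | v \in val (enum_val i)].
Local Notation N := (npm star).

Lemma edge_nonempty (e : E) : exists v, v \in val e.
Proof. by have [u [v [_ _ ->]]] := edge_ends bip e; exists u; rewrite !inE eqxx. Qed.

Lemma star_covered i : exists v, i \in star v.
Proof. by have [v ve] := edge_nonempty (enum_val i); exists v; rewrite inE. Qed.

Lemma sum_star (F : nmodType) (f : 'I_l -> F) v :
  \sum_(i in star v) f i = \sum_(e : E | v \in val e) f (enum_rank e).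
Proof.
rewrite (reindex (@enum_rank E)) /=; last exact: onW_bij (enum_rank_bij E).
by apply: eq_bigl => e; rewrite inE enum_rankK.
Qed.

Lemma sum_perfect_matching (F : pzSemiRingType) (M : {set E}) (v : T) :
  perfect_matching M -> \sum_(e : E | v \in val e) (e \in M)%:R = 1 :> F.
Proof.
move=> /forallP/(_ v)/eqP M1; rewrite -[RHS]/(1%:R) -M1 -sum1_card natr_sum.
rewrite big_mkcond [RHS]big_mkcond; apply: eq_bigr => e _.
by rewrite inE; do 2!case: (_ \in _).
Qed.

Lemma perfect_matching_star (M : {set E}) :
  perfect_matching M = pmatch star [set i | enum_val i \in M].
Proof.
apply: eq_forallb => v; congr (_ == _).
rewrite -(card_imset _ (@enum_val_inj E _)) //; apply: eq_card => e.
apply/idP/imsetP => [|[i]]; rewrite !inE.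
  by exists (enum_rank e); rewrite ?enum_rankK // !inE enum_rankK.
by move=> h ->.
Qed.

Definition pme (k : 'I_N) : {set E} := [set e | enum_rank e \in pmt k].

Lemma pme_pm k : perfect_matching (pme k).
Proof.
rewrite perfect_matching_star; have := pmt_pm k; congr (is_true (pmatch _ _)).
by apply/setP => i; rewrite !inE enum_valK.
Qed.

Lemma pme_surj M : perfect_matching M -> exists k, pme k = M.
Proof.
rewrite perfect_matching_star => /pmt_surj[k kM]; exists k.
by apply/setP => e; rewrite inE kM inE enum_rankK.
Qed.

Lemma star_hall n m : mS star n.+1 m ->
  exists2 M, pmatch star M & forall i, i \in M -> (0 < m i)%N.
Proof.
move=> /mSP Sm; pose x (e : E) : int := (m (enum_rank e))%:Z.
have [e|//||M pM Mx] := @regular_matching _ _ _ bip int x n.+1%:Z; first by [].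
  move=> v; rewrite -(Sm v) (Posz_sum _ _ (fun i => m i)).
  by rewrite (sum_star (fun i => (m i)%:Z)).
exists [set i | enum_val i \in M]; first by rewrite -perfect_matching_star.
by move=> i; rewrite inE => /Mx; rewrite /x enum_valK.
Qed.

Definition weighted (c : R) (y : E -> R) : Prop :=
  (forall e, 0 <= y e) /\ forall v : T, \sum_(e : E | v \in val e) y e = c.

Lemma weighted_le c y e : weighted c y -> y e <= c.
Proof.
case=> y0 yc; have [v ve] := edge_nonempty e.
by rewrite -(yc v) (bigD1 e) //= lerDl sumr_ge0.
Qed.

(** A matching in the support is subtracted with its least weight, which removes an edge from the
    support. *)
Lemma weighted_decomposition c y : weighted c y ->
  exists b : 'I_N -> R, [/\ forall k, 0 <= b k, \sum_k b k = c
    & forall e, y e = \sum_k b k * (e \in pme k)%:R].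
Proof.
have [n] := ubnP #|[set e | y e != 0]|; elim: n c y => // n IHn c y; rewrite ltnS => le_n.
move=> wy; have [y0 yc] := wy.
have c0 : 0 <= c by rewrite -(yc v0) sumr_ge0.
have [cE|cN0] := eqVneq c 0.
  exists (fun=> 0); split=> // [|e]; rewrite ?big1 // => [|k _]; last by rewrite mul0r.
  by apply/eqP; rewrite eq_le y0 -cE weighted_le.
have c_gt0 : 0 < c by rewrite lt_def cN0.
have [M pM Mx] := regular_matching bip y0 c_gt0 yc.
have [e0 e0M] : exists e0, e0 \in M.
  have /forallP/(_ v0)/eqP M1 := pM; have /card_gt0P[e] : (0 < #|[set e in M | v0 \in val e]|)%N.
    by rewrite M1.
  by rewrite inE => /andP[eM _]; exists e.
have [e1 e1M e1min] := @Order.TotalTheory.arg_minP _ R E e0 (mem M) y e0M.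
pose d := y e1; pose y' e := y e - d * (e \in M)%:R.
have d0 : 0 < d by apply: Mx.
have wy' : weighted (c - d) y'.
  split=> [e|v]; last by rewrite sumrB yc -mulr_sumr sum_perfect_matching ?mulr1.
  rewrite subr_ge0; case: (boolP (e \in M)) => [/e1min|_]; first by rewrite mulr1.
  by rewrite mulr0.
have [|b [b0 bc bE]] := IHn _ _ _ wy'.
  apply: leq_trans le_n; apply: proper_card; apply/properP; split.
    apply/fintype.subsetP => e; rewrite !inE; apply: contra => /eqP ye.
    rewrite /y' ye sub0r oppr_eq0 mulf_eq0; case: (boolP (e \in M)) => [/Mx|_].
      by rewrite ye ltxx.
    by rewrite eqxx orbT.
  exists e1; first by rewrite inE gt_eqF // Mx.
  by rewrite inE /y' (e1M : e1 \in M) mulr1 subrr eqxx.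
have [k1 k1M] := pme_surj pM.
exists (fun k => b k + d *+ (k == k1)); split=> [k||e].
- by rewrite addr_ge0 // mulrn_wge0 // ltW.
- rewrite big_split /= bc (bigD1 k1) //= eqxx big1 ?addr0 ?subrK // => k /negPf->.
  by rewrite mulr0n.
under eq_bigr do rewrite mulrDl; rewrite big_split /= -bE (bigD1 k1) //= eqxx mulr1n.
rewrite big1 ?addr0 => [|k /negPf->]; last by rewrite mulr0n mul0r.
by rewrite k1M /y' subrK.
Qed.

Local Notation inc k := (incidence R (pme k)).

Lemma sum_scale_inc (b : 'I_N -> R) (e : E) :
  (\sum_k b k *: inc k) e = \sum_k b k * (e \in pme k)%:R :> R.
Proof. by rewrite sum_ffunE; apply: eq_bigr => k _; rewrite !ffunE. Qed.

Lemma polytopeE (y : {ffun E -> R^o}) : P y <-> weighted 1 y.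
Proof.
split=> [[n [a [x [xP a0 a1 ->]]]]|wy].
  have sE (e : E) : (\sum_i a i *: x i) e = \sum_i a i * x i e :> R.
    by rewrite sum_ffunE; apply: eq_bigr => i _; rewrite !ffunE.
  split=> [e|v].
    rewrite sE sumr_ge0 // => i _; rewrite mulr_ge0 //.
    by have [M _ <-] := xP i; rewrite ffunE ler0n.
  under eq_bigr do rewrite sE; rewrite exchange_big /= -a1; apply: eq_bigr => i _.
  rewrite -mulr_sumr; have [M pM <-] := xP i.
  by under eq_bigr do rewrite ffunE; rewrite sum_perfect_matching ?mulr1.
have [b [b0 b1 bE]] := weighted_decomposition wy.
exists N, b, (fun k => inc k); split=> // [k|].
  by exists (pme k) => //; apply: pme_pm.
by apply/ffunP => e; rewrite sum_scale_inc -bE.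
Qed.

Lemma polytope_inc k : P (inc k).
Proof.
apply/polytopeE; split=> [e|v]; first by rewrite ffunE ler0n.
by under eq_bigr do rewrite ffunE; rewrite sum_perfect_matching ?pme_pm.
Qed.

Lemma dilate_polytopeE (t : nat) (y : {ffun E -> R^o}) : (0 < N)%N ->
  dilate t P y <-> weighted t%:R y.
Proof.
move=> N0; split=> [[x /polytopeE[x0 x1] <-]|wy].
  split=> [e|v]; first by rewrite ffunE mulr_ge0 ?ler0n.
  by under eq_bigr do rewrite ffunE; rewrite -mulr_sumr x1 mulr1.
case: t wy => [|t] wy.
  exists (inc (Ordinal N0)); first exact: polytope_inc.
  rewrite scale0r; apply/ffunP => e; rewrite ffunE; apply/esym/eqP.
  by rewrite eq_le (weighted_le e wy) wy.1.
have t0 : t.+1%:R != 0 :> R by rewrite pnatr_eq0.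
exists (t.+1%:R^-1 *: y); last by rewrite scalerA divff // scale1r.
apply/polytopeE; split=> [e|v]; first by rewrite ffunE mulr_ge0 ?invr_ge0 ?ler0n ?wy.1.
by under eq_bigr do rewrite ffunE; rewrite -mulr_sumr wy.2 mulVf.
Qed.

Lemma nb_lattice_pointsE (I : finType) (Q : set {ffun I -> R^o}) (s : seq {ffun I -> int}) :
    uniq s -> (forall z : {ffun I -> int}, Q [ffun i => (z i)%:~R] <-> z \in s) ->
  nb_lattice_points Q = size s.
Proof.
move=> us Qs; rewrite /nb_lattice_points -[in RHS](undup_id us) -card_fseq.
congr #|` _ |%fset; rewrite -[RHS]set_fsetK; congr fset_set.
by apply/seteqP; split=> z /=; rewrite inE => /Qs.
Qed.

Definition point_of (m : 'X_{1..l}) : {ffun E -> int} := [ffun e => (m (enum_rank e))%:Z].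

Lemma point_of_inj : injective point_of.
Proof.
move=> m m' /ffunP mm; apply/mnmP => i; have := mm (enum_val i).
by rewrite !ffunE enum_valK => -[].
Qed.

Lemma weighted_point t m :
  weighted t%:R (fun e => (point_of m e)%:~R) <-> mS star t m.
Proof.
have vs v : \sum_(e : E | v \in val e) (point_of m e)%:~R =
    (\sum_(i in star v) m i)%N%:R :> R.
  rewrite natr_sum (sum_star (fun i => (m i)%:R)); apply: eq_bigr => e _.
  by rewrite ffunE.
split=> [[_ wt]|/mSP Sm].
  by apply/mSP => v; apply/eqP; rewrite -(eqr_nat R) -vs wt.
by split=> [e|v]; [rewrite ffunE ler0n|rewrite vs Sm].
Qed.

Lemma weighted_point_surj c (z : {ffun E -> int}) :
  weighted c (fun e => (z e)%:~R) -> exists m, z = point_of m.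
Proof.
case=> z0 _; exists [multinom `|z (enum_val i)|%N | i < l]; apply/ffunP => e.
by rewrite ffunE mnmE enum_rankK gez0_abs // -(ler0z R).
Qed.

Lemma weighted_ext c (y y' : E -> R) : y =1 y' -> weighted c y -> weighted c y'.
Proof.
move=> yy [y0 yc]; split=> [e|v]; first by rewrite -yy.
by rewrite -(yc v); apply: eq_bigr => e _; rewrite yy.
Qed.

Lemma ehrhart_polytope t : (0 < N)%N -> ehrhart P t = size (mSS star t).
Proof.
move=> N0; rewrite -(size_map point_of); apply: nb_lattice_pointsE.
  by rewrite (map_inj_uniq point_of_inj) mSS_uniq.
move=> z; split=> [/(dilate_polytopeE _ _ N0) wz|/mapP[m]].
  have wz' : weighted t%:R (fun e => (z e)%:~R).
    by apply: weighted_ext wz => e; rewrite ffunE.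
  have [m zE] := weighted_point_surj wz'; rewrite zE map_f // (mSSE star_covered).
  by apply/weighted_point; rewrite -zE.
rewrite (mSSE star_covered) => Sm ->; apply/(dilate_polytopeE _ _ N0).
have /weighted_point : mS star t m by [].
by apply: weighted_ext => e; rewrite [RHS]ffunE.
Qed.

Lemma weighted_essential c y e : weighted c y -> ~~ essential star (enum_rank e) -> y e = 0.
Proof.
move=> wy ne; have [b [_ _ ->]] := weighted_decomposition wy.
rewrite big1 // => k _; suff -> : (e \in pme k) = false by rewrite mulr0.
by apply: contraNF ne => ek; apply/existsP; exists k; rewrite inE in ek.
Qed.

Lemma affine_hull_linear (I : finType) (Q : set {ffun I -> R^o}) (f : {ffun I -> R^o} -> R) c :
    (forall n (a : 'I_n -> R) (x : 'I_n -> {ffun I -> R^o}),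
       f (\sum_i a i *: x i) = \sum_i a i * f (x i)) ->
    (forall y, Q y -> f y = c) ->
  forall y, affine_hull Q y -> f y = c.
Proof.
move=> lf fQ y [n [a [x [xQ a1 ->]]]]; rewrite lf.
by under eq_bigr do rewrite fQ //; rewrite -mulr_suml a1 mul1r.
Qed.

(** Where an essential coordinate vanishes, a small step away from a matching through that edge
    leaves the polytope inside its affine hull. Conversely, vertex sums and inessential coordinates
    are constant on the affine hull, so only essential coordinates could turn negative. *)
Lemma relative_interior_point t m : (0 < t)%N -> (0 < N)%N ->
  relative_interior (dilate t P) [ffun e => (point_of m e)%:~R]
    <-> mS star t m && interior star m.
Proof.
move=> t0 N0; have tR : 0 < t%:R :> R by rewrite ltr0n.
have DE y := dilate_polytopeE t y N0.
have wE : weighted t%:R [ffun e => (point_of m e)%:~R : R^o] <-> mS star t m.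
  rewrite -weighted_point; split; apply: weighted_ext => e; by rewrite ffunE.
split=> [[/DE wy [eps eps0 h]]|/andP[Sm im]].
  have Sm := wE.1 wy; rewrite Sm; apply/forallP => i; apply/implyP => /existsP[k ki].
  rewrite lt0n; apply/negP => /eqP mi0.
  set y : {ffun E -> R^o} := finfun _ in wy h.
  pose e := enum_val i; have ye : y e = 0 by rewrite !ffunE enum_valK mi0.
  (* No coordinate of y - t inc k exceeds 2t in absolute value, so a step of length d moves every
     coordinate by less than [eps]. *)
  pose d := eps / (2 * t%:R + 1); have d0 : 0 < d by rewrite divr_gt0 // addr_gt0 // mulr_gt0.
  pose y' : {ffun E -> R^o} := (1 + d) *: y - (d * t%:R) *: inc k.
  have y'E f : y' f = y f + d * (y f - t%:R * (f \in pme k)%:R).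
    rewrite !ffunE /= -/(y f) ?ffunE /GRing.scale /=; ring.
  have /DE[/(_ e)] : dilate t P y'.
    apply: h.
      exists 2, (fun j => if j == ord0 then 1 + d else - d),
        (fun j => if j == ord0 then y else t%:R *: inc k); split.
      - move=> j; case: ifP => _; first exact/DE.
        by exists (inc k) => //; apply: polytope_inc.
      - by rewrite !big_ord_recl big_ord0 /= addr0 addrK.
      by rewrite !big_ord_recl big_ord0 /= addr0 scaleNr scalerA.
    move=> f; rewrite y'E addrAC subrr add0r normrM (gtr0_norm d0).
    have yt := weighted_le f wy; have y0 := wy.1 f.
    have le2 : `|y f - t%:R * (f \in pme k)%:R : R| <= 2 * t%:R.
      rewrite ler_norml; case: (f \in pme k); rewrite ?mulr1 ?mulr0; apply/andP; split; lra.
    apply: le_lt_trans (ler_wpM2l (ltW d0) le2) _.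
    by rewrite /d mulrAC ltr_pdivrMr ?ltr_pM2l ?ltrDl // addr_gt0 // mulr_gt0.
  rewrite y'E ye sub0r add0r (_ : e \in pme k) ?mulr1; last by rewrite inE enum_valK.
  by rewrite mulrN oppr_ge0 leNgt mulr_gt0.
have wy := wE.2 Sm; split; first exact/DE.
(* Radius 1 suffices: an integral point is at least 1 on every essential edge. *)
exists 1 => // y hy close; apply/DE; split=> [e|v]; last first.
  move: (y) hy; apply: affine_hull_linear => [n a x|z /DE[]] //.
  transitivity (\sum_(e : E | v \in val e) \sum_i a i * x i e).
    by apply: eq_bigr => e _; rewrite sum_ffunE; apply: eq_bigr => i _; rewrite !ffunE.
  by rewrite exchange_big; apply: eq_bigr => i _; rewrite mulr_sumr.
have [ess|ness] := boolP (essential star (enum_rank e)).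
  have := close e; rewrite !ffunE ltr_norml => /andP[+ _].
  have /forallP/(_ (enum_rank e)) := im; rewrite ess /= => m0.
  have m1 : 1 <= (m (enum_rank e))%:~R :> R by rewrite ler1n.
  lra.
suff -> : y e = 0 by [].
move: (y) hy; apply: affine_hull_linear => [n a x|z /DE wz]; last exact: weighted_essential wz ness.
by rewrite sum_ffunE; apply: eq_bigr => i _; rewrite !ffunE.
Qed.

Lemma ehrhart_interior_polytope t : (0 < t)%N -> (0 < N)%N ->
  ehrhart_interior P t = count (interior star) (mSS star t).
Proof.
move=> t0 N0; rewrite -size_filter -(size_map point_of); apply: nb_lattice_pointsE.
  by rewrite (map_inj_uniq point_of_inj) filter_uniq ?mSS_uniq.
move=> z; split=> [ri|/mapP[m]].
  have wz : weighted t%:R (fun e => (z e)%:~R).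
    by have /(dilate_polytopeE _ _ N0) := ri.1; apply: weighted_ext => e; rewrite ffunE.
  have [m zE] := weighted_point_surj wz; rewrite zE map_f // mem_filter (mSSE star_covered).
  by rewrite andbC; apply/(relative_interior_point _ t0 N0); rewrite -zE.
rewrite mem_filter (mSSE star_covered) andbC => h ->.
exact/(relative_interior_point _ t0 N0).
Qed.

Lemma facet_coordinates t x : facet t -> P x ->
  exists b : 'I_N -> R, [/\ \sum_i b i = 1, forall i, i \notin t -> b i = 0
    & x = \sum_i b i *: inc i].
Proof.
move=> ft /polytopeE/weighted_decomposition[b [_ b1 bE]].
exists (fun i => \sum_k b k * (lam t k i)%:~R); split=> [|i ti|].
- rewrite exchange_big /= -[RHS]b1; apply: eq_bigr => k _; rewrite -mulr_sumr.
  have := congr1 (fun z : int => z%:~R : R) (lam_height v0 k ft).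
  by rewrite rmorph_sum /= => ->; rewrite mulr1.
- by rewrite big1 // => k _; rewrite lam_out ?mulr0.
apply/ffunP => e; rewrite bE sum_scale_inc.
under [RHS]eq_bigr do rewrite mulr_suml; rewrite exchange_big; apply: eq_bigr => k _ /=.
have := congr1 (fun z : int => z%:~R : R) (lamE k (enum_rank e) ft).
rewrite /= rmorph_sum /= natz => eE; rewrite inE -[X in _ * X = _]/((_)%:Z%:~R) eE mulr_sumr.
by apply: eq_bigr => i _; rewrite rmorphM /= mulrA inE natz.
Qed.

Lemma facet_differences_free t i0 : facet t -> i0 \in t ->
  free [seq inc i - inc i0 | i <- enum (t :\ i0)].
Proof.
move=> ft ti0; apply/(@freeP _ _ _ (map_tuple (fun i => inc i - inc i0) (enum_tuple (t :\ i0)))).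
move=> k k0 j.
have evP (j' : 'I_#|t :\ i0|) : enum_val j' != i0 /\ enum_val j' \in t.
  by have := enum_valP j'; rewrite !inE => /andP.
pose c i := \sum_(j | enum_val j == i) k j - (\sum_j k j) *+ (i == i0).
have -> : k j = c (enum_val j).
  rewrite /c (negPf (evP j).1) mulr0n subr0 (big_pred1 j) // => j'.
  by rewrite (inj_eq enum_val_inj).
apply: (standard_indep ft.1) => [i ti|i1].
  rewrite /c (_ : (i == i0) = false) ?mulr0n ?subr0; last by apply: contraNF ti => /eqP->.
  by rewrite big_pred0 // => j'; apply: contraNF ti => /eqP<-; case: (evP j').
have /ffunP/(_ (enum_val i1)) := k0.
rewrite sum_ffunE [RHS]ffunE => kE; rewrite -[RHS]kE.
under eq_bigr do rewrite mulrBl; rewrite sumrB.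
rewrite [X in _ - X](bigD1 i0) //= eqxx mulr1n [X in _ - (_ + X)]big1 => [|i /negPf->]; last first.
  by rewrite mulr0n mul0r.
rewrite addr0 mulr_suml -[X in X - _ = _]/(\sum_i (\sum_(j | enum_val j == i) k j) * _).
rewrite [X in X - _](_ : _ = \sum_j k j * (i1 \in pmt (enum_val j))%:R); last first.
  under eq_bigr do rewrite mulr_suml.
  rewrite (exchange_big_dep xpredT) //=; apply: eq_bigr => j' _.
  by rewrite (big_pred1 (enum_val j')) // => i; rewrite eq_sym.
rewrite -sumrB; apply: eq_bigr => j' _; rewrite (nth_map i0) -?cardE // -enum_val_nth.
by rewrite !ffunE !inE enum_valK /GRing.scale /= mulrBr.
Qed.

(** The vertices of a facet form an affine basis: every point of the polytope is an affine
    combination of them, and their differences are free. *)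
Lemma polytope_dim_facet (t : {set 'I_N}) : facet t -> (0 < N)%N -> polytope_dim P = #|t|.-1.
Proof.
move=> ft N0; have [i0 ti0] := card_gt0P (facet_card_gt0 v0 ft N0).
pose B := [seq inc i - inc i0 | i <- enum (t :\ i0)].
have fB : free B by apply: facet_differences_free.
have sB : size B = #|t|.-1 by rewrite size_map -cardE (cardsD1 i0 t) ti0.
rewrite -sB; apply/eqP; rewrite eqn_leq; apply/andP; split.
  apply/bigmax_leqP => d /asboolP[x0 [s [Px0 Ps <- fs]]].
  rewrite -(size_map (fun x => x - x0) s) -(eqP fs); apply: leq_trans (dim_span B).
  apply/dimvS/span_subvP => _ /mapP[x xs ->].
  have [b [b1 bt ->]] := facet_coordinates ft (Ps _ xs).
  have [b' [b1' bt' ->]] := facet_coordinates ft Px0.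
  have -> : \sum_i b i *: inc i - \sum_i b' i *: inc i =
      \sum_(i in t :\ i0) (b i - b' i) *: (inc i - inc i0).
    rewrite [RHS]big_mkcond /= -sumrB.
    transitivity (\sum_i (b i - b' i) *: inc i - (\sum_i (b i - b' i)) *: inc i0).
      rewrite [X in _ - X *: _]sumrB b1 b1' subrr scale0r subr0.
      by apply: eq_bigr => i _; rewrite scalerBl.
    rewrite scaler_suml -sumrB; apply: eq_bigr => i _; rewrite -scalerBr !inE.
    case: eqP => [->|_] /=; first by rewrite subrr scaler0.
    by case: ifPn => // ti; rewrite bt ?bt' // subrr scale0r.
  apply: memv_suml => i ti; apply/memvZ/memv_span/map_f; by rewrite mem_enum.
have ltd : (size B < #|E|.+1)%N.
  rewrite ltnS -(eqP fB); apply: leq_trans (dimvS (subvf _)) _.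
  by rewrite dimvf /dim /= muln1.
apply: (leq_bigmax_cond (Ordinal ltd)); apply/asboolP.
exists (inc i0), [seq inc i | i <- enum (t :\ i0)]; split=> [|x /mapP[i _ ->]||].
- exact: polytope_inc.
- exact: polytope_inc.
- by rewrite /= !size_map.
by rewrite -map_comp.
Qed.

Lemma unimodal_of_interior_minimum (k0 : 'I_N) r e : mS star r e -> interior star e ->
    (forall n m, mS star n m -> interior star m -> (e <= m)%MM) ->
  has_unimodal_h_vector P.
Proof.
move=> Se ie emin.
have [D [F [h [[t ft tD] D0 sz mn]]]] := matching_h_vector v0 star_covered star_hall k0.
have N0 : (0 < N)%N by apply: leq_ltn_trans (ltn_ord k0).
pose H : {poly int} := \sum_(s in F) 'X^(h s).
have HE i : H`_i = #|[set s in F | h s == i]|%:Z.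
  rewrite coef_sum -sum1_card Posz_sum big_mkcond [RHS]big_mkcond; apply: eq_bigr => s _.
  by rewrite inE coefXn eq_sym; case: (s \in F); case: eqP.
exists H => [i|].
  rewrite HE (polytope_dim_facet ft N0) tD prednK //.
  rewrite -(card_cone_series (fun s => s \in F) h i D0); apply: eq_bigr => j _.
  by rewrite ehrhart_polytope // sz.
have [sd [h_le h_sym h_inc]] := mn _ _ Se ie emin.
(* The condition i < [uphalf sd] says 2i < sd. Beyond this peak the symmetry reflects the increasing
   half, and entries after [sd] are zero. *)
exists (uphalf sd); split=> i _ ij; rewrite !HE lez_nat.
  by apply: h_inc; lia.
have [lt_i|ge_i] := ltnP i sd.
  rewrite (h_sym i.+1) // (h_sym i) ?(ltnW lt_i) //.
  have -> : (sd - i = (sd - i.+1).+1)%N by lia.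
  by apply: h_inc; lia.
rewrite [X in (X <= _)%N](_ : _ = 0%N) //; apply/eqP; rewrite cards_eq0.
by apply/eqP/setP => s; rewrite !inE; apply/negP => /andP[/h_le le_s /eqP hs]; lia.
Qed.

Lemma unimodal_of_no_matching : (N = 0)%N -> has_unimodal_h_vector P.
Proof.
move=> N0; exists 0; last by exists 0%N; split=> i; rewrite size_poly0.
have noN (k : 'I_N) : False by case: k => i; rewrite N0.
move=> i; rewrite coef0 big1 // => j _.
suff -> : ehrhart P (i - j) = 0%N by rewrite mulr0.
rewrite -[RHS]/(size (@nil {ffun E -> int})); apply: nb_lattice_pointsE => // z.
split=> // -[x /polytopeE/weighted_decomposition[b [_ b1 _]] _].
suff : \sum_k b k = 0 by rewrite b1 => /eqP; rewrite oner_eq0.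
by rewrite big1 // => k; case: (noN k).
Qed.

Lemma mSS_translate n a m0 : mS star a m0 ->
  {subset [seq (m + m0)%MM | m <- mSS star n] <= mSS star (n + a)}.
Proof.
move=> S0 _ /mapP[m Sm ->]; rewrite !(mSSE star_covered) in Sm *.
exact: mS_add.
Qed.

Lemma mSS_translate_uniq n m0 : uniq [seq (m + m0)%MM | m <- mSS star n].
Proof. by rewrite map_inj_uniq ?mSS_uniq //; apply: addIm. Qed.

Lemma interior_height_gt0 (k0 : 'I_N) n m : mS star n m -> interior star m -> (0 < n)%N.
Proof.
case: n => // /(mS0E star_covered)->.
have /forallP/(_ v0)/eqP/esym : pmatch star (pmt k0) by apply: pmt_pm.
case: (set_0Vmem (pmt k0 :&: star v0)) => [->|[i /setIP[ik _]] _]; first by rewrite cards0.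
move/forallP/(_ i); rewrite mnm0E ltnn implybF => /negP[].
by apply/existsP; exists k0.
Qed.

(** For positive [k], any interior point e of degree k works: adding e embeds degree n - k into the
    interior of degree n, and the equal counts make this a bijection, so every interior point lies
    above e. *)
Theorem unimodal_of_gorenstein : gorenstein P -> has_unimodal_h_vector P.
Proof.
have [/eqP N0|N0] := posnP N; first by move=> _; apply: unimodal_of_no_matching; apply/eqP.
pose k0 := Ordinal N0.
case=> k [gorL gor0]; have [k1|k0'] := ltP 0 k.
  have [K kE] : exists K : nat, k = K%:Z by exists `|k|%N; rewrite gtz0_abs.
  have K0 : (0 < K)%N by rewrite kE in k1.
  have om n : (K <= n)%N -> count (interior star) (mSS star n) = size (mSS star (n - K)).
    move=> le_K; have n0 : (0 < n)%N by apply: leq_trans le_K.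
    rewrite -(ehrhart_interior_polytope n0 N0) gorL ?kE ?lez_nat //.
    by rewrite subzn // ehrhart_polytope.
  have : (0 < count (interior star) (mSS star K))%N.
    rewrite om // subnn lt0n size_eq0; apply/eqP => S0.
    by have := mSSE star_covered 0 0%MM; rewrite S0 in_nil [RHS]mS_zero.
  rewrite -has_count => /hasP[e]; rewrite (mSSE star_covered) => Se ie.
  apply: (unimodal_of_interior_minimum k0 Se ie) => n m Sm im.
  have n0 := interior_height_gt0 k0 Sm im.
  have [le_K|lt_n] := leqP K n; last first.
    have := gor0 n n0; rewrite kE ltz_nat => /(_ lt_n).
    rewrite ehrhart_interior_polytope // => /eqP; rewrite -leqn0 leqNgt -has_count.
    by case/hasP; exists m; rewrite ?(mSSE star_covered).
  have sub : {subset [seq (m + e)%MM | m <- mSS star (n - K)] <=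
      [seq m <- mSS star n | interior star m]}.
    move=> m' m'S; rewrite mem_filter.
    have := mSS_translate Se m'S; rewrite subnK // => ->; rewrite andbT.
    have /mapP[m1 _ ->] := m'S; apply/forallP => i; apply/implyP => ei.
    by rewrite mnmDE ltn_addl //; have /forallP/(_ i) := ie; rewrite ei.
  have [|_ eqm] := uniq_min_size (mSS_translate_uniq (n - K) e) sub.
    by rewrite size_map size_filter om.
  have : m \in [seq m <- mSS star n | interior star m].
    by rewrite mem_filter im (mSSE star_covered).
  by rewrite -eqm => /mapP[m1 _ ->]; rewrite lem_addl.
(* For [k <= 0] the count in degree 1 + |k| is at least that in degree 1, so every matching is
   interior and any one of them can serve as e. *)
have le_k1 : (size (mSS star 1) <= count (interior star) (mSS star 1))%N.
  rewrite -ehrhart_interior_polytope // gorL ?(le_trans k0') // ehrhart_polytope //.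
  have -> : `|1%:Z - k|%N = (1 + `|k|)%N by lia.
  have Sk : mS star `|k| (pmg k0 *+ `|k|)%MM.
    by have := mS_muln `|k|%N (mS_g k0); rewrite mul1n.
  rewrite -(size_map (fun m => (m + pmg k0 *+ `|k|)%MM)).
  exact: uniq_leq_size (mSS_translate_uniq _ _) (mSS_translate Sk).
have all1 : all (interior star) (mSS star 1).
  by rewrite all_count eqn_leq count_size.
have ik0 : interior star (pmg k0).
  by apply: (allP all1); rewrite (mSSE star_covered) -[_ \in _]/(mS star 1 _) mS_g.
apply: (unimodal_of_interior_minimum k0 (mS_g k0) ik0) => n m Sm im.
apply/mnm_lepP => i; rewrite pmgE; case: (boolP (i \in _)) => // ik.
have /forallP/(_ i)/implyP := im; apply; by apply/existsP; exists k0.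
Qed.

(** The all-ones vector is a sum of matchings, so every edge is essential and interior points are
    exactly those with all coordinates at least 1. *)
Theorem unimodal_of_regular r :
  (forall v : T, #|[set e : E | v \in val e]| = r) -> has_unimodal_h_vector P.
Proof.
move=> deg; have [/eqP N0|N0] := posnP N; first by apply: unimodal_of_no_matching; apply/eqP.
pose ones : 'X_{1..l} := [multinom 1%N | i < l].
have S1 : mS star r ones.
  apply/mSP => v; rewrite -(deg v) -sum1_card.
  rewrite (sum_star (F := nat) (fun i => ones i)).
  by apply: eq_big => e; rewrite ?inE // mnmE.
have [c c1 _] := standard_exists v0 star_covered star_hall S1.
have ess i : essential star i.
  apply: contraT => /existsPn ni; have := mnmE (fun=> 1%N) i; rewrite -/ones -c1 msumE big1 //.
  by move=> k _; rewrite pmgE (negPf (ni k)) muln0.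
apply: (unimodal_of_interior_minimum (Ordinal N0) S1).
  by apply/forallP => i; rewrite mnmE implybT.
move=> n m _ /forallP im; apply/mnm_lepP => i; rewrite mnmE.
by have := im i; rewrite ess.
Qed.

End MatchingPolytope.

(** * Grids and tori *)

Lemma edge_degree (T : finType) (adj : rel T) (col : T -> bool) (v : T) :
    (forall u v, adj u v -> col u != col v) -> ssrbool.symmetric adj ->
  #|[set e : edge adj | v \in val e]| = #|[set w | adj v w]|.
Proof.
move=> bip sym; have irr w : adj w w = false.
  by apply/negP => /bip; rewrite eqxx.
rewrite -(card_imset _ val_inj) -(card_in_imset (f := fun w => [set v; w])).
  apply: eq_card => S; apply/imsetP/imsetP => [[e]|[w]]; rewrite inE.
    case: e => e /= eP ve ->; have /existsP[a /existsP[b /andP[ab /eqP eE]]] := eP.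
    move: ve; rewrite eE !inE => /orP[/eqP->|/eqP->]; first by exists b; rewrite ?inE.
    by exists a; rewrite ?inE 1?sym // finset.setUC.
  move=> vw ->; have eP : [exists a, exists b, adj a b && ([set v; w] == [set a; b])].
    by apply/existsP; exists v; apply/existsP; exists w; rewrite vw eqxx.
  by exists (Sub [set v; w] eP); rewrite ?SubK // inE SubK !inE eqxx.
move=> w w'; rewrite !inE => vw vw' /setP/(_ w); rewrite !inE eqxx orbT.
by case/esym/orP => /eqP // wv; rewrite wv irr in vw.
Qed.

Lemma grid_bipartite m n (u v : 'I_n * 'I_m) :
  grid_adj u v -> odd (u.1 + u.2) != odd (v.1 + v.2).
Proof.
case: u v => [a b] [a' b']; rewrite /grid_adj /= => /eqP; lia.
Qed.

(** Adjacency in a cycle of length n. For n = 2 the closing edge coincides with the path edge, and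
    for n = 1 the condition [a != b] excludes the loop. *)
Definition cyclic_adj (n a b : nat) : bool :=
  [|| a.+1 == b, b.+1 == a
    | (a != b) && ((a == 0%N) && (b == n.-1) || (b == 0%N) && (a == n.-1))].

Lemma manhattan_eq1 (a b c d : nat) : (`|a - b| + `|c - d| == 1)%N =
  (c == d) && ((a.+1 == b) || (b.+1 == a)) || (a == b) && ((c.+1 == d) || (d.+1 == c)).
Proof. lia. Qed.

Lemma torus_adjE m n (u v : 'I_n * 'I_m) : torus_adj u v =
  (u.2 == v.2 :> nat) && cyclic_adj n u.1 v.1
  || (u.1 == v.1 :> nat) && cyclic_adj m u.2 v.2.
Proof.
case: u v => [a b] [a' b']; rewrite /torus_adj /grid_adj /cyclic_adj manhattan_eq1.
rewrite xpair_eqE /= -!val_eqE /=.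
case: (a == a' :> nat); case: (b == b' :> nat); rewrite /= ?orbF ?andbF -?orbA //=.
Qed.

Lemma torus_sym m n : ssrbool.symmetric (@torus_adj m n).
Proof. by move=> u v; rewrite !torus_adjE /cyclic_adj; lia. Qed.

(** A closing edge joins 0 to n - 1 or to m - 1, which is odd when the side is even. *)
Lemma torus_bipartite m n (u v : 'I_n * 'I_m) : ~~ odd m -> ~~ odd n ->
  torus_adj u v -> odd (u.1 + u.2) != odd (v.1 + v.2).
Proof.
rewrite torus_adjE /cyclic_adj; have := ltn_ord u.1; have := ltn_ord u.2.
have := ltn_ord v.1; have := ltn_ord v.2; lia.
Qed.

Definition rotate (n k a : nat) : nat := if (a + k < n)%N then (a + k)%N else (a + k - n)%N.

Lemma rotate_lt n k (a : 'I_n) : (k <= n)%N -> (rotate n k a < n)%N.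
Proof. by rewrite /rotate; have := ltn_ord a; case: ifP; lia. Qed.

Lemma rotate_inj n k (a b : 'I_n) : (k <= n)%N ->
  rotate n k a = rotate n k b -> a = b.
Proof.
move=> kn h; apply: val_inj; move: h; rewrite /rotate.
by have := ltn_ord a; have := ltn_ord b; do 2!case: ifP; rewrite /=; lia.
Qed.

Lemma rotate_cyclic n k (a b : 'I_n) : (k <= n)%N ->
  cyclic_adj n a b -> cyclic_adj n (rotate n k a) (rotate n k b).
Proof.
have := ltn_ord a; have := ltn_ord b; rewrite /cyclic_adj /rotate.
by do 2!case: ifP; lia.
Qed.

Lemma rotate_transitive n (a b : 'I_n) : exists2 k, (k <= n)%N & rotate n k a = b.
Proof.
exists (if (a <= b)%N then (b - a)%N else (b + n - a)%N); rewrite /rotate;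
by have := ltn_ord a; have := ltn_ord b; do !case: ifP; lia.
Qed.

(** Rotations act transitively on the vertices; this gives regularity without computing the degree,
    which depends on whether a side has length 2. *)
Lemma torus_degree_le m n (u v : 'I_n * 'I_m) :
  (#|[set w | torus_adj u w]| <= #|[set w | torus_adj v w]|)%N.
Proof.
have [k kn ka] := rotate_transitive u.1 v.1; have [k' km ka'] := rotate_transitive u.2 v.2.
pose f (w : 'I_n * 'I_m) : 'I_n * 'I_m :=
  (Ordinal (rotate_lt w.1 kn), Ordinal (rotate_lt w.2 km)).
have f_inj : injective f.
  by move=> [a b] [a' b'] [/(rotate_inj kn)-> /(rotate_inj km)->].
rewrite -(card_imset _ f_inj); apply: subset_leq_card; apply/fintype.subsetP => w.
case/imsetP=> z; rewrite !inE !torus_adjE => uz -> /=; rewrite -ka -ka'.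
case/orP: uz => /andP[/eqP-> h]; rewrite eqxx (rotate_cyclic _ h) ?orbT //.
Qed.

Theorem theorem1p4 (R : realType) (m n : nat) (m_gt0 : (0 < m)%N)
    (le_mn : (m <= n)%N) :
  (gorenstein (grid_polytope R m n) ->
     has_unimodal_h_vector (grid_polytope R m n))
  /\ (~~ odd m -> ~~ odd n -> has_unimodal_h_vector (torus_polytope R m n)).
Proof.
pose v0 : 'I_n * 'I_m := (Ordinal (leq_trans m_gt0 le_mn), Ordinal m_gt0).
split; first exact: (unimodal_of_gorenstein v0 (@grid_bipartite m n)).
move=> em en; have bip u v := @torus_bipartite m n u v em en.
apply: (@unimodal_of_regular _ _ _ _ v0 bip #|[set w | torus_adj v0 w]|) => v.
rewrite (edge_degree _ bip (@torus_sym m n)).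
by apply/eqP; rewrite eqn_leq !torus_degree_le.
Qed.
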